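(* Let $\{G_n\}_{n=1}^\infty\subset \mathbf{G}_d$ be a convergent graph sequence and let $\mathcal{G}$ be a graphing of vertex degree bound $d$ that is a limit of $\{G_n\}_{n=1}^\infty$. Then $\{G_n\}_{n=1}^\infty$ is a hyperfinite family if and only if $\mathcal{G}$ is hyperfinite.
   Context: Fix an integer $d\ge 1$. $\mathbf{G}_d$ is the set of finite simple graphs with all vertex degrees at most $d$ (up to isomorphism). $U^r_d$ is the finite set of rooted-isomorphism classes of rooted graphs with degrees at most $d$ in which every vertex is at shortest-path distance at most $r$ from the root. For $G\in\mathbf{G}_d$, $r\ge1$, $\alpha\in U^r_d$: $T(G,\alpha)$ is the set of vertices $v$ whose $r$-ball $B_r(v)$ (rooted at $v$) is rooted-isomorphic to $\alpha$, and $p(G,\alpha)=|T(G,\alpha)|/|V(G)|$. The sequence $\{G_n\}$ is convergent if $\lim_n p(G_n,\alpha)$ exists for all $r\ge1$, $\alpha\in U^r_d$. A graphing $\mathcal{G}(X,E,\mu)$ of vertex degree bound $d$ consists of a standard Borel probability space $(X,\mu)$ and a symmetric Borel set $E\subset X\times X$ without diagonal elements, in which every vertex has degree at most $d$, such that every Borel bijection $T:X\to X$ satisfying $T(x)=x$ or $(x,T(x))\in E$ for every $x$ preserves $\mu$. For $\alpha\in U^r_d$, $p(\mathcal{G},\alpha)$ is the $\mu$-measure of the set of $x\in X$ whose $r$-ball is rooted-isomorphic to $\alpha$. $\mathcal{G}$ is a limit of $\{G_n\}$ if $\lim_n p(G_n,\alpha)=p(\mathcal{G},\alpha)$ for all $r\geq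 1$, $\alpha\in U^r_d$. A set $\{G_n\}\subset\mathbf{G}_d$ is a hyperfinite family if for every $\epsilon>0$ there is $K>0$ such that for each $n$ there is $Z_n\subset V(G_n)$ with $|Z_n|<\epsilon|V(G_n)|$ such that after removing all edges incident to $Z_n$ every component of the remaining graph has at most $K$ vertices. A graphing $\mathcal{G}(X,E,\mu)$ is hyperfinite if for every $\epsilon>0$ there are $K>0$ and a Borel set $Z\subset X$ with $\mu(Z)<\epsilon$ such that after removing all edges incident to $Z$ all components have at most $K$ vertices. *)

(* Defs.v *)
From HB Require Import structures.
From mathcomp Require Import all_boot all_order all_algebra.
From mathcomp Require Import all_classical all_reals all_analysis.

Set Implicit Arguments.
Unset Strict Implicit.
Unset Printing Implicit Defensive.

Import Order.TTheory GRing.Theory Num.Theory.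
Import numFieldNormedType.Exports.

Local Open Scope classical_set_scope.
Local Open Scope ring_scope.

Definition gball (V : Type) (e : rel V) (r : nat) (x : V) : set V :=
  [set y | exists p : seq V, [/\ path e x p, y = last x p & (size p <= r)%N]].

Definition gcomponent (V : Type) (e : rel V) (x : V) : set V :=
  [set y | exists2 p : seq V, path e x p & y = last x p].

(* Only edges are removed: the vertices of [Z] stay, as isolated vertices. *)
Definition isolate (V : Type) (e : rel V) (Z : pred V) : rel V :=
  fun x y => [&& e x y, ~~ Z x & ~~ Z y].

(* The vertex set is required to be nonempty, so that p(G, alpha) makes sense. *)
Record bdgraph (d : nat) := BDGraph {
  vertex :> finType;
  adj : rel vertex;
  adj_sym : symmetric adj;
  adj_irr : irreflexive adj;
  adj_deg : forall x, (#|adj x| <= d)%N;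
  vertex_gt0 : (0 < #|vertex|)%N
}.

(* Elements of U^r_d are represented by rooted graphs rather than by their
   isomorphism classes; every use below is invariant under rooted isomorphism. *)
Record rooted_graph (d r : nat) := RootedGraph {
  rg_graph :> bdgraph d;
  rg_root : rg_graph;
  rg_radius : forall x : rg_graph, gball (@adj d rg_graph) r rg_root x
}.

(* The r-ball of [x] is the induced subgraph on [gball e r x], rooted at [x];
   [f] is a rooted isomorphism from [alpha] onto it. *)
Definition ball_iso (V : Type) (e : rel V) (d r : nat)
    (alpha : rooted_graph d r) (x : V) : Prop :=
  exists f : alpha -> V,
    [/\ set_bij [set: alpha] (gball e r x) f, f (rg_root alpha) = x &
        forall a b : alpha, e (f a) (f b) = adj a b].

Definition ball_set (d r : nat) (G : bdgraph d) (alpha : rooted_graph d r)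
    : {set G} :=
  finset (fun v : G => `[< ball_iso (@adj d G) alpha v >]).

Definition ball_freq (R : realType) (d r : nat) (G : bdgraph d)
    (alpha : rooted_graph d r) : R :=
  #|ball_set G alpha|%:R / #|G|%:R.

Definition convergent_graph_seq (R : realType) (d : nat) (G : nat -> bdgraph d)
    : Prop :=
  forall r : nat, (1 <= r)%N -> forall alpha : rooted_graph d r,
    cvgn (fun n => ball_freq R (G n) alpha).

(* Up to isomorphism, the Borel sigma-algebra of a separable complete metric
   space. *)
Definition standard_borel (R : realType) (disp : measure_display)
    (X : measurableType disp) : Prop :=
  exists P : metricType R,
    [/\ exists2 D : set P, countable D & dense D,
        forall u : nat -> P, cauchy (u @ \oo) -> exists l : P, u @ \oo --> l &
        exists2 f : X -> P, bijective f &
          forall A : set P, measurable (f @^-1` A) <-> <<s open >> A].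

(* The inverse of a Borel bijection of a standard Borel space is Borel, hence
   [T] is only required to be measurable in [graphing_inv]. *)
Record is_graphing (R : realType) (d : nat) (disp : measure_display)
    (X : measurableType disp) (mu : probability X R) (E : set (X * X)) : Prop :=
  IsGraphing {
    graphing_standard : standard_borel R X;
    graphing_borel : measurable E;
    graphing_sym : forall x y : X, E (x, y) -> E (y, x);
    graphing_irr : forall x : X, ~ E (x, x);
    graphing_deg : forall x : X, ([set y | E (x, y)] #<= `I_d)%card;
    graphing_inv : forall T : X -> X,
      measurable_fun setT T -> bijective T ->
      (forall x : X, T x = x \/ E (x, T x)) ->
      forall A : set X, measurable A -> mu (T @^-1` A) = mu A
  }.

Definition edge_rel (X : Type) (E : set (X * X)) : rel X :=
  fun x y => (x, y) \in E.

(* For a graphing, the set below is Borel, [E] being Borel and locally finite on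
   a standard Borel space. *)
Definition graphing_freq (R : realType) (d r : nat) (disp : measure_display)
    (X : measurableType disp) (mu : probability X R) (E : set (X * X))
    (alpha : rooted_graph d r) : \bar R :=
  mu [set x | ball_iso (edge_rel E) alpha x].

Definition graphing_limit (R : realType) (d : nat) (G : nat -> bdgraph d)
    (disp : measure_display) (X : measurableType disp) (mu : probability X R)
    (E : set (X * X)) : Prop :=
  forall r : nat, (1 <= r)%N -> forall alpha : rooted_graph d r,
    (ball_freq R (G n) alpha)%:E @[n --> \oo] --> graphing_freq mu E alpha.

Definition hyperfinite_family (R : realType) (d : nat) (G : nat -> bdgraph d)
    : Prop :=
  forall eps : R, 0 < eps ->
  exists2 K : nat, (0 < K)%N &
  forall n : nat, exists Z : {set G n},
    #|Z|%:R < eps * #|G n|%:R /\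
    forall x : G n,
      (#|connect (isolate (@adj d (G n)) (mem Z)) x| <= K)%N.

Definition hyperfinite_graphing (R : realType) (disp : measure_display)
    (X : measurableType disp) (mu : probability X R) (E : set (X * X)) : Prop :=
  forall eps : R, 0 < eps ->
  exists2 K : nat, (0 < K)%N &
  exists Z : set X,
    [/\ measurable Z, (mu Z < eps%:E)%E &
        forall x : X, (gcomponent (isolate (edge_rel E) (mem Z)) x #<= `I_K)%card].

(* Main.v *)
(** A finite graph with its uniform measure and a graphing are both treated as
    "measured graphs".  The claim is that if [A] is [(eps, K)]-hyperfinite and the
    frequencies of the balls of bounded radius of [A] and [B] are close, then [B]
    is [(C eps, K')]-hyperfinite, with bounds that only depend on [d], [eps], [K].

    Let [phi x] be the uniform distribution on the piece of [x] in [A]; it changes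
    along few edges.  Let [f_r x y] be the conditional expectation of [phi x y]
    given the isomorphism type of the [r]-ball of [x] with [y] marked.  Then
    [f_r x] is still a probability distribution, and [f_r x y] is also the
    conditional expectation given the type in which a neighbour [a] of [x] is
    marked as well.  The norms of the [f_r] increase with [r] and are bounded,
    so at some bounded radius the functions [f_r], [f_(r+1)], [f_(r+2)] nearly
    agree; since the balls of [x] and [a] are nested up to radius [1], [f_r x]
    and [f_r a] are then close for most edges.  This is a property of finitely
    many ball frequencies, hence it passes to [B].

    In [B], give the vertices finitely many colours, distinct within distance
    [2K+1], so that a distribution on the [K]-ball becomes a set of tokens
    (colour, threshold) of nearly constant size.  For a random order of the
    tokens, each vertex picks its first token: neighbours disagree with
    probability at most the distance of their distributions, and the vertices
    with a given token and centre lie in one [K]-ball.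

    For a graphing, measurability of ball types and colourings rests on the
    projection theorem for Borel sets with sections of bounded size, obtained
    by separating the projections of [d+1] disjoint cylinders. *)

Require Import Defs.
From HB Require Import structures.
From mathcomp Require Import all_boot all_order all_algebra.
From mathcomp Require Import fingroup perm.
From mathcomp Require Import all_classical all_reals all_analysis.
From mathcomp Require Import zify ring lra.

Set Implicit Arguments.
Unset Strict Implicit.
Unset Printing Implicit Defensive.

Import Order.TTheory GRing.Theory Num.Theory.
Import numFieldNormedType.Exports.

Local Open Scope classical_set_scope.
Local Open Scope ring_scope.

(** * Borel codes and projections with finite sections *)

(** The partition of [A] cannot be copied to [B], because a ball does not show where the pieces end.
    Averaging over ball types makes it readable off balls, but then neighbours [x] and [a] condition
    on different balls. The bridge is [psi], the average of [phi a] given the ball of [x]. On the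
    one hand [f_(r+1) x] and [psi_(r+1)] average [phi x] and [phi a] over the same information, so
    they are no further apart than [phi x] and [phi a]. On the other hand the squared norm of
    [psi_(r+1)] is at most that of [f_(r+2)], which makes it close to [f_r a] once the energies at
    [r] and [r+2] are close. The radius depends on [A], but pigeonhole bounds it in terms of [d],
    [K] and [eps], so one tolerance on frequencies serves all graphs. A type of frequency zero in
    [A] may occur in [B], where the rule need not be a distribution; such vertices are cut.
    Invariance of the measure is only used under finitely many matchings that cover all edges. *)

Section FiniteSections.
Variables (disp : measure_display) (X : measurableType disp) (Z : Type).
Variables (F : set Z) (p : Z -> X) (u : nat -> Z -> nat) (a : nat -> X -> nat).
Variable d : nat.
Hypothesis a_meas : forall i k, measurable [set x | a i x = k].
Hypothesis a_sep : forall x y, (forall i, a i x = a i y) -> x = y.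
Hypothesis u_closed : forall s : nat -> nat,
  (forall n, exists2 z, F z & forall i, (i < n)%N -> u i z = s i) ->
  exists2 z, F z & forall i, u i z = s i.
Hypothesis u_a : forall i z z', F z -> F z' -> u i z = u i z' ->
  a i (p z) = a i (p z').
Hypothesis fiber_bound : forall z : 'I_d.+1 -> Z, (forall j, F (z j)) ->
  (forall j l, p (z j) = p (z l)) -> ~ injective z.

Definition in_cylinder (s : seq nat) (z : Z) :=
  forall i, (i < size s)%N -> u i z = nth 0%N s i.

Definition shadow (s : seq nat) : set X :=
  [set x | exists z, [/\ F z, p z = x & in_cylinder s z]].

(** For [d = 1] this is Luzin's separation of two analytic sets by disjoint Borel sets; for larger
    [d] the Borel sets may overlap, but have no point common to all [d + 1]. *)
Definition separable (q : 'I_d.+1 -> seq nat) :=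
  exists B : 'I_d.+1 -> set X,
    [/\ forall j, measurable (B j), forall j, shadow (q j) `<=` B j &
        forall x, ~ forall j, B j x].

Lemma in_cylinder_rcons s z : in_cylinder s z ->
  in_cylinder (rcons s (u (size s) z)) z.
Proof.
move=> sz i; rewrite size_rcons ltnS leq_eqVlt nth_rcons => /orP[/eqP->|si].
  by rewrite ltnn eqxx.
by rewrite si sz.
Qed.

(** Used in contrapositive form: a non-separable tuple of words stays non-separable under some
    extension by one digit in each word. *)
Lemma separable_split (q : 'I_d.+1 -> seq nat) :
  (forall m : 'I_d.+1 -> nat, separable (fun j => rcons (q j) (m j))) ->
  separable q.
Proof.
move=> sepq.
have /choice[B HB] : forall m : {ffun 'I_d.+1 -> nat}, exists B : 'I_d.+1 -> set X,
    [/\ forall j, measurable (B j),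
        forall j, shadow (rcons (q j) (m j)) `<=` B j &
        forall x, ~ forall j, B j x].
  by move=> m; exact: (sepq m).
(* This is the union over [n] of the intersection of the [B m j] with [m j = n]. A point in all of
   them selects a digit [n j] for each [j], and so lies in every [B m j] for [m = n], which is
   excluded. *)
exists (fun j => \bigcup_n ~` (\bigcup_(m : {ffun 'I_d.+1 -> nat})
   (if m j == n then ~` (B m j) else set0))); split=> [j|j x|x].
- apply: bigcupT_measurable => n; apply: measurableC.
  apply: countable_bigcupT_measurable => // m.
  case: ifP => _ //; apply: measurableC.
  by case: (HB m).
- case=> z [Fz zx sz]; exists (u (size (q j)) z) => //= -[m _].
  case: ifP => //= /eqP mj; apply.
  have [_ + _] := HB m; move/(_ j); apply.
  by exists z; split=> //; rewrite mj; exact: in_cylinder_rcons.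
- move=> xB.
  have /choice[n Hn] : forall j, exists n, (~` (\bigcup_(m : {ffun 'I_d.+1 -> nat})
     (if m j == n then ~` (B m j) else set0))) x.
    by move=> j; have [n _ ?] := xB j; exists n.
  have [_ _ /(_ x)] := HB [ffun j => n j]; apply => j.
  apply: contrapT => nB; apply: (Hn j); exists [ffun j => n j] => //.
  by rewrite ffunE eqxx.
Qed.

Lemma nonseparable_branch (q : 'I_d.+1 -> seq nat) : ~ separable q ->
  exists t : nat -> 'I_d.+1 -> seq nat,
    [/\ t 0%N = q, forall n, ~ separable (t n) &
        forall n j, exists m, t n.+1 j = rcons (t n j) m].
Proof.
move=> nq.
have H : forall w : {q | ~ separable q}, exists w' : {q | ~ separable q},
    forall j, exists m, sval w' j = rcons (sval w j) m.
  case=> w nw.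
  have /existsNP[m nm] : ~ forall m : 'I_d.+1 -> nat,
      separable (fun j => rcons (w j) (m j)).
    by move=> /separable_split.
  by exists (exist (fun q => ~ separable q) _ nm) => j /=; exists (m j).
have /choice[f fP] := H.
exists (fun n => sval (iter n f (exist (fun q => ~ separable q) q nq))); split=> //.
- by move=> n; case: (iter n f _).
- by move=> n j; exact: fP.
Qed.

(** A non-separable tuple extends to [d + 1] infinite codes, realised by points of [F] by
    closedness, and distinct since their first [n] digits are. By the fibre bound two of these
    points have different projections, hence differ in some coordinate [a i]; but that coordinate
    separates the cylinders of length [n + i + 1]. *)
Lemma separable_distinct (n : nat) (q : 'I_d.+1 -> seq nat) :
  injective q -> (forall j, size (q j) = n) -> separable q.
Proof.
move=> qinj szq; apply: contrapT => /nonseparable_branch[t [t0 nt tS]].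
have szt k j : size (t k j) = (n + k)%N.
  elim: k => [|k IH]; first by rewrite t0 addn0.
  by have [m ->] := tS k j; rewrite size_rcons IH addnS.
pose s j i := nth 0%N (t i.+1 j) i.
have tstab k j i : (i < n + k)%N -> nth 0%N (t k j) i = s j i.
  have step l : (i < n + l)%N -> nth 0%N (t l.+1 j) i = nth 0%N (t l j) i.
    by move=> il; have [m ->] := tS l j; rewrite nth_rcons szt il.
  have stepD l e : (i < n + l)%N -> nth 0%N (t (l + e)%N j) i = nth 0%N (t l j) i.
    move=> il; elim: e => [|e IH]; first by rewrite addn0.
    by rewrite addnS step ?IH // (leq_trans il) // leq_add2l leq_addr.
  move=> ik; rewrite /s; case: (leqP k i.+1) => ki.
    by rewrite -(subnKC ki) stepD.
  by rewrite -(subnKC (ltnW ki)) stepD // addnS ltnS leq_addl.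
(* An empty cylinder has an empty shadow, which [set0] would separate. *)
have shad k j : exists2 z, F z & in_cylinder (t k j) z.
  apply: contrapT => nz; apply: (nt k).
  exists (fun l => if l == j then set0 else setT); split=> [l|l x|x].
  - by case: ifP.
  - case: ifP => // /eqP -> [z [Fz _ sz]]; apply: nz; by exists z.
  - by move=> /(_ j); rewrite eqxx.
have /choice[z Hz] : forall j, exists z, F z /\ forall i, u i z = s j i.
  move=> j; have [|z Fz uz] := u_closed (s := s j).
    move=> k; have [z Fz sz] := shad k j; exists z => // i ik.
    by rewrite sz ?szt ?(leq_trans ik) ?leq_addl // tstab // (leq_trans ik) ?leq_addl.
  by exists z.
have zinj : injective z.
  move=> j l zjl; apply: qinj; apply: (@eq_from_nth _ 0%N); rewrite !szq // => i iN.
  rewrite -t0 !tstab ?addn0 //.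
  by case: (Hz j) => _ <-; case: (Hz l) => _ <-; rewrite zjl.
apply: (fiber_bound (z := z)) => //; first by move=> j; case: (Hz j).
move=> j l; apply: contrapT => zjl.
have [i ai] : exists i, a i (p (z j)) <> a i (p (z l)).
  by apply/existsNP => aE; apply: zjl; exact: a_sep.
apply: (nt i.+1).
exists (fun m => if m == j then [set x | a i x = a i (p (z j))]
  else if m == l then [set x | a i x = a i (p (z l))] else setT).
have cylP m x : shadow (t i.+1 m) x -> a i x = a i (p (z m)).
  case=> w [Fw <- sw]; apply: u_a => //; first by case: (Hz m).
  have iN : (i < n + i.+1)%N by rewrite addnS ltnS leq_addl.
  by rewrite sw ?szt // tstab //; case: (Hz m) => _ ->.
split=> [m|m x|x].
- case: ifP => _; first exact: a_meas.
  by case: ifP => _; first exact: a_meas.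
- case: eqP => [->|_]; first exact: cylP.
  by case: eqP => [->|_ //]; exact: cylP.
- move=> H; have := H j; have := H l; rewrite !eqxx /=.
  by case: eqP => [lj|_] /= al aj; apply: ai; [rewrite lj|rewrite -aj al].
Qed.

(** Konig's lemma on an infinite alphabet: the digits extending a given word are bounded, since
    otherwise [d + 1] of them would give as many words on one level. *)
Lemma konig_bounded_levels (P : seq nat -> Prop) :
  (forall s m, P (rcons s m) -> P s) ->
  (forall n, exists2 s, size s = n & P s) ->
  (forall n (q : 'I_d.+1 -> seq nat), injective q ->
     (forall j, size (q j) = n) -> ~ forall j, P (q j)) ->
  exists t : nat -> nat, forall n, P (mkseq t n).
Proof.
move=> Ppre Pall Pfin.
have Pcat s s' : P (s ++ s') -> P s.
  elim/last_ind: s' => [|s' m IH]; rewrite ?cats0 // -rcons_cat.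
  by move/Ppre.
pose ext s := forall n, exists s', (n <= size s')%N /\ P (s ++ s').
have extS s : ext s -> exists m, ext (rcons s m).
  move=> es; apply: contrapT => /forallNP nm.
  have /choice[b Hb] : forall m, exists n, forall s', (n <= size s')%N ->
      ~ P (rcons s m ++ s').
    move=> m; have /existsNP[n nn] := nm m; exists n => s' ns' Ps'.
    by apply: nn; exists s'.
  have [N HN] : exists N, forall m, P (rcons s m) -> (m <= N)%N.
    apply: contrapT => /forallNP unb.
    have unb' N : exists m, P (rcons s m) /\ (N < m)%N.
      have /existsNP[m /not_implyP[Pm mN]] := unb N; exists m; split=> //.
      by rewrite ltnNge; apply/negP.
    have /choice[g Hg] := unb'.
    pose h (k : nat) := iter k.+1 g 0%N.
    have hmono k l : (k < l)%N -> (h k < h l)%N.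
      elim: l => // l IH; rewrite ltnS leq_eqVlt => /orP[/eqP->|kl].
        by rewrite /h [X in (_ < X)%N]iterS; case: (Hg (iter l.+1 g 0%N)).
      apply: ltn_trans (IH kl) _.
      by rewrite /h [X in (_ < X)%N]iterS; case: (Hg (iter l.+1 g 0%N)).
    apply: (Pfin (size s).+1 (fun j : 'I_d.+1 => rcons s (h j))).
    - move=> j l /rcons_inj[] hjl; apply: val_inj => /=.
      by case: (ltngtP j l) => // /hmono; rewrite hjl ltnn.
    - by move=> j; rewrite size_rcons.
    - by move=> j; rewrite /h iterS; case: (Hg (iter j g 0%N)).
  (* An extension longer than the bounds [b m] of all admissible digits; its first digit contradicts
     its own bound. *)
  have [s' [ns' Ps']] := es (\max_(m < N.+1) b m).+1%N.
  case: s' ns' Ps' => // m s' /=; rewrite ltnS -cat_rcons => ns' Ps'.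
  have mN : (m < N.+1)%N by rewrite ltnS HN //; exact: Pcat Ps'.
  apply: (Hb m s' _ Ps').
  by apply: leq_trans ns'; exact: (leq_bigmax (Ordinal mN)).
have H : forall w : {s | ext s}, exists w' : {s | ext s},
    exists m, sval w' = rcons (sval w) m.
  by case=> s es; have [m em] := extS s es; exists (exist ext _ em), m.
have /choice[f fP] := H.
have e0 : ext [::].
  by move=> n; have [s sn Ps] := Pall n; exists s; rewrite sn.
pose w n := iter n f (exist ext _ e0).
have szw n : size (sval (w n)) = n.
  elim: n => [|n IH] //=; have [m ->] := fP (w n); by rewrite size_rcons IH.
exists (fun n => nth 0%N (sval (w n.+1)) n) => n.
suff -> : mkseq (fun n => nth 0%N (sval (w n.+1)) n) n = sval (w n).
  have [s' [_ +]] := svalP (w n) 0%N; exact: Pcat.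
elim: n => [|n IH]; first by rewrite (size0nil (szw 0%N)).
rewrite mkseqS IH.
have [m mE] := fP (w n).
have -> : sval (w n.+1) = rcons (sval (w n)) m by [].
by rewrite nth_rcons szw ltnn eqxx.
Qed.

(** In general an intersection over [n] of unions over words of length [n] only contains the image.
    Here a point lies in [W] of at most [d] words per level, so these words form a tree with an
    infinite branch. As [F] is closed, the branch is the code of a point of [F], which projects to
    the given point because [W] records the coordinates. *)
Lemma measurable_image_finite_sections : measurable (p @` F).
Proof.
have /choice[B HB] : forall q : {ffun 'I_d.+1 -> seq nat}, exists B : 'I_d.+1 -> set X,
    (forall j, measurable (B j)) /\
    (forall n, injective q -> (forall j, size (q j) = n) ->
    [/\ forall j, shadow (q j) `<=` B j & forall x, ~ forall j, B j x]).
  move=> q; have [[n [qi sq]]|nn] := pselect (exists n, injective q /\ forall j, size (q j) = n).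
    by have [B [? ? ?]] := separable_distinct qi sq; exists B; split.
  by exists (fun=> set0); split=> // n qi sq; exfalso; apply: nn; exists n.
pose good (q : {ffun 'I_d.+1 -> seq nat}) :=
  injective q /\ exists n, forall j, size (q j) = n.
(* [W s] contains [shadow s], records the fibre coordinates, and any [d + 1] of
   these sets on a common level have empty intersection. *)
pose W (s : seq nat) : set X :=
  if pselect (exists2 z, F z & in_cylinder s z) is left e then
    [set x | forall i, (i < size s)%N -> a i x = a i (p (s2val (cid2 e)))] `&`
    ~` (\bigcup_(q : {ffun 'I_d.+1 -> seq nat}) \bigcup_(j : 'I_d.+1)
      (if `[< good q >] && (q j == s) then ~` (B q j) else set0))
  else set0.
have mW s : measurable (W s).
  rewrite /W; case: pselect => // e; apply: measurableI.
    have -> : [set x | forall i, (i < size s)%N -> a i x = a i (p (s2val (cid2 e)))] =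
        \bigcap_(i in [set i | (i < size s)%N]) [set x | a i x = a i (p (s2val (cid2 e)))].
      by apply/seteqP; split=> x /= H i; exact: H.
    by apply: bigcap_measurableType => i _; exact: a_meas.
  apply: measurableC; apply: countable_bigcupT_measurable => // q.
  apply: countable_bigcupT_measurable => // j.
  by case: ifP => // _; apply: measurableC; case: (HB q).
have subW s : shadow s `<=` W s.
  move=> x [z [Fz zx sz]]; rewrite /W; case: pselect => [e|]; last first.
    by case; exists z.
  split=> [i si|[q _ [j _]]].
    rewrite -zx; case: cid2 => z' /= Fz' sz'; apply: u_a => //.
    by rewrite sz // sz'.
  case: ifP => // /andP[/asboolP[qi [n sq]] /eqP qs]; apply.
  case: (HB q) => _ /(_ n qi sq)[+ _]; apply.
  by exists z; rewrite qs.
have W_distinct n (q : 'I_d.+1 -> seq nat) : injective q ->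
    (forall j, size (q j) = n) -> forall x, ~ forall j, W (q j) x.
  move=> qi sq x xW.
  have qfi : injective [ffun j => q j].
    by move=> j l; rewrite !ffunE; exact: qi.
  have sqf j : size ([ffun j => q j] j) = n by rewrite ffunE.
  case: (HB [ffun j => q j]) => _ /(_ n qfi sqf)[_ /(_ x)]; apply => j.
  have := xW j; rewrite /W; case: pselect => // e [_ +].
  apply: contra_notP => nB; exists [ffun j => q j] => //; exists j => //.
  rewrite ffunE eqxx andbT; case: ifP => // /asboolPn; apply.
  by split=> //; exists n.
have -> : p @` F = \bigcap_n \bigcup_(s : seq nat)
   (if size s == n then \bigcap_k W (take k s) else set0).
  apply/seteqP; split=> x /=.
    case=> z Fz <- n _; exists (mkseq (fun i => u i z) n) => //.
    rewrite size_mkseq eqxx => k _; apply: subW; exists z; split=> // i.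
    rewrite size_take size_mkseq => ik.
    rewrite nth_take ?nth_mkseq //; first by move: ik; case: ifP => //; lia.
    by move: ik; case: ifP => //; lia.
  move=> xI.
  have [|||t Ht] := @konig_bounded_levels (fun s => forall k, W (take k s) x).
  - move=> s m H k; case: (leqP k (size s)) => ks.
      by have := H k; rewrite -cats1 takel_cat.
    by have := H (size s); rewrite -cats1 take_size_cat // (take_oversize (ltnW ks)).
  - move=> n; have [s _] := xI n I.
    by case: eqP => // sn Ws; exists s => // k; exact: Ws.
  - move=> n q qi sq H; apply: (W_distinct n q qi sq x) => j.
    by have := H j (size (q j)); rewrite take_size.
  have Wt n : W (mkseq t n) x by have := Ht n n; rewrite take_oversize // size_mkseq.
  have Ft n : exists2 z, F z & in_cylinder (mkseq t n) z.
    by have := Wt n; rewrite /W; case: pselect.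
  have [|z Fz uz] := u_closed (s := t).
    move=> n; have [z Fz sz] := Ft n; exists z => // i iN.
    by rewrite sz ?size_mkseq // nth_mkseq.
  exists z => //; apply: a_sep => i.
  have := Wt i.+1; rewrite /W; case: pselect => // e [/(_ i) + _].
  rewrite size_mkseq => /(_ (leqnn _)) ->.
  case: cid2 => z' /= Fz' sz'; apply: u_a => //.
  by rewrite uz sz' ?size_mkseq // nth_mkseq.
apply: bigcapT_measurable => n; apply: countable_bigcupT_measurable => // s.
by case: ifP => // _; apply: bigcapT_measurable => k; exact: mW.
Qed.

End FiniteSections.

(* The map [z |-> (b z, c z)] sends [S] onto a closed subset of the Baire space.
   Nothing is asked of [c], which need not be measurable. *)
Definition closed_code (Z : Type) (S : set Z) (b c : nat -> Z -> nat) :=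
  forall s t : nat -> nat,
    (forall n, exists2 z, S z & forall i, (i < n)%N -> b i z = s i /\ c i z = t i) ->
    exists2 z, S z & forall i, b i z = s i /\ c i z = t i.

(** * Polish spaces as closed sets of codes *)

Section PolishCode.
Variables (R : realType) (P : metricType R) (p0 : P).

Lemma dense_sequence (D : set P) : countable D -> dense D ->
  exists q : nat -> P, forall p (e : R), 0 < e -> exists k, mdist p (q k) < e.
Proof.
move=> /countable_injP[g gi] dD.
have /choice[q Hq] : forall k, exists p : P, forall p', D p' -> g p' = k -> p = p'.
  move=> k; have [[p [Dp gp]]|np] := pselect (exists p, D p /\ g p = k).
    by exists p => p' Dp' gp'; apply: gi; rewrite ?inE // gp.
  by exists p0 => p' Dp' gp'; exfalso; apply: np; exists p'.
exists q => p e e0.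
have [||p' [/interior_subset pp' Dp']] := dD (interior (ball p e)).
- exists p; exact: nbhsx_ballx.
- exact: open_interior.
by exists (g p'); rewrite (Hq (g p') p') //; move: pp'; rewrite ballEmdist.
Qed.

Variable q : nat -> P.
Hypothesis q_dense : forall p (e : R), 0 < e -> exists k, mdist p (q k) < e.
Hypothesis P_complete :
  forall u : nat -> P, cauchy (u @ \oo) -> exists l : P, u @ \oo --> l.

Let near_centre n k p := mdist p (q k) <= n.+1%:R^-1.

Let near_ex n p : exists k, near_centre n k p.
Proof.
have [|k /ltW] := @q_dense p n.+1%:R^-1; first by rewrite invr_gt0.
by exists k.
Qed.

Definition centre_code n p := ex_minn (near_ex n p).

Let disj m k n k' := `[< ~ exists p, near_centre m k p /\ near_centre n k' p >].

(** A point outside ball [k] has positive excess distance to it; a ball containing the point misses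
    ball [k] as soon as its diameter is below that excess. *)
Let disj_ex n k p : (k < centre_code n p)%N -> exists m, disj m (centre_code m p) n k.
Proof.
rewrite /centre_code; case: ex_minnP => c _ cmin kc.
have nk : ~ near_centre n k p by move/cmin; rewrite leqNgt kc.
have pos : 0 < (mdist p (q k) - n.+1%:R^-1) / 2.
  by rewrite divr_gt0 // subr_gt0 ltNge; apply/negP.
have [m Hm] : exists m, m.+1%:R^-1 < (mdist p (q k) - n.+1%:R^-1) / 2.
  have := near_infty_natSinv_lt (PosNum pos).
  by case=> m _ /(_ m (leqnn m)) /= ?; exists m.
exists m; apply/asboolP => -[p' []]; rewrite /near_centre.
case: ex_minnP => c' pc' _ p'c' p'k.
have := metric_triangle p p' (q k); have := metric_triangle p (q c') p'.
rewrite [mdist (q c') p']metric_sym; rewrite /near_centre in pc' *.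
move: Hm; set x := m.+1%:R^-1 in pc' p'c' *; set y := n.+1%:R^-1 in p'k *; lra.
Qed.

(* For each ball of index [k < centre_code n p], the first level at which the
   ball chosen for [p] is disjoint from it: this makes a closed set out of the
   G-delta set of the centre codes. *)
Definition witness_code j p : nat :=
  let nk := odflt (0, 0)%N (unpickle j : option (nat * nat)) in
  if pselect (nk.2 < centre_code nk.1 p)%N is left h then ex_minn (disj_ex h) else 0%N.

Lemma centre_code_dist n p : mdist p (q (centre_code n p)) <= n.+1%:R^-1.
Proof. by rewrite /centre_code; case: ex_minnP. Qed.

(** Points realising longer and longer parts of the code form a Cauchy sequence, whose limit [l]
    lies in all prescribed closed balls. If an index [c] below [s i] were possible for [l], the
    witness code would name a prescribed ball disjoint from ball [c], although [l] lies in both. The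
    witnesses of [l] are then correct because each depends on finitely many centre codes. *)
Lemma closed_centre_code : closed_code setT centre_code witness_code.
Proof.
move=> s t H.
have /choice[x Hx] : forall n, exists p, forall i, (i < n)%N ->
    centre_code i p = s i /\ witness_code i p = t i.
  by move=> n; have [p _ ?] := H n; exists p.
have xs n i : (i < n)%N -> mdist (x n) (q (s i)) <= i.+1%:R^-1.
  by move=> /Hx[<- _]; exact: centre_code_dist.
have inv_lt (e : R) : 0 < e -> exists i, i.+1%:R^-1 < e.
  move=> e0; have := near_infty_natSinv_lt (PosNum e0).
  by case=> m _ /(_ m (leqnn m)) /= ?; exists m.
have [|l xl] := P_complete (u := x).
  apply: cauchy_exP => e e0; have [i ie] := inv_lt e e0.
  exists (q (s i)); exists i.+1 => // n /= /xs; rewrite ballEmdist /= metric_sym.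
  by move=> h; exact: le_lt_trans ie.
have ls i : near_centre i (s i) l.
  apply/ler_addgt0Pl => e e0.
  have /cvg_ballP/(_ e e0)[N _ HN] := xl.
  have := HN (maxn N i.+1) (leq_maxl _ _).
  have := @xs (maxn N i.+1) i (leq_maxr _ _).
  rewrite ballEmdist /=; have := metric_triangle l (x (maxn N i.+1)) (q (s i)).
  move: (i.+1%:R^-1) => y; lra.
have cl i : centre_code i l = s i.
  rewrite {1}/centre_code; case: ex_minnP => c lc cmin.
  apply/eqP; rewrite eqn_leq cmin //= leqNgt; apply/negP => csi.
  pose j := pickle (i, c); pose N := (maxn (maxn i j) (t j)).+1.
  have iN : (i < N)%N by rewrite ltnS leq_max leq_maxl.
  have jN : (j < N)%N by rewrite ltnS leq_max leq_maxr.
  have tN : (t j < N)%N by rewrite ltnS leq_maxr.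
  have := (Hx N j jN).2; rewrite /witness_code pickleK /=.
  have c1 : (c < centre_code i (x N))%N by rewrite (Hx N i iN).1.
  case: pselect => [h|]; last by rewrite c1.
  case: ex_minnP => m dm _ mt; move: dm; rewrite mt.
  rewrite (Hx N (t j) tN).1 => /asboolP; apply; exists l; split=> //.
exists l => // j; split=> //.
set nk := odflt (0, 0)%N (unpickle j : option (nat * nat)).
pose N := (maxn (maxn nk.1 j) (t j)).+1.
have iN : (nk.1 < N)%N by rewrite ltnS leq_max leq_maxl.
have jN : (j < N)%N by rewrite ltnS leq_max leq_maxr.
have tN : (t j < N)%N by rewrite ltnS leq_maxr.
have := (Hx N j jN).2; rewrite /witness_code -/nk.
have E : (nk.2 < centre_code nk.1 (x N))%N = (nk.2 < centre_code nk.1 l)%N.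
  by rewrite cl (Hx N _ iN).1.
case: pselect => h1; case: pselect => h2 //.
- case: ex_minnP => m dm mmin mt; case: ex_minnP => m' dm' m'min.
  have ml k : (k <= t j)%N -> centre_code k l = centre_code k (x N).
    by move=> kt; rewrite cl (Hx N k _).1 // (leq_ltn_trans kt).
  rewrite -mt in ml *.
  have le1 : (m' <= m)%N by apply: m'min; rewrite ml.
  by apply/eqP; rewrite eqn_leq le1 mmin //= -ml.
- by move: h2; rewrite -E h1.
- by move: h1; rewrite E h2.
Qed.

Lemma centre_code_inj p p' : (forall i, centre_code i p = centre_code i p') -> p = p'.
Proof.
move=> E; apply: mdist_positivity; apply/eqP; rewrite eq_le mdist_ge0 andbT.
apply/ler_addgt0Pl => e e0; rewrite addr0.
have e20 : 0 < e / 2 by rewrite divr_gt0.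
have := near_infty_natSinv_lt (PosNum e20).
case=> m _ /(_ m (leqnn m)) /= me.
have := centre_code_dist m p; have := centre_code_dist m p'; rewrite -E.
have := metric_triangle p (q (centre_code m p)) p'.
rewrite [mdist (q _) p']metric_sym; move: me; move: (m.+1%:R^-1) => y; lra.
Qed.

(** [T] is arbitrary in order to be instantiated with the sets whose preimage in another space
    belongs to a given sigma-algebra. *)
Lemma open_centre_code (T : set (set P)) : sigma_algebra setT T ->
  (forall i k, T [set p | centre_code i p = k]) -> forall U, open U -> T U.
Proof.
move=> [T0 TC TU] Tc U oU.
have -> : U = \bigcup_n \bigcup_k
  (if `[< [set p | centre_code n p = k] `<=` U >] then [set p | centre_code n p = k] else set0).
  apply/seteqP; split=> p /=.
    move=> Up; have /nbhs_ballP[e /= e0 eU] := open_nbhs_nbhs (conj oU Up).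
    have e20 : 0 < e / 2 by rewrite divr_gt0.
    have := near_infty_natSinv_lt (PosNum e20).
    case=> m _ /(_ m (leqnn m)) /= me.
    exists m => //; exists (centre_code m p) => //.
    case: ifP => // /asboolPn; apply => p' /= pp'; apply: eU.
    rewrite ballEmdist /=.
    have := centre_code_dist m p; have := centre_code_dist m p'; rewrite pp'.
    have := metric_triangle p (q (centre_code m p)) p'.
    rewrite [mdist (q _) p']metric_sym; move: me; move: (m.+1%:R^-1) => y; lra.
  by case=> n _ [k _]; case: ifP => // /asboolP; apply.
by apply: (TU) => n; apply: TU => k; case: ifP.
Qed.

Lemma measurable_centre_code n k : <<s open >> [set p | centre_code n p = k].
Proof.
have [T0 TC TU] := smallest_sigma_algebra setT (@open P).
have nm m j : <<s open >> [set p | near_centre m j p].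
  have -> : [set p | near_centre m j p] = setT `\` [set p | m.+1%:R^-1 < mdist p (q j)].
    apply/seteqP; split=> p /=; rewrite /near_centre; first by move=> h; split=> //; rewrite ltNge h.
    by case=> _ /negP; rewrite -leNgt.
  apply: (TC); apply: sub_sigma_algebra.
  rewrite openE => /= p pj.
  have e0 : 0 < mdist p (q j) - m.+1%:R^-1 by rewrite subr_gt0.
  apply/nbhs_ballP; exists (mdist p (q j) - m.+1%:R^-1) => //= p'.
  rewrite ballEmdist /=; have := metric_triangle p p' (q j); move: (m.+1%:R^-1) => y; lra.
have -> : [set p | centre_code n p = k] =
  setT `\` ((setT `\` [set p | near_centre n k p]) `|` \bigcup_j
     (if (j < k)%N then [set p | near_centre n j p] else set0)).
  apply/seteqP; split=> p /=; rewrite /centre_code; case: ex_minnP => c pc cmin.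
    move=> <-; split=> // -[[_]|[j _]]; first by apply.
    by case: ifP => // jc /cmin; rewrite leqNgt jc.
  case=> _ /not_orP[/not_andP[//|/contrapT pk] H].
  apply/eqP; rewrite eqn_leq cmin //= leqNgt; apply/negP => ck.
  by apply: H; exists c => //; rewrite ck.
apply: (TC); rewrite -bigcup2E; apply: (TU) => -[|[|?]] //=; first exact: TC.
by apply: TU => j; case: ifP.
Qed.

End PolishCode.

(** The last clause says that the level sets of the [a i] generate the Borel sets, in the form of an
    induction principle. *)
Lemma standard_borel_code (R : realType) (disp : measure_display)
    (X : measurableType disp) : standard_borel R X ->
  exists a w : nat -> X -> nat,
    [/\ forall i k, measurable [set x | a i x = k],
        forall x y, (forall i, a i x = a i y) -> x = y,
        closed_code setT a w &
        forall T : set (set X), sigma_algebra setT T ->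
          (forall i k, T [set x | a i x = k]) -> forall A, measurable A -> T A].
Proof.
case=> P [[D cD dD] cP [f [g fK gK] fm]].
have [q Hq] := dense_sequence (f point) cD dD.
exists (fun i x => centre_code Hq i (f x)), (fun i x => witness_code Hq i (f x)).
split.
- by move=> i k; apply/(fm [set p | centre_code Hq i p = k]); exact: measurable_centre_code.
- by move=> x y /centre_code_inj /(can_inj fK).
- move=> s t H; have [|l _ Hl] := @closed_centre_code _ _ _ Hq cP s t.
    by move=> n; have [x _ Hx] := H n; exists (f x).
  by exists (g l) => // i; rewrite gK.
- move=> T [T0 TC TU] Tc A mA.
  have AE : A = f @^-1` (g @^-1` A) by apply/seteqP; split=> x /=; rewrite fK.
  rewrite AE in mA *; move/fm in mA.
  pose T' := [set B : set P | T (f @^-1` B)].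
  have sT' : sigma_algebra setT T'.
    split=> [|B TB|B TB]; rewrite /T' /= ?preimage_set0 //.
      by rewrite setTD preimage_setC -setTD; exact: TC.
    by rewrite preimage_bigcup; exact: TU.
  move: (g @^-1` A) mA; apply: smallest_sub => //.
  by move=> U; apply: (open_centre_code (q_dense := Hq) sT') => i k; exact: (Tc i k).
Qed.

Lemma card_le_IP (T : choiceType) (A : set T) (n : nat) :
  (A #<= `I_n)%card <->
  forall s : seq T, uniq s -> (forall y, y \in s -> A y) -> (size s <= n)%N.
Proof.
split.
  move=> /pcard_leP/unsquash f s us sA.
  have fs : uniq [seq f y | y <- s].
    by rewrite map_inj_in_uniq // => x y xs ys; apply: inj; rewrite inE; exact: sA.
  have := uniq_leq_size (s2 := iota 0 n) fs; rewrite size_map size_iota; apply.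
  move=> _ /mapP[y ys ->]; rewrite mem_iota add0n /=.
  have : `I_n (f y) by apply: funS; exact: sA.
  by [].
move=> H.
pose Q m := `[< exists s : seq T, [/\ uniq s, forall y, y \in s -> A y & size s = m] >].
have Q0 : exists m, Q m by exists 0%N; apply/asboolP; exists [::].
have Qn m : Q m -> (m <= n)%N by move=> /asboolP[s [us sA <-]]; exact: H.
case: (ex_maxnP Q0 Qn) => m /asboolP[s [us sA sm]] mmax.
have As : A `<=` [set` s].
  move=> y Ay /=; apply: contrapT => /negP ys.
  have : Q m.+1.
    apply/asboolP; exists (y :: s); split=> /=; rewrite ?ys ?sm //.
    by move=> z; rewrite inE => /orP[/eqP->|/sA].
  by move/mmax; rewrite ltnn.
case: s us sA As {sm} => [|x0 s] us sA As.
  by have -> : A = set0; [apply/seteqP; split=> // y /As | exact: card_ge0].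
have sub : A `<=` nth x0 (x0 :: s) @` `I_(size (x0 :: s)).
  move=> y /As ys; exists (index y (x0 :: s)); last exact: nth_index.
  by have := index_mem y (x0 :: s); rewrite ys.
apply: card_le_trans (subset_card_le sub) (card_le_trans (card_image_le _ _) _).
by rewrite card_le_II; exact: H.
Qed.

(** * Borel sets as sets with closed codes *)

Section Codable.
Variables (Z : Type) (b : nat -> Z -> nat).
Hypothesis b_sep : forall z z', (forall i, b i z = b i z') -> z = z'.

(** The classical refinement of topologies: the additional coordinates [c] make [S] closed. *)
Definition codable (S : set Z) := exists c, closed_code S b c.

(** The codes of all [S k] are interleaved. The limit points found for the different [k] share the
    coordinates [b], so they coincide. *)
Lemma codable_bigcap (S : nat -> set Z) : (forall k, codable (S k)) ->
  codable (\bigcap_k S k).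
Proof.
move=> /choice[c Hc].
pose e j := odflt (0, 0)%N (unpickle j : option (nat * nat)).
have eK k i : e (pickle (k, i)) = (k, i) by rewrite /e pickleK.
exists (fun j z => c (e j).1 (e j).2 z) => s t H.
have /choice[z Hz] : forall k, exists z, S k z /\
    forall i, b i z = s i /\ c k i z = t (pickle (k, i)).
  move=> k; have [|z Sz zE] := Hc k s (fun i => t (pickle (k, i))); last by exists z.
  move=> n; pose N := (\max_(i < n.+1) maxn i (pickle (k, nat_of_ord i))).+1.
  have [z Sz zE] := H N; exists z => [|i iN]; first exact: Sz.
  have iN' : (i < n.+1)%N by rewrite ltnS ltnW.
  have mi := leq_bigmax (F := fun i : 'I_n.+1 => maxn i (pickle (k, nat_of_ord i)))
    (Ordinal iN').
  have [|-> _] := zE i; first by rewrite ltnS (leq_trans _ mi) // leq_maxl.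
  have [|_] := zE (pickle (k, i)); first by rewrite ltnS (leq_trans _ mi) // leq_maxr.
  by rewrite eK /=.
have zE k : z k = z 0%N.
  by apply: b_sep => i; case: (Hz k) => _ /(_ i)[-> _]; case: (Hz 0%N) => _ /(_ i)[-> _].
exists (z 0%N) => [k _|j]; first by rewrite -(zE k); case: (Hz k).
case: (Hz 0%N) => _ /(_ j)[-> _]; split=> //.
case ej: (e j) => [k i] /=; rewrite -(zE k).
case: (Hz k) => _ /(_ i)[_ ->].
have [w Sw wE] := H (maxn j (pickle (k, i))).+1.
have [|_] := wE j; first by rewrite ltnS leq_maxl.
have [|_] := wE (pickle (k, i)); first by rewrite ltnS leq_maxr.
by rewrite ej eK /= => -> ->.
Qed.

(** The first digit stores the index of the set containing the point; by disjointness it is the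
    right index for the limit point too. *)
Lemma codable_disjoint_bigcup (S : nat -> set Z) : (forall k, codable (S k)) ->
  (forall k l z, S k z -> S l z -> k = l) -> codable (\bigcup_k S k).
Proof.
move=> /choice[c Hc] dis.
have /choice[k Hk] : forall z, exists k, (exists l, S l z) -> S k z.
  move=> z; have [[l Sl]|n] := pselect (exists l, S l z); first by exists l.
  by exists 0%N => /n.
exists (fun j z => if j is j'.+1 then c (k z) j' z else k z) => s t H.
have [|z Sz zE] := Hc (t 0%N) s (fun i => t i.+1).
  move=> n; have [z [l _ Sz] zE] := H n.+1; have [_ kt] := zE 0%N isT.
  have Skz : S (k z) z by apply: Hk; exists l.
  exists z; first by rewrite -kt.
  move=> i iN; rewrite -kt; split; first by case: (zE i _) => //; exact: leqW.
  by case: (zE i.+1 _).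
have kz : k z = t 0%N by apply: (dis _ _ z) => //; apply: Hk; exists (t 0%N).
exists z; first by exists (t 0%N).
move=> i; split; first by case: (zE i).
by case: i => [//|i]; rewrite kz; case: (zE i).
Qed.

Hypothesis codableT : codable setT.

Lemma codable_finitary (S : set Z) (N : nat) :
  (forall z z', (forall i, (i < N)%N -> b i z = b i z') -> S z -> S z') -> codable S.
Proof.
move=> SN; have [c Hc] := codableT; exists c => s t H.
have [|z _ zE] := Hc s t; first by move=> n; have [z _ ?] := H n; exists z.
exists z => //; have [w Sw wE] := H N.
by apply: SN Sw => i iN; case: (wE i iN) => -> _; case: (zE i) => ->.
Qed.

(** The complement is carried along because the closure properties above do not provide it, while a
    sigma-algebra requires it. *)
Definition bicodable (S : set Z) := codable S /\ codable (~` S).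

Lemma bicodable_sigma_algebra : sigma_algebra setT bicodable.
Proof.
split.
- by split; apply: (@codable_finitary _ 0%N).
- by move=> A [cA cC]; rewrite setTD; split=> //; rewrite setCK.
- move=> A /all_and2[cA cC]; split; last first.
    by rewrite setC_bigcup; exact: codable_bigcap.
  (* The sets are made disjoint by removing their predecessors, which is where the codes of the
     complements enter. *)
  have -> : \bigcup_k A k = \bigcup_k (A k `&` \bigcap_j (if (j < k)%N then ~` A j else setT)).
    apply/seteqP; split=> z [k _]; last by case=> Ak _; exists k.
    move=> Ak; have ex : exists k, `[< A k z >] by exists k; apply/asboolP.
    case: (ex_minnP ex) => m /asboolP Am mmin; exists m => //; split=> // j _.
    by case: ifP => // jm /asboolP /mmin; rewrite leqNgt jm.
  apply: codable_disjoint_bigcup => [k|k l z [Ak Hk] [Al Hl]].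
    rewrite -bigcap2E; apply: codable_bigcap => -[|[|?]] //=.
    by apply: codable_bigcap => j; case: ifP.
  case: (ltngtP k l) => // kl.
    by have := Hl k I; rewrite kl => /(_ Ak).
  by have := Hk l I; rewrite kl => /(_ Al).
Qed.

End Codable.

Lemma measurable_prod_codable (disp : measure_display) (X : measurableType disp)
    (a w : nat -> X -> nat) :
  (forall x y, (forall i, a i x = a i y) -> x = y) -> closed_code setT a w ->
  (forall T : set (set X), sigma_algebra setT T ->
     (forall i k, T [set x | a i x = k]) -> forall A, measurable A -> T A) ->
  forall F : set (X * X), measurable F ->
    codable (fun i z => pickle (a i z.1, a i z.2)) F.
Proof.
move=> a_sep aw a_gen.
set b := fun i (z : X * X) => pickle (a i z.1, a i z.2).
have bP i z z' : b i z = b i z' -> a i z.1 = a i z'.1 /\ a i z.2 = a i z'.2.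
  by move=> /(pcan_inj pickleK)[-> ->].
have b_sep z z' : (forall i, b i z = b i z') -> z = z'.
  case: z z' => [x y] [x' y'] /= H.
  by congr pair; apply: a_sep => i; case: (bP _ _ _ (H i)).
have bT : codable b setT.
  pose e j := odflt (0, 0)%N (unpickle j : option (nat * nat)).
  exists (fun i z => pickle (w i z.1, w i z.2)) => s t H.
  (* Each digit of the limit code is attained by some point, so it is the code of a pair and
     decoding loses nothing. *)
  have stP i : exists u v, s i = pickle u /\ t i = pickle v :> nat /\
      e (s i) = u /\ e (t i) = v.
    have [z _ /(_ i (leqnn _))[<- <-]] := H i.+1.
    by do 2!eexists; do 3!split=> //; rewrite /e pickleK.
  have [|x _ Hx] := aw (fun i => (e (s i)).1) (fun i => (e (t i)).1).
    move=> n; have [z _ Hz] := H n; exists z.1 => // i iN.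
    by case: (Hz i iN) => <- <-; rewrite /e !pickleK.
  have [|y _ Hy] := aw (fun i => (e (s i)).2) (fun i => (e (t i)).2).
    move=> n; have [z _ Hz] := H n; exists z.2 => // i iN.
    by case: (Hz i iN) => <- <-; rewrite /e !pickleK.
  exists (x, y) => // i; have [u [v [su [tv [eu ev]]]]] := stP i.
  rewrite /b /=; case: (Hx i) => -> ->; case: (Hy i) => -> ->.
  by rewrite eu ev -!surjective_pairing su tv.
have sa := bicodable_sigma_algebra b_sep bT.
have gen (f : X * X -> X) : (forall i z z', b i z = b i z' -> a i (f z) = a i (f z')) ->
    forall A, measurable A -> bicodable b (f @^-1` A).
  move=> fb; apply: a_gen.
    case: sa => T0 TC TU; split=> [|A TA|A TA].
    - by rewrite preimage_set0.
    - by rewrite setTD preimage_setC -setTD; exact: TC.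
    - by rewrite preimage_bigcup; exact: TU.
  move=> i k; split; apply: (@codable_finitary _ _ bT _ i.+1) => z z' /(_ i (leqnn _)) /fb E;
    by rewrite /= E.
move=> F mF; suff: bicodable b F by case.
apply: smallest_sub mF => //.
  by move=> A [[B mB] <-|[B mB] <-]; rewrite setTI; apply: gen => // i z z' /bP[].
Qed.

Lemma measurable_neighbours (R : realType) (disp : measure_display)
    (X : measurableType disp) (d : nat) (E : set (X * X)) (B : set X) :
  standard_borel R X -> measurable E ->
  (forall x, ([set y | E (x, y)] #<= `I_d)%card) -> measurable B ->
  measurable [set x | exists2 y, E (x, y) & B y].
Proof.
move=> /standard_borel_code[a [w [am asep aw agen]]] mE degE mB.
have mF : measurable (E `&` (setT `*` B)) by apply: measurableI => //; exact: measurableX.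
have [c Hc] := measurable_prod_codable asep aw agen mF.
pose F := E `&` (setT `*` B).
have -> : [set x | exists2 y, E (x, y) & B y] = fst @` F.
  apply/seteqP; split=> x /=; first by case=> y Exy By; exists (x, y).
  by case=> -[x' y] [/= Exy [_ By]] <-; exists y.
pose e j := odflt (0, 0)%N (unpickle j : option (nat * nat)).
pose b i (z : X * X) := pickle (a i z.1, a i z.2).
apply: (@measurable_image_finite_sections _ X _ F fst
  (fun i z => pickle (b i z, c i z)) a d) => //.
- move=> s H.
  have [|z Fz Hz] := Hc (fun i => (e (s i)).1) (fun i => (e (s i)).2).
    move=> n; have [z Fz zE] := H n; exists z => // i iN.
    by rewrite -(zE i iN) /e pickleK.
  exists z => // i; rewrite /b; case: (Hz i) => -> ->.
  have [z' _ /(_ i (leqnn _)) <-] := H i.+1.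
  by rewrite /e pickleK -surjective_pairing.
- by move=> i z z' _ _ /(pcan_inj pickleK)[/(pcan_inj pickleK)[]].
- move=> z Fz pz zi.
  have /card_le_IP/(_ (codom (fun j => (z j).2))) := degE (z ord0).1.
  rewrite size_codom card_ord ltnn => H; suff: false by []; apply: H.
    rewrite map_inj_uniq ?enum_uniq // => j l Ejl; apply: zi.
    by rewrite [LHS]surjective_pairing [RHS]surjective_pairing Ejl (pz j l).
  by move=> _ /codomP[j ->]; rewrite (pz ord0 j); case: (Fz j); case: (z j).
Qed.

(** * Measured graphs *)

Section FiniteValued.
Variables (V : Type) (meas : (V -> bool) -> Prop).

(** A simple function with values in an arbitrary type: no sigma-algebra on [T] is involved, so [T]
    may consist of lists, sets or reals alike. *)
Definition finmeas (T : Type) (h : V -> T) : Prop :=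
  exists (I : finType) (b : I -> V -> bool) (F : {ffun I -> bool} -> T),
    (forall i, meas (b i)) /\ forall x, h x = F [ffun i => b i x].

Lemma finmeas_of_meas b : meas b -> finmeas b.
Proof.
move=> mb; exists unit, (fun=> b), (fun f => f tt); split=> // x.
by rewrite ffunE.
Qed.

Lemma finmeas_cst T (t : T) : finmeas (fun=> t).
Proof. by exists void, (fun=> xpredT), (fun=> t); split. Qed.

Lemma finmeas_map T U (f : T -> U) (h : V -> T) :
  finmeas h -> finmeas (fun x => f (h x)).
Proof.
move=> [I [b [F [mb hE]]]]; exists I, b, (fun u => f (F u)); split=> // x.
by rewrite hE.
Qed.

Lemma finmeas_map2 T U W (f : T -> U -> W) (h : V -> T) (k : V -> U) :
  finmeas h -> finmeas k -> finmeas (fun x => f (h x) (k x)).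
Proof.
move=> [I [b [F [mb hE]]]] [J [c [G [mc kE]]]].
exists (I + J)%type, (fun ij => match ij with inl i => b i | inr j => c j end),
  (fun u => f (F [ffun i => u (inl i)]) (G [ffun j => u (inr j)])).
split=> [[i|j]//|x]; rewrite hE kE.
by congr (f (F _) (G _)); apply/ffunP => i; rewrite !ffunE.
Qed.

Lemma finmeas_comp T (h : V -> T) (f : V -> V) :
  (forall b, meas b -> meas (fun x => b (f x))) ->
  finmeas h -> finmeas (fun x => h (f x)).
Proof.
move=> mf [I [b [F [mb hE]]]]; exists I, (fun i x => b i (f x)), F; split=> [i|x].
  exact: mf.
by rewrite hE.
Qed.

Lemma finmeas_seq T (J : Type) (s : seq J) (h : J -> V -> T) :
  (forall j, finmeas (h j)) -> finmeas (fun x => [seq h j x | j <- s]).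
Proof.
move=> hf; elim: s => [|j s IH] /=; first exact: finmeas_cst.
exact: (finmeas_map2 cons).
Qed.

Lemma finmeas_sum (R : nmodType) (J : Type) (s : seq J) (h : J -> V -> R) :
  (forall j, finmeas (h j)) -> finmeas (fun x => \sum_(j <- s) h j x).
Proof.
move=> hf; have := finmeas_map (fun l => \sum_(i <- l) i) (finmeas_seq s hf).
by under eq_fun do rewrite big_map.
Qed.

Lemma finmeas_has (J : Type) (s : seq J) (h : J -> V -> bool) :
  (forall j, finmeas (h j)) -> finmeas (fun x => has (fun j => h j x) s).
Proof.
move=> hf; have := finmeas_map (has id) (finmeas_seq s hf).
by under eq_fun do rewrite has_map.
Qed.

(** Measurability is reduced to that of a finite table from which [g] can be read off, without any
    formula for the reading; [x0] supplies a value for tables that do not occur. *)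
Lemma finmeas_determined T U (x0 : V) (h : V -> T) (g : V -> U) :
  finmeas h -> (forall x y, h x = h y -> g x = g y) -> finmeas g.
Proof.
move=> fh hg.
have /choice[F HF] : forall t, exists u, forall x, h x = t -> g x = u.
  move=> t; have [[x hx]|n] := pselect (exists x, h x = t).
    by exists (g x) => y hy; apply: hg; rewrite hx.
  by exists (g x0) => y hy; exfalso; apply: n; exists y.
have := finmeas_map F fh.
by under eq_fun do rewrite -(HF _ _ erefl).
Qed.

Hypothesis measT : meas (fun=> true).
Hypothesis measN : forall b, meas b -> meas (fun x => ~~ b x).
Hypothesis measI : forall b c, meas b -> meas c -> meas (fun x => b x && c x).

Lemma meas_has (J : Type) (s : seq J) (b : J -> V -> bool) :
  (forall j, meas (b j)) -> meas (fun x => has (fun j => b j x) s).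
Proof.
move=> mb; elim: s => [|j s IH] /=; first exact: (measN measT).
have := measN (measI (measN (mb j)) (measN IH)).
by under eq_fun do rewrite negb_and !negbK.
Qed.

(** The predicate is a finite union of atoms of the algebra generated by the [c i]. *)
Lemma meas_of_finmeas (b : V -> bool) : finmeas b -> meas b.
Proof.
move=> [I [c [F [mc bE]]]].
have -> : b = fun x => has (fun f : {ffun I -> bool} =>
    F f && ~~ has (fun i => c i x != f i) (enum I)) (enum {ffun I -> bool}).
  apply/funext => x; rewrite bE; apply/idP/hasP => [Fx|[f _ /andP[Ff /hasPn cf]]].
    exists [ffun i => c i x]; rewrite ?mem_enum // Fx /=.
    by apply/hasPn => i _; rewrite ffunE eqxx.
  suff -> : [ffun i => c i x] = f by [].
  apply/ffunP => i; rewrite ffunE; have := cf i; rewrite mem_enum => /(_ isT).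
  by move/negPn/eqP.
apply: meas_has => f; case: (F f) => /=; last exact: (measN measT).
apply: measN; apply: meas_has => i; case: (f i).
  by rewrite (_ : (fun x => _) = fun x => ~~ c i x); [exact: measN | apply/funext => x; case: (c i x)].
by rewrite (_ : (fun x => _) = c i); [exact: mc | apply/funext => x; case: (c i x)].
Qed.

End FiniteValued.

(* [expect] is only meaningful on functions with finitely many values, and only
   finite additivity is required. *)
Record mgraph (R : realType) (d : nat) := MGraph {
  mvertex :> choiceType;
  medge : rel mvertex;
  meas : (mvertex -> bool) -> Prop;
  expect : (mvertex -> R) -> R;
  mvertex0 : mvertex;
  medge_sym : symmetric medge;
  medge_irr : irreflexive medge;
  medge_deg : forall x (s : seq mvertex), uniq s -> all (medge x) s -> (size s <= d)%N;
  measT : meas (fun=> true);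
  measN : forall b, meas b -> meas (fun x => ~~ b x);
  measI : forall b c, meas b -> meas c -> meas (fun x => b x && c x);
  meas_eq : forall f g : mvertex -> mvertex,
    (forall b, meas b -> meas (fun x => b (f x))) ->
    (forall b, meas b -> meas (fun x => b (g x))) -> meas (fun x => f x == g x);
  meas_neighbour : forall b, meas b -> meas (fun x => `[< exists2 y, medge x y & b y >]);
  meas_colouring : forall L : nat, exists m : nat, exists c : mvertex -> 'I_m,
    (forall k, meas (fun x => c x == k)) /\
    forall x y, gball medge L x y -> c x = c y -> x = y;
  expect_linear : forall (a : R) g h, finmeas meas g -> finmeas meas h ->
    expect (fun x => a * g x + h x) = a * expect g + expect h;
  expect_ge0 : forall g, finmeas meas g -> (forall x, 0 <= g x) -> 0 <= expect g;
  expect1 : expect (fun=> 1) = 1;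
  expect_invariant : forall f : mvertex -> mvertex, involutive f ->
    (forall x, f x = x \/ medge x (f x)) ->
    (forall b, meas b -> meas (fun x => b (f x))) ->
    forall b, meas b -> expect (fun x => (b (f x))%:R) = expect (fun x => (b x)%:R)
}.

Section Balls.
Variables (V : Type) (e : rel V).

Lemma gball_refl r x : gball e r x x.
Proof. by exists [::]. Qed.

Lemma gball_mono r s x y : (r <= s)%N -> gball e r x y -> gball e s x y.
Proof. by move=> rs [p [px yp sp]]; exists p; split=> //; exact: leq_trans rs. Qed.

Lemma gball_trans r s x y z : gball e r x y -> gball e s y z -> gball e (r + s) x z.
Proof.
move=> [p [px -> sp]] [q [qx -> sq]]; exists (p ++ q).
by rewrite cat_path last_cat px qx size_cat leq_add.
Qed.

Lemma gball1 x y : e x y -> gball e 1 x y.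
Proof. by move=> xy; exists [:: y]; rewrite /= xy. Qed.

Lemma gball0 x y : gball e 0 x y -> y = x.
Proof. by move=> [[|z p] [_ -> sp]]. Qed.

Lemma gballS r x y : gball e r.+1 x y -> y = x \/ exists2 z, e x z & gball e r z y.
Proof.
move=> [[|z p] [/= px -> sp]]; first by left.
by case/andP: px => xz pz; right; exists z => //; exists p.
Qed.

Lemma gball_sym (es : symmetric e) r x y : gball e r x y -> gball e r y x.
Proof.
elim: r x y => [|r IH] x y; first by move=> /gball0->; exact: gball_refl.
move=> /gballS[->|[z xz zy]]; first exact: gball_refl.
by rewrite -addn1; apply: gball_trans (IH _ _ zy) _; apply: gball1; rewrite es.
Qed.

Lemma gball_comp r x y : gball e r x y -> gcomponent e x y.
Proof. by move=> [p [px yp _]]; exists p. Qed.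

Lemma gcomponent_trans x y z :
  gcomponent e x y -> gcomponent e y z -> gcomponent e x z.
Proof.
move=> [p px ->] [q qx ->]; exists (p ++ q); last by rewrite last_cat.
by rewrite cat_path px.
Qed.

Lemma gcomponent_sym (es : symmetric e) x y : gcomponent e x y -> gcomponent e y x.
Proof.
move=> [p px ->]; have : gball e (size p) x (last x p) by exists p.
by move/(gball_sym es)/gball_comp.
Qed.

End Balls.

(** * Matchings that cover all edges *)

Section Moves.
Variables (R : realType) (d : nat) (G : mgraph R d).
Local Notation e := (@medge R d G).
Local Notation meas := (@meas R d G).
Local Notation finmeas := (finmeas meas).

Let ncol := projT1 (cid (@meas_colouring R d G 2)).
Let col : G -> 'I_ncol := projT1 (cid (projT2 (cid (@meas_colouring R d G 2)))).

Let col_meas k : meas (fun x => col x == k).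
Proof. exact: (projT2 (cid (projT2 (cid (@meas_colouring R d G 2))))).1. Qed.

Let col_inj x y : gball e 2 x y -> col x = col y -> x = y.
Proof. exact: (projT2 (cid (projT2 (cid (@meas_colouring R d G 2))))).2. Qed.

Let col_nb x y z : e x y -> e x z -> col y = col z -> y = z.
Proof.
move=> xy xz; apply: col_inj; apply: (@gball_trans _ _ 1 1 y x z); apply: gball1 => //.
by rewrite medge_sym.
Qed.

Let col_edge x y : e x y -> col x != col y.
Proof.
move=> xy; apply/eqP => E.
have E' := col_inj (@gball_mono _ _ 1 2 _ _ isT (gball1 xy)) E.
by move: xy; rewrite E' medge_irr.
Qed.

Definition moves : finType := ('I_ncol * 'I_ncol)%type.

Let to_col k x := if pselect (exists y, e x y && (col y == k)) is left h
  then projT1 (cid h) else x.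

Let to_colP k x y : e x y -> col y = k -> to_col k x = y.
Proof.
move=> xy yk; rewrite /to_col; case: pselect => [h|[]]; last by exists y; rewrite xy yk eqxx.
by case: cid => z /= /andP[xz /eqP zk]; apply: (@col_nb x) => //; rewrite zk.
Qed.

Let to_colE k x : to_col k x = x \/ e x (to_col k x) /\ col (to_col k x) = k.
Proof.
rewrite /to_col; case: pselect => [h|]; last by left.
by case: cid => z /= /andP[xz /eqP zk]; right.
Qed.

(* The edges joining two given colour classes of a colouring with distance-2
   separation form a matching, and [move] swaps its endpoints. *)
Definition move (i : moves) (x : G) : G :=
  if (i.1 < i.2)%N then
    if col x == i.1 then to_col i.2 x else if col x == i.2 then to_col i.1 x else x
  else x.

Lemma move_edge i x : move i x = x \/ e x (move i x).
Proof.
rewrite /move; case: ifP => _; last by left.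
case: ifP => _; first by case: (to_colE i.2 x) => [|[]]; [left|right].
case: ifP => _; last by left.
by case: (to_colE i.1 x) => [|[]]; [left|right].
Qed.

Lemma moveK i : involutive (move i).
Proof.
move=> x; rewrite {2}/move; case: ifP => i12; last by rewrite /move i12.
have i21 : (i.2 == i.1) = false by apply/eqP => E; move: i12; rewrite E ltnn.
case: eqP => [x1|x1].
  case: (to_colE i.2 x) => [E|[xy yc]]; first by rewrite E /move i12 x1 eqxx E.
  by rewrite /move i12 yc i21 eqxx; apply: to_colP => //; rewrite medge_sym.
case: eqP => [x2|x2]; last by rewrite /move i12 (introF eqP x1) (introF eqP x2).
case: (to_colE i.1 x) => [E|[xy yc]]; first by rewrite E /move i12 (introF eqP x1) x2 eqxx E.
by rewrite /move i12 yc eqxx; apply: to_colP => //; rewrite medge_sym.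
Qed.

Lemma move_ex x y : e x y -> exists i, move i x = y.
Proof.
move=> xy; have := col_edge xy; rewrite neq_ltn => /orP[] cxy.
  by exists (col x, col y); rewrite /move /= cxy eqxx; exact: to_colP.
exists (col y, col x); rewrite /move /= cxy eqxx.
case: eqP => [E|_]; first by move: cxy; rewrite E ltnn.
exact: to_colP.
Qed.

(** The pair of colours can be read off the ends of the edge, and its order is fixed by [i.1 < i.2].
    Hence the nontrivial moves at [x] list its neighbours without repetition. *)
Lemma move_uniq x i j : move i x <> x -> move i x = move j x -> i = j.
Proof.
have D k : move k x <> x -> (k.1 < k.2)%N /\
    (col x = k.1 /\ col (move k x) = k.2 \/ col x = k.2 /\ col (move k x) = k.1).
  rewrite /move; case: ifP => // k12; case: eqP => [xk|_].
    by case: (to_colE k.2 x) => [E|[_ ?]] H //; split=> //; left.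
  by case: eqP => [xk|_] //; case: (to_colE k.1 x) => [E|[_ ?]] H //; split=> //; right.
move=> mi ij; have [i12 ci] := D i mi; have [j12 cj] : (j.1 < j.2)%N /\
    (col x = j.1 /\ col (move i x) = j.2 \/ col x = j.2 /\ col (move i x) = j.1).
  by rewrite ij; apply: D; rewrite -ij.
case: i j {D mi ij} i12 ci j12 cj => [i1 i2] [j1 j2] /= i12 ci j12 cj.
case: ci => -[ci ci']; case: cj => -[]; rewrite ci ci' => E1 E2.
- by rewrite E1 E2.
- by move: i12 j12; rewrite E1 E2 => /ltnW; rewrite leqNgt => /negP.
- by move: i12 j12; rewrite E1 E2 => /ltnW; rewrite leqNgt => /negP.
- by rewrite E1 E2.
Qed.

Lemma move_id : exists i, forall x, move i x = x.
Proof. by exists (col (mvertex0 G), col (mvertex0 G)) => x; rewrite /move ltnn. Qed.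

Lemma meas_of_fin b : finmeas b -> meas b.
Proof. exact: meas_of_finmeas (@measT _ _ G) (@measN _ _ G) (@measI _ _ G) _. Qed.

Lemma fin_and (b c : G -> bool) : finmeas b -> finmeas c -> finmeas (fun x => b x && c x).
Proof. exact: finmeas_map2. Qed.

Lemma move_meas i b : meas b -> meas (fun x => b (move i x)).
Proof.
move=> mb; rewrite /move; case: (i.1 < i.2)%N => //.
have mk k : meas (fun x => b (to_col k x)).
  (* Unfolds the chosen neighbour into existential statements over neighbours, to which
     [meas_neighbour] applies; uniqueness of the neighbour of colour [k] makes both forms agree. *)
  have -> : (fun x => b (to_col k x)) = fun x =>
      `[< exists2 y, e x y & (col y == k) && b y >] ||
      ~~ `[< exists2 y, e x y & col y == k >] && b x.
    apply/funext => x; rewrite /to_col; case: pselect => [h|n].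
      case: cid => z /= /andP[xz /eqP zk].
      have -> : `[< exists2 y, e x y & col y == k >] by apply/asboolP; exists z => //; apply/eqP.
      rewrite /= orbF; apply/idP/asboolP => [bz|[y xy /andP[/eqP yk by_]]].
        by exists z => //; rewrite zk eqxx.
      by rewrite (col_nb xz xy) // zk.
    have -> : `[< exists2 y, e x y & col y == k >] = false.
      by apply/asboolPn => -[y xy yk]; apply: n; exists y; rewrite xy.
    have -> // : `[< exists2 y, e x y & (col y == k) && b y >] = false.
    by apply/asboolPn => -[y xy /andP[yk _]]; apply: n; exists y; rewrite xy.
  apply: meas_of_fin; apply: finmeas_map2; first apply: finmeas_of_meas.
    by apply: meas_neighbour; apply: measI.
  apply: fin_and; apply: finmeas_of_meas => //.
  by apply: measN; exact: meas_neighbour.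
have H (k : 'I_ncol) (h1 h2 : G -> G) : meas (fun x => b (h1 x)) -> meas (fun x => b (h2 x)) ->
    meas (fun x => b (if col x == k then h1 x else h2 x)).
  move=> m1 m2; apply: meas_of_fin.
  have := finmeas_map2 (fun (p : bool * bool) (q : bool) => if p.1 then p.2 else q)
    (finmeas_map2 pair (finmeas_of_meas (col_meas k)) (finmeas_of_meas m1))
    (finmeas_of_meas m2).
  by rewrite (_ : (fun x => _) = fun x => b (if col x == k then h1 x else h2 x)) //;
    apply/funext => x; rewrite /=; case: ifP.
by apply: (H) => //; apply: H.
Qed.

End Moves.

(** Turns a sum over the distinct points of a ball into a sum over all words, a fixed finite index
    set, so that measurability can be checked term by term. *)
Lemma big_undup_count (R : realType) (T : eqType) (s : seq T) (F : T -> R) :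
  \sum_(y <- undup s) F y = \sum_(y <- s) F y / (count_mem y s)%:R.
Proof.
rewrite -[RHS]big_undup_iterop_count /= big_seq [RHS]big_seq; apply: eq_bigr => y.
rewrite mem_undup => ys; have : (0 < count_mem y s)%N by rewrite -has_count has_pred1.
set n := count_mem y s => n0.
have -> : iterop n +%R (F y / n%:R) 0 = (F y / n%:R) *+ n.
  by case: (n) => //=.
by rewrite -mulr_natr divfK // pnatr_eq0 -lt0n.
Qed.

Section Expectation.
Variables (R : realType) (d : nat) (G : mgraph R d).
Local Notation meas := (@meas R d G).
Local Notation finmeas := (finmeas meas).
Local Notation "'Ex'" := (@expect R d G).
Implicit Types g h : G -> R.

Lemma expect0 : Ex (fun=> 0) = 0.
Proof.
have := @expect_linear _ _ G (-1) (fun=> 1) (fun=> 1) (finmeas_cst _ _) (finmeas_cst _ _).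
by rewrite expect1 (_ : (fun x => _) = fun=> 0) => [->|]; [ring | apply/funext => x; ring].
Qed.

Lemma expectD g h : finmeas g -> finmeas h -> Ex (fun x => g x + h x) = Ex g + Ex h.
Proof.
move=> fg fh; have := expect_linear 1 fg fh; rewrite mul1r => <-.
by congr (Ex _); apply/funext => x; rewrite mul1r.
Qed.

Lemma expectZ c g : finmeas g -> Ex (fun x => c * g x) = c * Ex g.
Proof.
move=> fg; have := expect_linear c fg (finmeas_cst _ 0); rewrite expect0 addr0 => <-.
by congr (Ex _); apply/funext => x; rewrite addr0.
Qed.

Lemma expectB g h : finmeas g -> finmeas h -> Ex (fun x => g x - h x) = Ex g - Ex h.
Proof.
move=> fg fh; have := expect_linear (-1) fh fg; rewrite mulN1r addrC => <-.
by congr (Ex _); apply/funext => x; rewrite mulN1r addrC.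
Qed.

Lemma expect_cst c : Ex (fun=> c) = c.
Proof.
rewrite -[RHS]mulr1 -[X in _ = _ * X](@expect1 _ _ G) -expectZ; last exact: finmeas_cst.
by congr (Ex _); apply/funext => x; rewrite mulr1.
Qed.

Lemma expect_le g h : finmeas g -> finmeas h -> (forall x, g x <= h x) -> Ex g <= Ex h.
Proof.
move=> fg fh gh; rewrite -subr_ge0 -expectB //; apply: expect_ge0.
  exact: (finmeas_map2 (fun a b => a - b)).
by move=> x; rewrite subr_ge0.
Qed.

Lemma expect_sum (J : Type) (s : seq J) (h : J -> G -> R) : (forall j, finmeas (h j)) ->
  Ex (fun x => \sum_(j <- s) h j x) = \sum_(j <- s) Ex (h j).
Proof.
move=> fh; elim: s => [|j s IH].
  by rewrite big_nil -[RHS]expect0; congr (Ex _); apply/funext => x; rewrite big_nil.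
rewrite big_cons -IH -expectD //; last exact: finmeas_sum.
by congr (Ex _); apply/funext => x; rewrite big_cons.
Qed.

Lemma finmeas_nat (b : G -> bool) : finmeas b -> finmeas (fun x => (b x)%:R : R).
Proof. exact: (finmeas_map (fun c : bool => c%:R)). Qed.

(** [expect_invariant] speaks of indicators only; a finitely valued function is a linear combination
    of indicators of its atoms. *)
Lemma expect_move i g : finmeas g -> Ex (fun x => g (move i x)) = Ex g.
Proof.
move=> [I [b [F [mb gE]]]].
pose h x := [ffun i => b i x].
have fh : finmeas h by exists I, b, id.
have gE' x : g x = \sum_(f : {ffun I -> bool}) F f * (h x == f)%:R.
  rewrite (bigD1 (h x)) //= eqxx mulr1 big1 ?addr0 ?gE // => f /negPf.
  by rewrite eq_sym => ->; rewrite mulr0.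
have mf f : meas (fun x => h x == f).
  by apply: meas_of_fin; apply: (finmeas_map (fun u => u == f)).
have fi f : finmeas (fun x => (h x == f)%:R : R).
  by apply: finmeas_nat; exact: finmeas_of_meas.
have fm f : finmeas (fun x => (h (move i x) == f)%:R : R).
  exact: (@finmeas_comp _ _ _ (fun x => (h x == f)%:R : R) (move i) (@move_meas _ _ _ i) (fi f)).
have -> : g = fun x => \sum_(f : {ffun I -> bool}) F f * (h x == f)%:R by exact/funext.
rewrite !expect_sum; last 2 first.
- by move=> f; apply: finmeas_map.
- by move=> f; apply: (finmeas_map (fun u => F f * u)) (fm f).
apply: eq_bigr => f _; rewrite !expectZ //; congr (_ * _).
apply: (expect_invariant (f := move i)) => //.
- exact: moveK.
- exact: move_edge.
- by move=> c; exact: move_meas.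
Qed.

End Expectation.

Section Walks.
Variables (R : realType) (d : nat) (G : mgraph R d).
Local Notation e := (@medge R d G).
Local Notation meas := (@meas R d G).
Local Notation finmeas := (finmeas meas).
Implicit Types (x y a : G) (w : seq (moves G)).

Definition walk w x := foldl (fun z i => move i z) x w.

Lemma walk_cat w w' x : walk (w ++ w') x = walk w' (walk w x).
Proof. exact: foldl_cat. Qed.

Lemma walk_revK w x : walk (rev w) (walk w x) = x.
Proof.
elim: w x => //= i w IH x.
by rewrite rev_cons -cats1 walk_cat IH /= moveK.
Qed.

Lemma walk_gball w x : gball e (size w) x (walk w x).
Proof.
elim: w x => [|i w IH] x; first exact: gball_refl.
apply: (@gball_trans _ _ 1 _ _ _ _ _ (IH (move i x))).
by case: (move_edge i x) => [->|xi]; [exact: gball_refl | exact: gball1].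
Qed.

Lemma gball_walk r x y : gball e r x y -> exists2 w, size w = r & walk w x = y.
Proof.
elim: r x => [|r IH] x; first by move=> H; rewrite (gball0 H); exists [::].
have [i0 iE] := move_id G.
move=> H; case: (gballS H) => [->|[z /move_ex[i <-] /IH[w sw wy]]]; last first.
  by exists (i :: w) => //=; rewrite sw.
exists (nseq r.+1 i0); rewrite ?size_nseq //.
by elim: (r.+1) => //= n; rewrite iE.
Qed.

(** Words of length exactly [L] suffice because some move is the identity and can serve as
    padding. *)
Definition ball L x : seq G := undup [seq walk w x | w : L.-tuple (moves G)].

Lemma ball_uniq L x : uniq (ball L x).
Proof. exact: undup_uniq. Qed.

Lemma mem_ball L x y : y \in ball L x <-> gball e L x y.
Proof.
rewrite mem_undup; split.
  by move=> /mapP[w _ ->]; have := walk_gball w x; rewrite size_tuple.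
move=> H; case: (gball_walk H) => w sw <-; apply/mapP.
by exists (tcast sw (in_tuple w)); rewrite ?mem_enum // val_tcast.
Qed.

Lemma mem_ball_walk L x y : (y \in ball L x) = has (fun w : L.-tuple _ => walk w x == y) (enum {: L.-tuple (moves G)}).
Proof.
rewrite mem_undup; apply/mapP/hasP => -[w wE]; first by move=> ->; exists w.
by move=> /eqP; exists w.
Qed.

Definition nb x : seq G := [seq move i x | i <- enum (moves G) & move i x != x].

Lemma nb_uniq x : uniq (nb x).
Proof.
rewrite map_inj_in_uniq => [|i j]; first exact: filter_uniq (enum_uniq _).
by rewrite !mem_filter => /andP[/eqP mi _] _; exact: move_uniq.
Qed.

Lemma mem_nb x y : (y \in nb x) = e x y.
Proof.
apply/mapP/idP => [[i]|xy].
  by rewrite mem_filter => /andP[/eqP mi _] ->; case: (move_edge i x).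
have [i iy] := move_ex xy; exists i => //; rewrite mem_filter mem_enum iy andbT.
by apply: contraTneq xy => ->; rewrite medge_irr.
Qed.

Lemma size_nb x : (size (nb x) <= d)%N.
Proof.
apply: (medge_deg (nb_uniq x) (x := x)); apply/allP => y.
by rewrite mem_nb.
Qed.

Lemma size_ball L x : (size (ball L x) <= d.+1 ^ L)%N.
Proof.
elim: L x => [|L IH] x.
  rewrite expn0 -[1%N]/(size [:: x]); apply: uniq_leq_size; first exact: ball_uniq.
  by move=> y /mem_ball H; rewrite (gball0 H) inE.
have sub : {subset ball L.+1 x <= flatten [seq ball L z | z <- x :: nb x]}.
  move=> y /mem_ball H; case: (gballS H) => [->|[z xz zy]]; apply/flattenP.
    by exists (ball L x); [exact: map_f (mem_head _ _) | apply/mem_ball; exact: gball_refl].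
  exists (ball L z); last exact/mem_ball.
  by apply: map_f; rewrite inE mem_nb xz orbT.
apply: leq_trans (uniq_leq_size (ball_uniq _ _) sub) _.
have : forall s : seq G, (size (flatten [seq ball L z | z <- s]) <= size s * d.+1 ^ L)%N.
  by elim=> [|z s IHs] //=; rewrite size_cat mulSn leq_add.
move=> /(_ (x :: nb x)) /leq_trans -> //.
by rewrite expnS leq_mul2r /= ltnS size_nb orbT.
Qed.

Lemma sum_nb (F : G -> R) x :
  \sum_(a <- nb x) F a = \sum_i (move i x != x)%:R * F (move i x).
Proof.
rewrite big_map big_filter big_enum_cond /= big_mkcond /=.
by apply: eq_bigr => i _; case: ifP; rewrite ?mul1r ?mul0r.
Qed.

(** This replaces measurability on a product: all means below only involve points at bounded
    distance, which are reached by finitely many words. *)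
Definition nice2 (T : Type) (h : G -> G -> T) :=
  forall v, finmeas (fun x => h x (walk v x)).
Definition nice3 (T : Type) (h : G -> G -> G -> T) :=
  forall u v, finmeas (fun x => h x (walk u x) (walk v x)).

Lemma meas_walk w b : meas b -> meas (fun x => b (walk w x)).
Proof. by elim: w b => //= i w IH b mb; apply: (@move_meas _ _ _ i (fun x => b (walk w x))); exact: IH. Qed.

Lemma finmeas_walk w (T : Type) (h : G -> T) : finmeas h -> finmeas (fun x => h (walk w x)).
Proof. by apply: finmeas_comp => b; exact: meas_walk. Qed.

Lemma finmeas_walk_eq w w' : finmeas (fun x => walk w x == walk w' x).
Proof. by apply: finmeas_of_meas; apply: meas_eq => b; exact: meas_walk. Qed.

Lemma finmeas_move_ne i : finmeas (fun x => (move i x != x)).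
Proof. by apply: (finmeas_map negb); exact: (finmeas_walk_eq [:: i] [::]). Qed.

Lemma nice_edge : nice2 e.
Proof.
move=> v; have -> : (fun x => e x (walk v x)) = fun x =>
    has (fun i => (walk [:: i] x == walk v x) && (move i x != x)) (enum (moves G)).
  apply/funext => x; apply/idP/hasP => [/[dup] xv /move_ex[i iE]|[i _ /andP[/= /eqP <-]]].
    exists i; rewrite ?mem_enum //= iE eqxx /=.
    by apply: contraTneq xv => ->; rewrite medge_irr.
  by case: (move_edge i x) => [->|//]; rewrite eqxx.
apply: finmeas_has => i; apply: fin_and; first exact: finmeas_walk_eq.
exact: finmeas_move_ne.
Qed.

Lemma nice_ball L : nice2 (fun x y => y \in ball L x).
Proof.
move=> v; under eq_fun do rewrite mem_ball_walk.
by apply: finmeas_has => w; exact: finmeas_walk_eq.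
Qed.

Lemma nice3_xy (T : Type) (h : G -> G -> T) : nice2 h -> nice3 (fun x a y => h x y).
Proof. by move=> nh u v; exact: nh. Qed.
(** Seen from [walk u x] as base point, [rev u] leads back to [x] and [rev u ++ v] to [walk v x]. *)
Lemma nice3_flip (T : Type) (h : G -> G -> G -> T) : nice3 h -> nice3 (fun x a y => h a x y).
Proof.
move=> nh u v; have := finmeas_walk u (nh (rev u) (rev u ++ v)).
by under eq_fun do rewrite walk_cat walk_revK.
Qed.

Lemma nice3_ay (T : Type) (h : G -> G -> T) : nice2 h -> nice3 (fun x a y => h a y).
Proof. by move=> nh; apply: (@nice3_flip _ (fun x a y => h x y)); exact: nice3_xy. Qed.

Lemma finmeas_sum_nb (h : G -> G -> R) : nice2 h -> finmeas (fun x => \sum_(a <- nb x) h x a).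
Proof.
move=> nh; under eq_fun do rewrite sum_nb.
apply: finmeas_sum => i; apply: (finmeas_map2 *%R); last exact: (nh [:: i]).
by apply: finmeas_nat; exact: finmeas_move_ne.
Qed.

Lemma finmeas_sum_ball L (h : G -> G -> R) :
  nice2 h -> finmeas (fun x => \sum_(y <- ball L x) h x y).
Proof.
move=> nh; under eq_fun do rewrite big_undup_count big_map big_enum.
apply: finmeas_sum => w; apply: (finmeas_map2 (fun u v => u / v)); first exact: nh.
apply: (finmeas_map (fun n : nat => n%:R)).
under eq_fun do rewrite count_map -size_filter -sum1_size big_filter big_mkcond.
by apply: finmeas_sum => v; apply: (finmeas_map (fun c : bool => if c then 1%N else 0%N));
  exact: finmeas_walk_eq.
Qed.

(** For an edge this is the union of the two [K]-balls, free of repetitions and, up to permutation,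
    symmetric in [x] and [a]. *)
Definition dom K x a : seq G := [seq y <- ball K.+1 x | (y \in ball K x) || (y \in ball K a)].

Lemma ball_sub K L x y : (K <= L)%N -> y \in ball K x -> y \in ball L x.
Proof. by move=> KL /mem_ball/(gball_mono KL)/mem_ball. Qed.

Lemma ball_nb K x a y : e x a -> y \in ball K a -> y \in ball K.+1 x.
Proof. by move=> xa /mem_ball ya; apply/mem_ball; exact: (@gball_trans _ _ 1 _ _ _ _ (gball1 xa)). Qed.

Lemma mem_dom K x a y : e x a -> (y \in dom K x a) = (y \in ball K x) || (y \in ball K a).
Proof.
move=> xa; rewrite mem_filter andb_idr // => /orP[]; first exact: ball_sub.
exact: ball_nb.
Qed.

Lemma dom_uniq K x a : uniq (dom K x a).
Proof. by rewrite filter_uniq ?ball_uniq. Qed.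

Lemma perm_dom K x a : e x a -> perm_eq (dom K x a) (dom K a x).
Proof.
move=> xa; apply: uniq_perm; rewrite ?dom_uniq // => y.
by rewrite !mem_dom // 1?orbC // medge_sym.
Qed.

Lemma size_dom K x a : (size (dom K x a) <= d.+1 ^ K.+1)%N.
Proof. by apply: leq_trans (size_ball K.+1 x); rewrite size_filter count_size. Qed.

Lemma sum_dom_ball K x a (F : G -> R) : e x a -> (forall y, y \notin ball K x -> F y = 0) ->
  \sum_(y <- dom K x a) F y = \sum_(y <- ball K x) F y.
Proof.
move=> xa F0; rewrite (bigID (fun y => y \in ball K x)) /= [X in _ + X]big1 ?addr0; last first.
  by move=> y /F0.
rewrite -big_filter; apply: perm_big; apply: uniq_perm; rewrite ?filter_uniq ?dom_uniq ?ball_uniq //.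
by move=> y; rewrite mem_filter mem_dom //; case: (y \in ball K x).
Qed.

Lemma finmeas_sum_dom K (h : G -> G -> G -> R) : nice3 h ->
  nice2 (fun x a => \sum_(y <- dom K x a) h x a y).
Proof.
move=> nh u.
have := @finmeas_sum_ball K.+1 (fun x y => ((y \in ball K x) || (y \in ball K (walk u x)))%:R * h x (walk u x) y).
have E x : \sum_(y <- dom K x (walk u x)) h x (walk u x) y = \sum_(y <- ball K.+1 x)
    ((y \in ball K x) || (y \in ball K (walk u x)))%:R * h x (walk u x) y.
  rewrite big_filter big_mkcond; apply: eq_bigr => y _.
  by case: ifP; rewrite ?mul1r ?mul0r.
under [X in _ -> finmeas X]eq_fun do rewrite E; apply => v.
apply: (finmeas_map2 *%R); last exact: nh.
apply: finmeas_nat; apply: (finmeas_map2 orb); first exact: nice_ball.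
exact: (nice3_ay (nice_ball K)).
Qed.

Definition edge_mean K (h : G -> G -> G -> R) : R :=
  expect (fun x : G => \sum_(a <- nb x) \sum_(y <- dom K x a) h x a y).

Definition pair_mean K (h : G -> G -> R) : R :=
  expect (fun x : G => \sum_(y <- ball K x) h x y).

Lemma finmeas_edge_mean K (h : G -> G -> G -> R) : nice3 h ->
  finmeas (fun x : G => \sum_(a <- nb x) \sum_(y <- dom K x a) h x a y).
Proof. by move=> nh; apply: finmeas_sum_nb; exact: finmeas_sum_dom. Qed.

Lemma edge_meanD K h h' : nice3 h -> nice3 h' ->
  edge_mean K (fun x a y => h x a y + h' x a y) = edge_mean K h + edge_mean K h'.
Proof.
move=> nh nh'; rewrite /edge_mean -expectD; [|exact: finmeas_edge_mean..].
congr (expect _); apply/funext => x; rewrite -big_split /=.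
by apply: eq_bigr => a _; rewrite -big_split.
Qed.

Lemma edge_meanZ K c h : nice3 h -> edge_mean K (fun x a y => c * h x a y) = c * edge_mean K h.
Proof.
move=> nh; rewrite /edge_mean -expectZ; last exact: finmeas_edge_mean.
congr (expect _); apply/funext => x; rewrite big_distrr /=.
by apply: eq_bigr => a _; rewrite big_distrr.
Qed.

Lemma edge_mean_le K h h' : nice3 h -> nice3 h' ->
  (forall x a y, e x a -> y \in dom K x a -> h x a y <= h' x a y) ->
  edge_mean K h <= edge_mean K h'.
Proof.
move=> nh nh' H; apply: expect_le; [exact: finmeas_edge_mean..|] => x.
rewrite big_seq [leRHS]big_seq; apply: ler_sum => a; rewrite mem_nb => xa.
by rewrite big_seq [leRHS]big_seq; apply: ler_sum => y; exact: H.
Qed.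

(** Mass transport: the mean splits into one summand per move, and each move is a measure-preserving
    involution exchanging [x] and [a]. *)
Lemma edge_mean_flip K h : nice3 h -> edge_mean K h = edge_mean K (fun x a y => h a x y).
Proof.
move=> nh; rewrite /edge_mean.
have E (h' : G -> G -> G -> R) : nice3 h' -> expect (fun x : G => \sum_(a <- nb x) \sum_(y <- dom K x a) h' x a y)
    = \sum_i expect (fun x => (move i x != x)%:R * \sum_(y <- dom K x (move i x)) h' x (move i x) y).
  move=> nh'; under eq_fun do rewrite sum_nb; rewrite expect_sum // => i.
  apply: (finmeas_map2 *%R); last exact: (finmeas_sum_dom K nh' [:: i]).
  by apply: finmeas_nat; exact: finmeas_move_ne.
rewrite (E h) // (E (fun x a y => h a x y)); last exact: nice3_flip.
apply: eq_bigr => i _.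
rewrite -[LHS](expect_move i); last first.
  apply: (finmeas_map2 *%R); last exact: (finmeas_sum_dom K nh [:: i]).
  by apply: finmeas_nat; exact: finmeas_move_ne.
congr (expect _); apply/funext => x; rewrite moveK eq_sym.
case: (move_edge i x) => [->|xi]; first by rewrite eqxx !mul0r.
by congr (_ * _); apply: perm_big; rewrite perm_dom // medge_sym.
Qed.

Lemma pair_meanD K h h' : nice2 h -> nice2 h' ->
  pair_mean K (fun x y => h x y + h' x y) = pair_mean K h + pair_mean K h'.
Proof.
move=> nh nh'; rewrite /pair_mean -expectD; [|exact: finmeas_sum_ball..].
by congr (expect _); apply/funext => x; rewrite -big_split.
Qed.

Lemma pair_meanZ K c h : nice2 h -> pair_mean K (fun x y => c * h x y) = c * pair_mean K h.
Proof.
move=> nh; rewrite /pair_mean -expectZ; last exact: finmeas_sum_ball.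
by congr (expect _); apply/funext => x; rewrite big_distrr.
Qed.

Lemma pair_mean_le K h h' : nice2 h -> nice2 h' ->
  (forall x y, y \in ball K x -> h x y <= h' x y) -> pair_mean K h <= pair_mean K h'.
Proof.
move=> nh nh' H; apply: expect_le; [exact: finmeas_sum_ball..|] => x.
by rewrite big_seq [leRHS]big_seq; apply: ler_sum => y; exact: H.
Qed.

End Walks.

(** * Ball types *)

Section BallIso.
Variables (R : realType) (d : nat).
Implicit Types A B C : mgraph R d.

(** Rooted isomorphism of [r]-balls. The map is total but only its values on the ball count, so
    restricting and composing need no subtypes. *)
Definition biso A B (r : nat) (x : A) (x' : B) (g : A -> B) : Prop :=
  [/\ g x = x', {in ball r x &, injective g},
      forall y, y \in ball r x' <-> exists2 z, z \in ball r x & g z = y &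
      {in ball r x &, forall y z, medge (g y) (g z) = medge y z}].

Lemma ball_center A r (x : A) : x \in ball r x.
Proof. by apply/mem_ball; exact: gball_refl. Qed.

Lemma ball_trans A r s (x y z : A) :
  y \in ball r x -> z \in ball s y -> z \in ball (r + s) x.
Proof. by move=> /mem_ball xy /mem_ball yz; apply/mem_ball; exact: gball_trans xy yz. Qed.

Lemma ball_step A s (z y : A) : y \in ball s.+1 z ->
  y = z \/ exists2 w, medge z w & y \in ball s w.
Proof.
move=> /mem_ball H; case: (gballS H) => [->|[w zw wy]]; first by left.
by right; exists w => //; apply/mem_ball.
Qed.

Lemma nb_ball A (z w : A) : medge z w -> w \in ball 1 z.
Proof. by move=> zw; apply/mem_ball; exact: gball1. Qed.

Lemma biso_sym A B r (x : A) (x' : B) g : biso r x x' g ->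
  exists g', [/\ biso r x' x g', {in ball r x, cancel g g'} & {in ball r x', cancel g' g}].
Proof.
move=> [gx gi gim ge].
have /choice[g' Hg'] : forall y', exists y, y' \in ball r x' -> y \in ball r x /\ g y = y'.
  move=> y'; have [yx|n] := pselect (y' \in ball r x'); last by exists x.
  by have [y ? ?] := (gim y').1 yx; exists y.
have gK : {in ball r x, cancel g g'}.
  move=> y yx; have gyx : g y \in ball r x' by apply/gim; exists y.
  by have [yx' gE] := Hg' _ gyx; apply: gi.
have g'K : {in ball r x', cancel g' g} by move=> y /Hg'[].
exists g'; split=> //; split.
- by rewrite -gx gK // ball_center.
- exact: can_in_inj g'K.
- move=> y; split=> [yx|[z /Hg'[? _] <- //]].
  by exists (g y); [apply/gim; exists y | exact: gK].
- move=> y z yx zx; have [y1 y2] := Hg' _ yx; have [z1 z2] := Hg' _ zx.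
  by rewrite -(ge _ _ y1 z1) y2 z2.
Qed.

(** A path of length [s] starting at distance [k] from the root stays in the ball when [s + k <= r],
    so [g] preserves its edges. *)
Lemma biso_ball A B r (x : A) (x' : B) g s k y z : biso r x x' g -> (s + k <= r)%N ->
  z \in ball k x -> y \in ball s z -> g y \in ball s (g z).
Proof.
move=> [gx gi gim ge]; elim: s k z => [|s IH] k z sk zx yz.
  by have /mem_ball H := yz; rewrite (gball0 H) ball_center.
case: (ball_step yz) => [->|[w zw yw]]; first exact: ball_center.
have wx : w \in ball (k + 1) x by apply: ball_trans zx (nb_ball zw).
have := IH (k + 1)%N w; rewrite addn1 addnS => /(_ sk); rewrite -addn1 => /(_ wx yw) H.
have gzw : medge (g z) (g w).
  by rewrite ge //; [apply: ball_sub zx | apply: ball_sub wx]; move: sk; clear; lia.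
by have := ball_trans (nb_ball gzw) H; rewrite add1n.
Qed.

Lemma biso_restrict A B r (x : A) (x' : B) g s k z : biso r x x' g -> (s + k <= r)%N ->
  z \in ball k x -> biso s z (g z) g.
Proof.
move=> gb sk zx; have [g' [g'b gK g'K]] := biso_sym gb.
have [gx gi gim ge] := gb.
have sub y : y \in ball s z -> y \in ball r x.
  by move=> yz; apply: ball_sub (ball_trans zx yz); rewrite addnC.
have zr : z \in ball r x by apply: ball_sub zx; move: sk; clear; lia.
have gzx : g z \in ball k x'.
  rewrite -gx; apply: (biso_ball gb (k := 0) _ (ball_center _ _) zx).
  by move: sk; clear; lia.
split=> //.
- by move=> y w ys ws; apply: gi; exact: sub.
- move=> y; split=> [ys|[w ws <-]]; last exact: (biso_ball gb sk).
  exists (g' y); first by have := biso_ball g'b sk gzx ys; rewrite gK.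
  apply: g'K; apply: ball_sub (ball_trans gzx ys); by rewrite addnC.
- by move=> y w ys ws; apply: ge; exact: sub.
Qed.

Lemma perm_ball_biso A B s (z : A) (z' : B) g : biso s z z' g ->
  perm_eq (ball s z') (map g (ball s z)).
Proof.
move=> [gx gi gim _]; apply: uniq_perm; rewrite ?ball_uniq //.
  by rewrite map_inj_in_uniq ?ball_uniq.
move=> y; apply/idP/mapP => [/gim[w wz <-]|[w wz ->]]; first by exists w.
by apply/gim; exists w.
Qed.

Lemma perm_nb_biso A B s (z : A) (z' : B) g : (0 < s)%N -> biso s z z' g ->
  perm_eq (nb z') (map g (nb z)).
Proof.
move=> s0 [gx gi gim ge].
have sub (C : mgraph R d) (u w : C) : medge u w -> w \in ball s u.
  by move=> /nb_ball; exact: ball_sub.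
apply: uniq_perm; rewrite ?nb_uniq //.
  rewrite map_inj_in_uniq ?nb_uniq // => y w; rewrite !mem_nb => /sub yz /sub wz.
  exact: gi.
move=> y; rewrite mem_nb; apply/idP/mapP => [/[dup] yz /sub/gim[w wz wy]|[w]].
  by exists w => //; rewrite mem_nb -ge ?ball_center // gx wy.
by rewrite mem_nb => zw ->; rewrite -gx ge ?ball_center //; exact: sub.
Qed.

Lemma biso_edge_dom A B K s (x : A) (x' : B) g a : (K < s)%N -> biso s x x' g ->
  medge x a -> medge x' (g a) /\ perm_eq (dom K x' (g a)) (map g (dom K x a)).
Proof.
move=> Ks gb xa; have [gx gi gim ge] := gb.
have ax1 := nb_ball xa.
have axs : a \in ball s x by apply: ball_sub ax1; move: Ks; clear; lia.
have xa' : medge x' (g a) by rewrite -gx ge ?ball_center.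
split=> //; have b1 := biso_restrict gb (s := K) (k := 0) (z := x).
have {}b1 : biso K x (g x) g by apply: b1; rewrite ?ball_center // addn0 ltnW.
have b2 : biso K a (g a) g by apply: (biso_restrict gb _ ax1); rewrite addn1.
have sub y : y \in dom K x a -> y \in ball s x.
  by rewrite mem_filter => /andP[_]; exact: ball_sub.
apply: uniq_perm; rewrite ?dom_uniq //.
  by rewrite map_inj_in_uniq ?dom_uniq // => y z /sub ys /sub zs; exact: gi.
move=> y; rewrite mem_dom // -gx (perm_mem (perm_ball_biso b1)) (perm_mem (perm_ball_biso b2)) -mem_cat -map_cat.
apply/mapP/mapP => -[w wE ->]; exists w => //; move: wE.
  by rewrite mem_cat mem_dom.
by rewrite mem_cat mem_dom.
Qed.

End BallIso.

Section BallTypes.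
Variables (R : realType) (d r : nat).
Implicit Types A B : mgraph R d.

Local Notation M := (d.+1 ^ r)%N.

(* Graphs on subsets of ['I_M] with three marked vertices; every [r]-ball is
   isomorphic to such a graph, [M] being a bound for its cardinality. *)
Definition code : finType :=
  ({ffun 'I_M * 'I_M -> bool} * {set 'I_M} * ('I_M * 'I_M * 'I_M))%type.

Definition code_map A (x a y : A) (c : code) (j : 'I_M -> A) : Prop :=
  let: (E, D, (i0, i1, i2)) := c in
  [/\ {in D &, injective j}, forall z, z \in ball r x <-> exists2 i, i \in D & j i = z,
      {in D &, forall i k, medge (j i) (j k) = E (i, k)},
      [/\ i0 \in D, i1 \in D & i2 \in D] & [/\ j i0 = x, j i1 = a & j i2 = y]].

(** Collecting all codes instead of choosing a canonical one gives a complete invariant of the ball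
    with two marked points; it is empty if a marked point lies outside the ball. *)
Definition ball_type A (x a y : A) : {set code} :=
  finset (fun c => `[< exists j, code_map x a y c j >]).

Lemma code_map_comp A B (x a y : A) (x' : B) g c j : biso r x x' g ->
  code_map x a y c j -> code_map x' (g a) (g y) c (g \o j).
Proof.
move=> [gx gi gim ge]; case: c => -[E D] [[i0 i1] i2] [ji jim je [D0 D1 D2] [j0 j1 j2]].
have jb i : i \in D -> j i \in ball r x by move=> iD; apply/jim; exists i.
split=> //=.
- by move=> i k iD kD /= /(gi _ _ (jb _ iD) (jb _ kD)); exact: ji.
- move=> z; split=> [/gim[w /jim[i iD <-] <-]|[i iD <-]]; first by exists i.
  by apply/gim; exists (j i) => //; exact: jb.
- by move=> i k iD kD /=; rewrite ge ?jb // je.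
- by rewrite j0 j1 j2.
Qed.

Lemma ball_type_biso A B s (x : A) (x' : B) g a y : biso s x x' g -> (r <= s)%N ->
  a \in ball s x -> y \in ball s x -> ball_type x a y = ball_type x' (g a) (g y).
Proof.
move=> gb rs ax yx; have [g' [g'b gK g'K]] := biso_sym gb.
have [gx _ _ _] := gb; have [gx' _ _ _] := g'b.
have res (A1 B1 : mgraph R d) (z : A1) (z' : B1) h : biso s z z' h -> biso r z z' h.
  move=> hb; have [hz _ _ _] := hb; rewrite -hz.
  by apply: (biso_restrict hb (k := 0)); rewrite ?addn0 ?ball_center.
apply/setP => c; rewrite !inE; apply: asbool_equiv_eq; split=> -[j cj].
  by exists (g \o j); exact: code_map_comp (res _ _ _ _ _ gb) cj.
exists (g' \o j); have := code_map_comp (res _ _ _ _ _ g'b) cj.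
by rewrite !gK.
Qed.

Lemma ball_type_nonempty A (x a y : A) : a \in ball r x -> y \in ball r x ->
  exists c, c \in ball_type x a y.
Proof.
move=> ax yx; pose s := ball r x; have szs : (size s <= M)%N := size_ball r x.
pose j (i : 'I_M) := nth x s i.
pose D : {set 'I_M} := finset (fun i : 'I_M => (i < size s)%N).
have idx z : z \in s -> (index z s < M)%N by rewrite -index_mem => h; exact: leq_trans h szs.
pose num z (zs : z \in s) : 'I_M := Ordinal (idx z zs).
have numD z (zs : z \in s) : num z zs \in D by rewrite inE /= index_mem.
have jnum z (zs : z \in s) : j (num z zs) = z by exact: nth_index.
have xs : x \in s by exact: ball_center.
exists ([ffun ik => medge (j ik.1) (j ik.2)], D, (num x xs, num a ax, num y yx)).
rewrite inE; apply/asboolP; exists j; split=> //.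
- move=> i k; rewrite !inE => iD kD /eqP; rewrite nth_uniq ?ball_uniq // => /eqP.
  exact: val_inj.
- move=> z; split=> [zs|[i iD <-]]; first by exists (num z zs).
  by apply: mem_nth; move: iD; rewrite inE.
- by move=> i k _ _; rewrite ffunE.
Qed.

Lemma biso_of_ball_type A B (x a y : A) (x' a' y' : B) : a \in ball r x -> y \in ball r x ->
  ball_type x a y = ball_type x' a' y' ->
  exists g, [/\ biso r x x' g, g a = a' & g y = y'].
Proof.
move=> ax yx T; have [c cx] := ball_type_nonempty ax yx.
have := cx; rewrite T inE => /asboolP[j' cj']; move: cx; rewrite inE => /asboolP[j cj].
case: c cj cj' => -[E D] [[i0 i1] i2] [ji jim je [D0 D1 D2] [j0 j1 j2]]
  [ji' jim' je' _ [j0' j1' j2']].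
have /choice[k Hk] : forall z, exists i, z \in ball r x -> i \in D /\ j i = z.
  move=> z; have [zx|n] := pselect (z \in ball r x); last by exists i0.
  by have [i ? ?] := (jim z).1 zx; exists i.
have kj i : i \in D -> k (j i) = i.
  move=> iD; have jx : j i \in ball r x by apply/jim; exists i.
  by have [kD kE] := Hk _ jx; exact: ji.
exists (fun z => j' (k z)); split.
- split=> [|z w zx wx|z|z w zx wx].
  + by rewrite -j0 kj.
  + have [zD <-] := Hk _ zx; have [wD <-] := Hk _ wx; rewrite !kj //.
    by move=> /(ji' _ _ zD wD) ->.
  + split=> [/jim'[i iD <-]|[w /Hk[kD _] <-]]; last by apply/jim'; exists (k w).
    by exists (j i); [apply/jim; exists i | rewrite kj].
  + have [zD zE] := Hk _ zx; have [wD wE] := Hk _ wx.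
    by rewrite je' // -{2}zE -{2}wE je.
- by rewrite -j1 kj.
- by rewrite -j2 kj.
Qed.

End BallTypes.

Arguments ball_type {R d} r {A} x a y.

Section TypeMeasurable.
Variables (R : realType) (d : nat) (A : mgraph R d).

(** The coincidences among words determine the ball. Length [L + 1] is needed for edges: an edge
    between two points of the [L]-ball is a coincidence of a word prolonged by one letter with
    another word. *)
Lemma walk_code_biso L (x x' : A) :
  (forall w w' : L.+1.-tuple (moves A), (walk w x == walk w' x) = (walk w x' == walk w' x')) ->
  exists g, biso L x x' g /\ forall w : seq (moves A), (size w <= L)%N -> g (walk w x) = walk w x'.
Proof.
move=> Hw.
have [i0 iE] := move_id A.
have pad (w : seq (moves A)) : (size w <= L.+1)%N ->
    exists w' : L.+1.-tuple (moves A), forall z : A, walk w' z = walk w z.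
  move=> wL; have sz : size (w ++ nseq (L.+1 - size w) i0) == L.+1.
    by rewrite size_cat size_nseq subnKC.
  exists (Tuple sz) => z /=; rewrite walk_cat.
  by elim: (L.+1 - size w)%N => //= n; rewrite iE.
have Hs w w' : (size w <= L.+1)%N -> (size w' <= L.+1)%N ->
    (walk w x == walk w' x) = (walk w x' == walk w' x').
  by move=> /pad[v vE] /pad[v' vE']; rewrite -!vE -!vE'.
have /choice[wd Hwd] : forall z : A, exists w, z \in ball L x -> size w = L /\ walk w x = z.
  move=> z; have [/mem_ball H|n] := pselect (z \in ball L x); last by exists [::].
  by have [w ? ?] := gball_walk H; exists w.
pose g z := walk (wd z) x'.
have gE w : (size w <= L)%N -> g (walk w x) = walk w x'.
  move=> wL; have wx : walk w x \in ball L x.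
    by apply/mem_ball; apply: gball_mono wL (walk_gball w x).
  have [sz wE] := Hwd _ wx; apply/eqP; rewrite /g -Hs ?sz // ?wE //; exact: leqW.
exists g; split=> //.
have bw (y : A) z : z \in ball L y -> exists2 w, (size w <= L)%N & walk w y = z.
  by move=> /mem_ball H; have [w sw wE] := gball_walk H; exists w; rewrite ?sw.
split.
- exact: (gE [::]).
- move=> y z /bw[w wL <-] /bw[v vL <-]; rewrite !gE // => /eqP; rewrite -Hs; try exact: leqW.
  by move/eqP.
- move=> y; split=> [/bw[w wL <-]|[z /bw[w wL <-] <-]].
    by exists (walk w x); [apply/mem_ball; apply: gball_mono wL (walk_gball w x) | exact: gE].
  by rewrite gE //; apply/mem_ball; apply: gball_mono wL (walk_gball w x').
- move=> y z /bw[w wL <-] /bw[v vL <-]; rewrite !gE //.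
  have edgeE (u : A) : medge (walk w u) (walk v u) =
      has (fun i => (walk (w ++ [:: i]) u == walk v u) && (walk w u != walk v u)) (enum (moves A)).
    apply/idP/hasP => [/[dup] wv /move_ex[i iv]|[i _ /andP[/eqP <-]]].
      exists i; rewrite ?mem_enum // walk_cat /= iv eqxx /=.
      by apply: contraTneq wv => ->; rewrite medge_irr.
    by rewrite walk_cat /=; case: (move_edge i (walk w u)) => [->|//]; rewrite eqxx.
  rewrite !edgeE; apply: eq_has => i.
  by rewrite -!Hs ?size_cat ?addn1 //; exact: leqW.
Qed.

Lemma nice_ball_type r (t : {set code d r}) : nice3 (fun x a y : A => ball_type r x a y == t).
Proof.
move=> u v; pose L := maxn r (maxn (size u) (size v)).
pose T := L.+1.-tuple (moves A).
have fin : finmeas (@meas _ _ A) (fun x : A => [seq walk ww.1 x == walk ww.2 x | ww : T * T <- enum {: T * T}]).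
  by apply: finmeas_seq => ww; exact: finmeas_walk_eq.
apply: (finmeas_determined (mvertex0 A) fin) => x x' /eq_in_map E.
have [|g [gb gE]] := @walk_code_biso L x x'.
  by move=> w w'; apply: (E (w, w')); rewrite mem_enum.
have bw w : (size w <= L)%N -> walk w x \in ball L x.
  by move=> wL; apply/mem_ball; apply: gball_mono wL (walk_gball w x).
have uL : (size u <= L)%N by rewrite /L !leq_max leqnn orbT.
have vL : (size v <= L)%N by rewrite /L !leq_max leqnn !orbT.
by rewrite (ball_type_biso gb (leq_maxl _ _) (bw u uL) (bw v vL)) !gE.
Qed.

End TypeMeasurable.

(** * Conditional expectations and local rules *)

Section ConditionalExpectation.
Variables (R : realType) (W : Type) (dm : W -> Prop) (N : (W -> R) -> Prop).
Variables (L : (W -> R) -> R) (T : finType) (th : W -> T).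
Hypothesis N_cst : forall c, N (fun=> c).
Hypothesis N_map2 : forall (f : R -> R -> R) g h, N g -> N h -> N (fun w => f (g w) (h w)).
Hypothesis N_ind : forall t, N (fun w => (th w == t)%:R).
Hypothesis LD : forall g h, N g -> N h -> L (fun w => g w + h w) = L g + L h.
Hypothesis LZ : forall c g, N g -> L (fun w => c * g w) = c * L g.
Hypothesis L_le : forall g h, N g -> N h -> (forall w, dm w -> g w <= h w) -> L g <= L h.

Let ind t w : R := (th w == t)%:R.

Lemma mean_eq_on g h : N g -> N h -> (forall w, dm w -> g w = h w) -> L g = L h.
Proof. by move=> Ng Nh gh; apply/eqP; rewrite eq_le !L_le // => w /gh ->. Qed.

Lemma mean0 : L (fun=> 0) = 0.
Proof.
rewrite -[RHS](mul0r (L (fun=> 0))) -LZ //.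
by congr (L _); apply/funext => w; rewrite mul0r.
Qed.

Lemma mean_ge0 g : N g -> (forall w, dm w -> 0 <= g w) -> 0 <= L g.
Proof. by move=> Ng g0; rewrite -mean0; apply: L_le. Qed.

Lemma closed_mul g h : N g -> N h -> N (fun w => g w * h w).
Proof. exact: N_map2. Qed.

Lemma closed_mul_label g t : N g -> N (fun w => g w * ind t w).
Proof. by move=> Ng; exact: closed_mul Ng (N_ind t). Qed.

Lemma closed_map (f : R -> R) g : N g -> N (fun w => f (g w)).
Proof. by move=> Ng; apply: (N_map2 (fun a _ => f a) Ng Ng). Qed.

Lemma closed_sum (I : Type) (s : seq I) (h : I -> W -> R) :
  (forall i, N (h i)) -> N (fun w => \sum_(i <- s) h i w).
Proof.
move=> Nh; elim: s => [|i s IH].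
  by under eq_fun do rewrite big_nil.
by under eq_fun do rewrite big_cons; exact: N_map2.
Qed.

Lemma mean_sum (I : Type) (s : seq I) (h : I -> W -> R) :
  (forall i, N (h i)) -> L (fun w => \sum_(i <- s) h i w) = \sum_(i <- s) L (h i).
Proof.
move=> Nh; elim: s => [|i s IH].
  by under eq_fun do rewrite big_nil; rewrite mean0 big_nil.
by under eq_fun do rewrite big_cons; rewrite LD ?IH ?big_cons //; exact: closed_sum.
Qed.

Lemma sum_ind (F : T -> R) w : \sum_t F t * ind t w = F (th w).
Proof.
rewrite (bigD1 (th w)) //= /ind eqxx mulr1 big1 ?addr0 // => t /negPf.
by rewrite eq_sym => ->; rewrite mulr0.
Qed.

Lemma closed_label (F : T -> R) : N (fun w => F (th w)).
Proof.
under eq_fun do rewrite -sum_ind; apply: closed_sum => t.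
exact: (closed_map (fun u => F t * u) (N_ind t)).
Qed.

Lemma mean_split h : N h -> L h = \sum_t L (fun w => h w * ind t w).
Proof.
move=> Nh; rewrite -mean_sum; last by move=> t; exact: closed_mul_label.
congr (L _); apply/funext => w; rewrite -big_distrr /=.
suff -> : \sum_t ind t w = 1 by rewrite mulr1.
by rewrite -[RHS](sum_ind (fun=> 1) w); apply: eq_bigr => t _; rewrite mul1r.
Qed.

(** [dm] marks the arguments over which [L] takes the mean; the label has to determine the value
    only there. *)
Definition determined (h : W -> R) :=
  forall w w', dm w -> dm w' -> th w = th w' -> h w = h w'.

Lemma determinedP h : determined h -> exists U, forall w, dm w -> h w = U (th w).
Proof.
move=> dh; have /choice[U HU] : forall t, exists u, forall w, dm w -> th w = t -> h w = u.
  move=> t; have [[w [dw wt]]|n] := pselect (exists w, dm w /\ th w = t).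
    by exists (h w) => w' dw' wt'; apply: dh => //; rewrite wt.
  by exists 0 => w dw wt; exfalso; apply: n; exists w.
by exists U => w dw; exact: HU.
Qed.

(** On a label of mean zero the quotient is 0; for unit-valued [g] the identity [cexpM] holds there
    too, since the numerator vanishes as well. *)
Definition cexp (g : W -> R) (t : T) : R := L (fun w => g w * ind t w) / L (ind t).

Definition unit_valued (g : W -> R) := forall w, dm w -> 0 <= g w <= 1.

Lemma cexp_bounds g t : N g -> unit_valued g ->
  0 <= L (fun w => g w * ind t w) <= L (ind t).
Proof.
move=> Ng g01; apply/andP; split.
  apply: mean_ge0 => [|w]; first exact: closed_mul_label.
  by move=> /g01/andP[g0 _]; rewrite mulr_ge0 // ler0n.
apply: L_le => [||w /g01/andP[_ g1]]; [exact: closed_mul_label | exact: N_ind |].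
by rewrite ler_piMl // ler0n.
Qed.

Lemma cexp01 g t : N g -> unit_valued g -> 0 <= cexp g t <= 1.
Proof.
move=> Ng g01; have /andP[g0 g1] := cexp_bounds t Ng g01.
have := le_trans g0 g1; rewrite /cexp le_eqVlt => /predU1P[<-|t0].
  by rewrite invr0 mulr0 lexx ler01.
by rewrite divr_ge0 ?(ltW t0) // ler_pdivrMr // mul1r.
Qed.

Lemma cexpM g t : N g -> unit_valued g -> cexp g t * L (ind t) = L (fun w => g w * ind t w).
Proof.
move=> Ng g01; have /andP[g0 g1] := cexp_bounds t Ng g01.
rewrite /cexp; have [E|n] := eqVneq (L (ind t)) 0; last by rewrite divfK.
by rewrite E mulr0; apply/eqP; rewrite eq_le g0 /= -E g1.
Qed.

Lemma cexp_proj g h : N g -> unit_valued g -> N h -> determined h ->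
  L (fun w => cexp g (th w) * h w) = L (fun w => g w * h w).
Proof.
move=> Ng g01 Nh /determinedP[U HU].
rewrite mean_split; last by apply: closed_mul => //; exact: closed_label.
rewrite [RHS]mean_split; last exact: closed_mul.
apply: eq_bigr => t _.
have Ngi : N (fun w => g w * ind t w) by exact: closed_mul_label.
transitivity (U t * L (fun w => g w * ind t w)).
  rewrite -(cexpM t Ng g01) mulrA -LZ; last exact: N_ind.
  apply: mean_eq_on => [||w dw].
  - by apply: closed_mul_label; apply: closed_mul => //; exact: closed_label.
  - exact: (closed_map ( *%R (U t * cexp g t)) (N_ind t)).
  - by rewrite HU // /ind; case: eqP => [->|_]; rewrite ?mulr0 // [U t * _]mulrC.
rewrite -LZ //; apply: mean_eq_on => [||w dw].
- exact: (closed_map ( *%R (U t)) Ngi).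
- by apply: closed_mul_label; exact: closed_mul.
- by rewrite HU // /ind; case: eqP => [->|_]; rewrite ?mulr0 // !mulr1 mulrC.
Qed.

(** On each label the left side is the absolute value of a mean, hence at most the mean of the
    absolute value. [f] is characterised by its means over labels, so it need not be given as a
    [cexp]. *)
Lemma cexp_contract f g h : N f -> determined f -> N g ->
  (forall t, L (fun w => f w * ind t w) = L (fun w => g w * ind t w)) ->
  N h -> unit_valued h ->
  L (fun w => `|f w - cexp h (th w)|) <= L (fun w => `|g w - h w|).
Proof.
move=> Nf /determinedP[U HU] Ng fg Nh h01.
have Nd (a b : W -> R) : N a -> N b -> N (fun w => `|a w - b w|).
  exact: (N_map2 (fun a b => `|a - b|)).
have Nch := closed_label (cexp h).
rewrite mean_split; last exact: Nd.
rewrite [leRHS]mean_split; last exact: Nd.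
apply: ler_sum => t _.
have -> : L (fun w => `|f w - cexp h (th w)| * ind t w) = `|U t - cexp h t| * L (ind t).
  rewrite -LZ; last exact: N_ind.
  apply: mean_eq_on => [||w /HU ->]; first by apply: closed_mul_label; exact: Nd.
    exact: (closed_map ( *%R _) (N_ind t)).
  by rewrite /ind; case: eqP => [->|_]; rewrite ?mulr0.
have t0 : 0 <= L (ind t) by apply: mean_ge0 => [|w _]; [exact: N_ind | rewrite ler0n].
rewrite -(ger0_norm t0) -normrM mulrBl (cexpM t Nh h01) -LZ; last exact: N_ind.
have -> : L (fun w => U t * ind t w) = L (fun w => g w * ind t w).
  rewrite -fg; apply: mean_eq_on => [||w /HU ->]; first exact: (closed_map ( *%R _) (N_ind t)).
    exact: closed_mul_label.
  by rewrite /ind; case: eqP => [->|_]; rewrite ?mulr0.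
have Ngi := closed_mul_label t Ng; have Nhi := closed_mul_label t Nh.
have -> : L (fun w => g w * ind t w) - L (fun w => h w * ind t w) =
    L (fun w => (g w - h w) * ind t w).
  rewrite -mulN1r -(LZ _ Nhi) -(LD Ngi (closed_map ( *%R (-1)) Nhi)).
  by congr (L _); apply/funext => w; ring.
have Ngh : N (fun w => (g w - h w) * ind t w).
  by apply: closed_mul_label; exact: (N_map2 (fun a b => a - b)).
have Nagh : N (fun w => `|g w - h w| * ind t w) by apply: closed_mul_label; exact: Nd.
rewrite ler_norml; apply/andP; split.
  rewrite lerNl -mulN1r -LZ //; apply: L_le => // [|w _]; first exact: (closed_map ( *%R _) Ngh).
  by rewrite mulrA ler_wpM2r ?ler0n // mulN1r -normrN ler_norm.
by apply: L_le => // w _; rewrite ler_wpM2r ?ler0n // ler_norm.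
Qed.

(** Pointwise [2 c |g| <= g^2 + c^2]; this stands in for the Cauchy-Schwarz inequality and avoids
    square roots. *)
Lemma mean_norm_le c g : 0 < c -> N g ->
  L (fun w => `|g w|) <= L (fun w => g w ^+ 2) / (2 * c) + c / 2 * L (fun=> 1).
Proof.
move=> c0 Ng; have N2 : N (fun w => g w ^+ 2) := closed_map (fun a => a ^+ 2) Ng.
rewrite [_ / (2 * c)]mulrC -LZ // -LZ // -LD; last 2 first.
- exact: (closed_map ( *%R _) N2).
- exact: (closed_map ( *%R _) (N_cst 1)).
apply: L_le => [||w _]; first exact: (closed_map (fun a => `|a|)).
  apply: (N_map2 +%R); first exact: (closed_map ( *%R _) N2).
  exact: (closed_map ( *%R _) (N_cst 1)).
have -> : (2 * c)^-1 * g w ^+ 2 + c / 2 * 1 = `|g w| + (`|g w| - c) ^+ 2 / (2 * c).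
  rewrite -(real_normK (num_real (g w))); set u := `|g w|; field; lra.
by rewrite lerDl divr_ge0 ?sqr_ge0 // mulr_ge0 // ltW.
Qed.

End ConditionalExpectation.

Opaque ball_type.
Section Rules.
Variables (R : realType) (d : nat).
Implicit Types A B : mgraph R d.

Definition rule K r (F : {set code d r} -> R) A (x y : A) : R :=
  (y \in ball K x)%:R * F (ball_type r x x y).

Lemma biso_mem A B r s k (x : A) (x' : B) g y z : biso r x x' g -> (s + k <= r)%N ->
  z \in ball k x -> y \in ball r x -> (g y \in ball s (g z)) = (y \in ball s z).
Proof.
move=> gb sk zx yx; apply/idP/idP => [H|]; last exact: biso_ball gb sk zx.
have [_ _ im _] := biso_restrict gb sk zx; have [w wz wy] := (im (g y)).1 H.
have [_ gi _ _] := gb; suff <- : w = y by [].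
by apply: gi => //; apply: ball_sub (ball_trans zx wz); rewrite addnC.
Qed.

Lemma rule_biso K s k (F : {set code d s} -> R) r A B (x : A) (x' : B) g z y :
  biso r x x' g -> (K <= s)%N -> (s + k <= r)%N -> z \in ball k x -> y \in ball r x ->
  rule K F (g z) (g y) = rule K F z y.
Proof.
move=> gb Ks sk zx yx; have gzb := biso_restrict gb sk zx.
have Kk : (K + k <= r)%N by apply: leq_trans sk; rewrite leq_add2r.
rewrite /rule (biso_mem gb Kk zx yx).
have [yz|_] := boolP (y \in ball K z); last by rewrite !mul0r.
by rewrite -(ball_type_biso gzb) ?ball_center // (ball_sub Ks).
Qed.

Lemma nice_rule K r F A : nice2 (@rule K r F A).
Proof.
move=> v; apply: (finmeas_map2 (fun (b : bool) u => b%:R * u)); first exact: nice_ball.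
have -> : (fun x : A => F (ball_type r x x (walk v x))) = fun x : A =>
    \sum_t F t * (ball_type r x x (walk v x) == t)%:R.
  apply/funext => x; rewrite (bigD1 (ball_type r x x (walk v x))) //= eqxx mulr1.
  by rewrite big1 ?addr0 // => t /negPf; rewrite eq_sym => ->; rewrite mulr0.
apply: finmeas_sum => t; apply: (finmeas_map ( *%R (F t))); apply: finmeas_nat.
exact: (nice_ball_type t [::] v).
Qed.

Lemma rule01 K r F A (x y : A) : (forall t, 0 <= F t <= 1) -> 0 <= @rule K r F A x y <= 1.
Proof.
move=> F01; rewrite /rule; case: (y \in _); last by rewrite mul0r lexx ler01.
by rewrite mul1r.
Qed.

End Rules.

Lemma eq_leR (R : realType) (a b : R) : a = b -> a <= b. Proof. by move=> ->. Qed.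

(** * Energy increments of local averages *)

Section Energy.
Variables (R : realType) (d : nat) (G : mgraph R d) (K : nat).
Variable phi : G -> G -> R.
Hypothesis phi_nice : nice2 phi.
Hypothesis phi01 : forall x y, 0 <= phi x y <= 1.
Hypothesis phi_ball : forall x y, y \notin ball K x -> phi x y = 0.
Hypothesis phi_sum : forall x, \sum_(y <- ball K x) phi x y = 1.

Local Notation e := (@medge R d G).
Local Notation L := (edge_mean K).
Local Notation P := (pair_mean K).

Let dm2 (w : G * G) : Prop := w.2 \in ball K w.1.
Let dm3 (w : G * G * G) : Prop := e w.1.1 w.1.2 /\ w.2 \in dom K w.1.1 w.1.2.
Let N2 (g : G * G -> R) := nice2 (fun x y => g (x, y)).
Let N3 (g : G * G * G -> R) := nice3 (fun x a y => g (x, a, y)).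
Let L2 (g : G * G -> R) := P (fun x y => g (x, y)).
Let L3 (g : G * G * G -> R) := L (fun x a y => g (x, a, y)).
Let th2 r (w : G * G) := ball_type r w.1 w.1 w.2.
Let th3 r (w : G * G * G) := ball_type r w.1.1 w.1.2 w.2.

Let N2_cst c : N2 (fun=> c). Proof. by move=> v; exact: finmeas_cst. Qed.
Let N3_cst c : N3 (fun=> c). Proof. by move=> u v; exact: finmeas_cst. Qed.
Let N2_map2 (f : R -> R -> R) g h : N2 g -> N2 h -> N2 (fun w => f (g w) (h w)).
Proof. by move=> Ng Nh v; exact: (finmeas_map2 f (Ng v) (Nh v)). Qed.
Let N3_map2 (f : R -> R -> R) g h : N3 g -> N3 h -> N3 (fun w => f (g w) (h w)).
Proof. by move=> Ng Nh u v; exact: (finmeas_map2 f (Ng u v) (Nh u v)). Qed.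
Let N2_ind r t : N2 (fun w => (th2 r w == t)%:R).
Proof. by move=> v; apply: finmeas_nat; exact: (nice_ball_type t [::] v). Qed.
Let N3_ind r t : N3 (fun w => (th3 r w == t)%:R).
Proof. by move=> u v; apply: finmeas_nat; exact: nice_ball_type. Qed.
Let L2D g h : N2 g -> N2 h -> L2 (fun w => g w + h w) = L2 g + L2 h.
Proof. exact: pair_meanD. Qed.
Let L3D g h : N3 g -> N3 h -> L3 (fun w => g w + h w) = L3 g + L3 h.
Proof. exact: edge_meanD. Qed.
Let L2Z c g : N2 g -> L2 (fun w => c * g w) = c * L2 g.
Proof. exact: pair_meanZ. Qed.
Let L3Z c g : N3 g -> L3 (fun w => c * g w) = c * L3 g.
Proof. exact: edge_meanZ. Qed.
Let L2_le g h : N2 g -> N2 h -> (forall w, dm2 w -> g w <= h w) -> L2 g <= L2 h.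
Proof. by move=> Ng Nh gh; apply: pair_mean_le => // x y yx; exact: gh. Qed.
Let L3_le g h : N3 g -> N3 h -> (forall w, dm3 w -> g w <= h w) -> L3 g <= L3 h.
Proof. by move=> Ng Nh gh; apply: edge_mean_le => // x a y xa yx; exact: gh. Qed.

Let phi2 (w : G * G) := phi w.1 w.2.
Let N2_phi : N2 phi2. Proof. exact: phi_nice. Qed.
Let phi2_01 : unit_valued dm2 phi2. Proof. by move=> w _; exact: phi01. Qed.

Definition avg_coef r (t : {set code d r}) : R := cexp L2 (th2 r) phi2 t.

Lemma avg_coef01 r t : 0 <= @avg_coef r t <= 1.
Proof. exact: (cexp01 N2_cst N2_map2 (@N2_ind r) L2Z L2_le t N2_phi phi2_01). Qed.

Local Notation f r := (@rule R d K r (@avg_coef r) G).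

Definition local2 r (h : G -> G -> R) := forall x y x' y' : G,
  y \in ball K x -> y' \in ball K x' -> ball_type r x x y = ball_type r x' x' y' ->
  h x y = h x' y'.

Definition local3 r (h : G -> G -> G -> R) := forall x a y x' a' y' : G,
  e x a -> y \in dom K x a -> e x' a' -> y' \in dom K x' a' ->
  ball_type r x a y = ball_type r x' a' y' -> h x a y = h x' a' y'.

Lemma pair_mean_proj r h : nice2 h -> local2 r h ->
  P (fun x y => f r x y * h x y) = P (fun x y => phi x y * h x y).
Proof.
move=> nh lh; pose h2 w := h w.1 w.2.
have dh : determined dm2 (th2 r) h2.
  by move=> [x y] [x' y'] /= yx yx'; exact: lh.
have := cexp_proj N2_cst N2_map2 (@N2_ind r) L2D L2Z L2_le N2_phi phi2_01 (h := h2) nh dh.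
rewrite [X in _ = X -> _]/L2 => <-.
apply: (mean_eq_on L2_le (g := fun w => f r w.1 w.2 * h2 w)
  (h := fun w => cexp L2 (th2 r) phi2 (th2 r w) * h2 w)).
- by apply: (N2_map2 *%R) => //; exact: nice_rule.
- by apply: (N2_map2 *%R) => //; exact: (closed_label N2_cst N2_map2 (@N2_ind r)).
- by move=> [x y] /= yx; rewrite /rule yx mul1r.
Qed.

Lemma rule_out r F (x y : G) : y \notin ball K x -> @rule R d K r F G x y = 0.
Proof. by move=> /negPf yx; rewrite /rule yx mul0r. Qed.

(* Otherwise unification unfolds rules of different radii before telling them apart. *)
Opaque rule avg_coef.

Lemma ball_dom (x a y : G) : y \in dom K x a -> y \in ball K.+1 x.
Proof. by rewrite mem_filter => /andP[]. Qed.

Lemma local2_sum_nb r (h : G -> G -> G -> R) : (0 < r)%N -> (K <= r)%N -> local3 r h ->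
  local2 r (fun x y => \sum_(a <- nb x) h x a y).
Proof.
move=> r0 Kr lh x y x' y' yx yx' T.
have yr : y \in ball r x := ball_sub Kr yx.
have [g [gb _ gy]] := biso_of_ball_type (ball_center _ _) yr T.
rewrite [RHS](perm_big _ (perm_nb_biso r0 gb)) [RHS]big_map /= [LHS]big_seq [RHS]big_seq.
apply: eq_bigr => a; rewrite mem_nb => xa.
have ax : a \in ball r x := ball_sub r0 (nb_ball xa).
have [gx _ _ ge] := gb.
have xa' : e x' (g a) by rewrite -gx ge ?ball_center.
apply: lh => //; rewrite ?mem_dom ?yx ?yx' //.
by rewrite -gy; exact: (ball_type_biso gb).
Qed.

Lemma nice2_sum_nb (h : G -> G -> G -> R) : nice3 h -> nice2 (fun x y => \sum_(a <- nb x) h x a y : R).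
Proof. by move=> nh v; apply: (@finmeas_sum_nb _ _ _ (fun x a => h x a (walk v x))) => u; exact: nh. Qed.

Lemma edge_mean_ball (g : G -> G -> R) (h : G -> G -> G -> R) : (forall x y, y \notin ball K x -> g x y = 0) ->
  L (fun x a y => g x y * h x a y) = P (fun x y => g x y * \sum_(a <- nb x) h x a y).
Proof.
move=> g0; congr expect; apply/funext => x.
under [RHS]eq_bigr do rewrite big_distrr /=.
rewrite exchange_big /= big_seq [RHS]big_seq; apply: eq_bigr => a; rewrite mem_nb => xa.
by apply: sum_dom_ball => // y /g0->; rewrite mul0r.
Qed.

(* The number of neighbours [a] of [x] giving a prescribed type is determined by
   the type without [a]; so marking [a] does not change the expectation. *)
Lemma edge_mean_proj r (h : G -> G -> G -> R) : (K < r)%N -> nice3 h -> local3 r h ->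
  L (fun x a y => f r x y * h x a y) = L (fun x a y => phi x y * h x a y).
Proof.
move=> Kr nh lh; rewrite !edge_mean_ball //; last exact: rule_out.
apply: pair_mean_proj; first exact: nice2_sum_nb.
by apply: local2_sum_nb => //; [exact: leq_ltn_trans Kr | exact: ltnW].
Qed.

Lemma local3_rule r s (F : {set code d s} -> R) : (K < r)%N -> (K <= s)%N -> (s <= r)%N ->
  local3 r (fun x a y => @rule R d K s F G x y).
Proof.
move=> Kr Ks sr x a y x' a' y' xa yd xa' yd' T.
have yr : y \in ball r x := ball_sub Kr (ball_dom yd).
have ar : a \in ball r x := ball_sub (leq_ltn_trans (leq0n _) Kr) (nb_ball xa).
have [g [gb _ <-]] := biso_of_ball_type ar yr T.
have [gx _ _ _] := gb; rewrite -gx.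
by rewrite (rule_biso F gb Ks (k := 0)) ?addn0 ?ball_center.
Qed.

(** The strict inequality [s < r] places the [s]-ball of the neighbour [a] inside the [r]-ball of
    [x]. *)
Lemma local3_rule_flip r s (F : {set code d s} -> R) : (K <= s)%N -> (s < r)%N ->
  local3 r (fun x a y => @rule R d K s F G a y).
Proof.
move=> Ks sr x a y x' a' y' xa yd xa' yd' T.
have Kr : (K < r)%N := leq_ltn_trans Ks sr.
have yr : y \in ball r x := ball_sub Kr (ball_dom yd).
have ar : a \in ball r x := ball_sub (leq_ltn_trans (leq0n _) Kr) (nb_ball xa).
have [g [gb <- <-]] := biso_of_ball_type ar yr T.
by rewrite (rule_biso F gb Ks (k := 1)) ?addn1 ?nb_ball.
Qed.

Lemma local3_flip_type r (U : {set code d r} -> R) : (K < r)%N ->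
  local3 r.+1 (fun x a y => U (ball_type r a x y)).
Proof.
move=> Kr x a y x' a' y' xa yd xa' yd' T.
have Kr' : (K < r.+1)%N by exact: leqW.
have yr : y \in ball r.+1 x := ball_sub Kr' (ball_dom yd).
have ar : a \in ball r.+1 x := ball_sub (isT : (1 <= r.+1)%N) (nb_ball xa).
have [g [gb <- <-]] := biso_of_ball_type ar yr T.
have [gx _ _ _] := gb; rewrite -gx.
have r1 : (r + 1 <= r.+1)%N by rewrite addn1.
have gab := biso_restrict gb r1 (nb_ball xa).
have ax : e a x by rewrite medge_sym.
congr U; apply: (ball_type_biso gab) => //.
  exact: ball_sub (leq_ltn_trans (leq0n _) Kr) (nb_ball ax).
by move: yd; rewrite mem_dom // orbC -mem_dom // => /ball_dom; exact: ball_sub.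
Qed.

Lemma edge_mean_ge0 (h : G -> G -> G -> R) : nice3 h -> (forall x a y, 0 <= h x a y) -> 0 <= L h.
Proof.
move=> nh h0; apply: expect_ge0 => [|x]; first exact: finmeas_edge_mean.
by apply: sumr_ge0 => a _; apply: sumr_ge0.
Qed.

Let cst1 : nice3 (fun _ _ _ : G => 1 : R). Proof. by move=> u v; exact: finmeas_cst. Qed.

Lemma edge_mean1 : L (fun _ _ _ : G => 1) <= (d * d.+1 ^ K.+1)%:R.
Proof.
rewrite -[leRHS](expect_cst G) /edge_mean; apply: expect_le.
- exact: finmeas_edge_mean.
- exact: finmeas_cst.
- move=> x; apply: (@le_trans _ _ (\sum_(a <- nb x) (d.+1 ^ K.+1)%:R)).
    apply: ler_sum => a _; rewrite big_const_seq count_predT iter_addr_0.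
    by rewrite ler_nat size_dom.
  by rewrite big_const_seq count_predT iter_addr_0 -mulrnA ler_nat mulnC leq_mul2r size_nb orbT.
Qed.

Opaque edge_mean.

Definition energy r := L (fun x a y => f r x y * f r x y).

Let nf r : nice3 (fun x a y => f r x y). Proof. by apply: nice3_xy; exact: nice_rule. Qed.
Let nf' r : nice3 (fun x a y => f r a y). Proof. by apply: nice3_ay; exact: nice_rule. Qed.
Let nphi' : nice3 (fun x a y => phi a y). Proof. exact: nice3_ay. Qed.
Let nmap2 (o : R -> R -> R) (g h : G -> G -> G -> R) : nice3 g -> nice3 h ->
  nice3 (fun x a y => o (g x a y) (h x a y)).
Proof. by move=> ng nh u v; exact: (finmeas_map2 o (ng u v) (nh u v)). Qed.
Let nmap (o : R -> R) (g : G -> G -> G -> R) : nice3 g -> nice3 (fun x a y => o (g x a y)).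
Proof. by move=> ng u v; exact: (finmeas_map o (ng u v)). Qed.

Lemma energy_phi r : (K < r)%N -> energy r = L (fun x a y => phi x y * f r x y).
Proof.
move=> Kr; exact: (edge_mean_proj Kr (@nf r) (local3_rule (@avg_coef r) Kr (ltnW Kr) (leqnn r))).
Qed.

Lemma edge_mean_sqrB (g h : G -> G -> G -> R) c : nice3 g -> nice3 h ->
  L (fun x a y => g x a y * h x a y) = c ->
  L (fun x a y => (g x a y - h x a y) ^+ 2) =
    L (fun x a y => g x a y * g x a y) - 2 * c + L (fun x a y => h x a y * h x a y).
Proof.
move=> ng nh <-.
have nm (k k' : G -> G -> G -> R) : nice3 k -> nice3 k' -> nice3 (fun x a y => k x a y * k' x a y) by exact: (nmap2 *%R).
rewrite -mulNr -(edge_meanZ _ _ (nm _ _ ng nh)) -(edge_meanD _ (nm _ _ ng ng) (nmap ( *%R (- 2)) (nm _ _ ng nh))).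
rewrite -(edge_meanD _ (nmap2 +%R (nm _ _ ng ng) (nmap ( *%R (- 2)) (nm _ _ ng nh))) (nm _ _ nh nh)).
by congr edge_mean; apply/funext => x; apply/funext => a; apply/funext => y; ring.
Qed.

(** Pythagoras: [f s] is determined by the [r]-ball, so its inner product with [f r] equals that
    with [phi], which is [energy s]. *)
Lemma energy_diff r s : (K < s)%N -> (s <= r)%N ->
  L (fun x a y => (f r x y - f s x y) ^+ 2) = energy r - energy s.
Proof.
move=> Ks sr; have Kr := leq_trans Ks sr.
have E := etrans (edge_mean_proj Kr (@nf s) (local3_rule (@avg_coef s) Kr (ltnW Ks) sr)) (esym (energy_phi Ks)).
have ar (a b : R) : a - 2 * b + b = a - b by ring.
exact: etrans (edge_mean_sqrB (@nf r) (@nf s) E) (ar (energy r) (energy s)).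
Qed.

Lemma energy_mono r s : (K < s)%N -> (s <= r)%N -> energy s <= energy r.
Proof.
move=> Ks sr; rewrite -subr_ge0 -energy_diff //; apply: edge_mean_ge0.
  exact: (nmap (fun u => u ^+ 2) (nmap2 (fun a b => a - b) (@nf r) (@nf s))).
by move=> x a y; exact: sqr_ge0.
Qed.

Lemma energy_bound r : 0 <= energy r <= (d * d.+1 ^ K.+1)%:R.
Proof.
have nsq : nice3 (fun x a y => f r x y * f r x y) := nmap2 *%R (@nf r) (@nf r).
have f01 (x y : G) := rule01 K x y (@avg_coef01 r).
apply/andP; split.
  by apply: (edge_mean_ge0 nsq) => x a y; have /andP[f0 _] := f01 x y; exact: mulr_ge0.
apply: le_trans edge_mean1; apply: (edge_mean_le nsq cst1) => x a y _ _.
by have /andP[f0 f1] := f01 x y; exact: mulr_ile1.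
Qed.

(* [psi r x a y] is the conditional expectation of [phi a y] given the [r]-ball
   of [x], whereas [f r a y] conditions on the [r]-ball of [a]. *)
Let phi3 (w : G * G * G) := phi w.1.2 w.2.
Let phi3_01 : unit_valued dm3 phi3. Proof. by move=> w _; exact: phi01. Qed.
Let psi r (x a y : G) := cexp L3 (th3 r) phi3 (ball_type r x a y).
Let npsi r : nice3 (@psi r). Proof. exact: (closed_label N3_cst N3_map2 (@N3_ind r)). Qed.

Lemma psi_proj r (h : G -> G -> G -> R) : nice3 h -> local3 r h ->
  L (fun x a y => psi r x a y * h x a y) = L (fun x a y => phi a y * h x a y).
Proof.
move=> nh lh; pose h3 w := h w.1.1 w.1.2 w.2.
have dh : determined dm3 (th3 r) h3.
  by move=> [[x a] y] [[x' a'] y'] /= [xa yx] [xa' yx']; exact: lh.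
exact: (cexp_proj N3_cst N3_map2 (@N3_ind r) L3D L3Z L3_le nphi' phi3_01 (h := h3) nh dh).
Qed.

(** By [edge_mean_proj], [f r x] is also the average of [phi x] with [a] marked. Both terms on the
    left thus average over the same types, and averaging contracts the L1 distance. *)
Lemma psi_contract r : (K < r)%N ->
  L (fun x a y => `|f r x y - psi r x a y|) <= L (fun x a y => `|phi x y - phi a y|).
Proof.
move=> Kr.
have lf := local3_rule (@avg_coef r) Kr (ltnW Kr) (leqnn r).
have det : determined dm3 (th3 r) (fun w => f r w.1.1 w.2).
  by move=> [[x a] y] [[x' a'] y'] [xa yx] [xa' yx']; exact: lf.
have proj t : L3 (fun w => f r w.1.1 w.2 * (th3 r w == t)%:R) =
    L3 (fun w => phi w.1.1 w.2 * (th3 r w == t)%:R).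
  apply: (edge_mean_proj Kr (h := fun x a y => (ball_type r x a y == t)%:R)).
    exact: N3_ind.
  by move=> x a y x' a' y' _ _ _ _ ->.
exact: (cexp_contract N3_cst N3_map2 (@N3_ind r) L3D L3Z L3_le
  (@nf r) det (nice3_xy phi_nice) proj nphi' phi3_01).
Qed.

Let nmul (g h : G -> G -> G -> R) : nice3 g -> nice3 h ->
  nice3 (fun x a y => g x a y * h x a y) := @nmap2 *%R g h.

(** With [x] and [a] exchanged, [psi r] is determined by the [(r+1)]-ball of [x], and its inner
    product with [f r.+1] is its own squared norm. The squared distance of the two, which is
    nonnegative, is then the difference of their squared norms. *)
Lemma psi_energy r : (K < r)%N -> L (fun x a y => psi r x a y * psi r x a y) <= energy r.+1.
Proof.
move=> Kr.
have lpsi : local3 r (psi r) by move=> x a y x' a' y' _ _ _ _ E; rewrite /psi E.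
have lpsi' : local3 r.+1 (fun x a y => psi r a x y) := local3_flip_type _ Kr.
have npsi' := nice3_flip (@npsi r).
have E1 := edge_mean_proj (leqW Kr) npsi' lpsi'.
have E2 := edge_mean_flip K (nmul (nice3_xy phi_nice) npsi').
have E3 := psi_proj (@npsi r) lpsi.
have E4 := edge_mean_flip K (nmul (@npsi r) (@npsi r)).
have E5 := edge_mean_sqrB (@nf r.+1) npsi' (etrans E1 (etrans E2 (esym E3))).
have E6 := edge_mean_ge0 (nmap (fun u => u ^+ 2) (nmap2 (fun a b => a - b) (@nf r.+1) npsi'))
  (fun x a y => sqr_ge0 _).
have ar (a b c : R) : 0 <= a - 2 * b + c -> b = c -> b <= a by lra.
exact: (ar _ _ _ (eq_rect _ (fun u => 0 <= u) E6 _ E5) E4).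
Qed.

(** [f r a] is visible in the [(r+1)]-ball of [x], so its inner product with [psi r.+1] is
    [energy r]; the squared norm of [psi r.+1] is at most [energy r.+2]. *)
Lemma psi_close r : (K < r)%N ->
  L (fun x a y => (psi r.+1 x a y - f r a y) ^+ 2) <= energy r.+2 - energy r.
Proof.
move=> Kr; have Kr1 : (K < r.+1)%N := leqW Kr.
have lf' : local3 r.+1 (fun x a y => f r a y) := local3_rule_flip (@avg_coef r) (ltnW Kr) (leqnn _).
have E1 := psi_proj (@nf' r) lf'.
have E2 := edge_mean_flip K (nmul (nice3_xy phi_nice) (@nf r)).
have E3 := edge_mean_flip K (nmul (@nf r) (@nf r)).
have E4 := edge_mean_sqrB (@npsi r.+1) (@nf' r) (etrans E1 (esym (etrans (energy_phi Kr) E2))).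
have ar (a b c e' : R) : a <= b -> c = e' -> a - 2 * c + e' <= b - c by lra.
exact: (le_trans (eq_leR E4) (ar _ _ _ _ (psi_energy Kr1) E3)).
Qed.

(** Triangle inequality along [f r x], [f r.+1 x], [psi r.+1 x a], [f r a]. The middle distance is
    bounded by contraction; each outer one is an energy increment, converted by [mean_norm_le] at
    half of the error terms. *)
Lemma rule_variation r c : (K < r)%N -> 0 < c ->
  L (fun x a y => `|f r x y - f r a y|) <= L (fun x a y => `|phi x y - phi a y|)
    + (energy r.+2 - energy r) / c + c * (d * d.+1 ^ K.+1)%:R.
Proof.
move=> Kr c0; have Kr1 : (K < r.+1)%N := leqW Kr.
have nabs (g h : G -> G -> G -> R) : nice3 g -> nice3 h -> nice3 (fun x a y => `|g x a y - h x a y|).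
  exact: (nmap2 (fun a b => `|a - b|)).
have nB (g h : G -> G -> G -> R) : nice3 g -> nice3 h -> nice3 (fun x a y => g x a y - h x a y).
  exact: (nmap2 (fun a b => a - b)).
pose l1 := L (fun x a y => `|f r.+1 x y - f r x y|).
pose l2 := L (fun x a y => `|f r.+1 x y - psi r.+1 x a y|).
pose l3 := L (fun x a y => `|psi r.+1 x a y - f r a y|).
have H : L (fun x a y => `|f r x y - f r a y|) <= l1 + l2 + l3.
  have n1 := nabs _ _ (@nf r.+1) (@nf r); have n2 := nabs _ _ (@nf r.+1) (@npsi r.+1).
  have n3 := nabs _ _ (@npsi r.+1) (@nf' r).
  rewrite /l1 /l2 /l3 -(edge_meanD _ n1 n2) -(edge_meanD _ (nmap2 +%R n1 n2) n3).
  apply: (edge_mean_le (nabs _ _ (@nf r) (@nf' r)) (nmap2 +%R (nmap2 +%R n1 n2) n3)) => x a y _ _.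
  have ar (a1 a2 a3 a4 : R) : `|a1 - a4| <= `|a2 - a1| + `|a2 - a3| + `|a3 - a4|.
    have -> : a1 - a4 = - (a2 - a1) + (a2 - a3) + (a3 - a4) by ring.
    by rewrite (le_trans (ler_normD _ _)) // lerD2r (le_trans (ler_normD _ _)) // normrN.
  exact: ar.
have B (g : G -> G -> G -> R) z : nice3 g -> L (fun x a y => g x a y ^+ 2) <= z ->
    L (fun x a y => `|g x a y|) <= z / (2 * c) + c / 2 * (d * d.+1 ^ K.+1)%:R.
  move=> ng gz; apply: (@le_trans _ _ (L (fun x a y => g x a y ^+ 2) / (2 * c) + c / 2 * L (fun _ _ _ => 1))).
    exact: (mean_norm_le N3_cst N3_map2 L3D L3Z L3_le (g := fun w => g w.1.1 w.1.2 w.2) c0 ng).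
  apply: lerD; first by rewrite ler_wpM2r // invr_ge0 mulr_ge0 // ltW.
  by rewrite ler_wpM2l ?edge_mean1 // divr_ge0 // ltW.
have m : energy r.+1 - energy r <= energy r.+2 - energy r.
  by rewrite lerD2r; exact: energy_mono.
have B1 : l1 <= _ := B _ _ (nB _ _ (@nf r.+1) (@nf r)) (le_trans (eq_leR (energy_diff Kr (leqnSn r))) m).
have B2 : l3 <= _ := B _ _ (nB _ _ (@npsi r.+1) (@nf' r)) (psi_close Kr).
have C : l2 <= _ := psi_contract Kr1.
move: (energy r.+2 - energy r) B1 B2 C H => z; move: l1 l2 l3 => l1 l2 l3.
move: (L _) (L _) ((d * d.+1 ^ K.+1)%:R : R) => v D q B1 B2 C H.
have E : z / c = z / (2 * c) + z / (2 * c) by field; rewrite gt_eqF.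
have E' : c * q = c / 2 * q + c / 2 * q by field.
rewrite E E'; move: B1 B2 C H; move: (z / (2 * c)) (c / 2 * q) => z1 q1; lra.
Qed.

(** Tested against the indicator of the type of [x], the projection identity equates the sum times
    the frequency of that type with the frequency itself, which is then cancelled. *)
Lemma rule_sum r (x : G) : (K < r)%N ->
  expect (fun z : G => (ball_type r z z z == ball_type r x x x)%:R) != 0 ->
  \sum_(y <- ball K x) f r x y = 1.
Proof.
move=> Kr p0; pose I (z : G) : R := (ball_type r z z z == ball_type r x x x)%:R.
have fI : finmeas (@meas _ _ G) I by apply: finmeas_nat; exact: (nice_ball_type _ [::] [::]).
have lI : local2 r (fun z _ => I z).
  move=> z y z' y' yz yz' T.
  have yr := ball_sub (ltnW Kr) yz.
  have [g [gb _ _]] := biso_of_ball_type (ball_center _ _) yr T.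
  have [gz _ _ _] := gb.
  by rewrite /I (ball_type_biso gb (leqnn _) (ball_center _ _) (ball_center _ _)) gz.
have E : P (fun z y => f r z y * I z) = P (fun z y => phi z y * I z).
  exact: (@pair_mean_proj r (fun z _ => I z) (fun v => fI) lI).
have E1 : P (fun z y => f r z y * I z) = expect I * \sum_(y <- ball K x) f r x y.
  rewrite [RHS]mulrC -expectZ // /pair_mean; congr expect; apply/funext => z.
  rewrite -big_distrl /= /I; case: eqP => [T|_]; last by rewrite !mulr0.
  have [g [gb _ _]] := biso_of_ball_type (ball_center _ _) (ball_center _ _) (esym T).
  have [gx _ _ _] := gb; have Kb : biso K x z g.
    by rewrite -gx; apply: (biso_restrict gb (k := 0)); rewrite ?addn0 ?ball_center // ltnW.
  congr (_ * _); rewrite [LHS](perm_big _ (perm_ball_biso Kb)) [LHS]big_map /=.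
  rewrite [LHS]big_seq [RHS]big_seq; apply: eq_bigr => y yx; rewrite -gx.
  apply: (rule_biso _ gb (ltnW Kr) (k := 0)); rewrite ?addn0 ?ball_center //.
  exact: ball_sub (ltnW Kr) yx.
have E2 : P (fun z y => phi z y * I z) = expect I * 1.
  rewrite mulr1 /pair_mean; congr expect; apply/funext => z.
  by rewrite -big_distrl /= phi_sum mul1r.
exact: (mulfI p0 (etrans (esym E1) (etrans E E2))).
Qed.

End Energy.

Definition hyperfin (V : choiceType) (e : rel V) (Z : pred V) (K : nat) : Prop :=
  forall (x : V) (s : seq V), uniq s ->
    (forall y, y \in s -> gcomponent (isolate e Z) x y) -> (size s <= K)%N.

Lemma isolate_sym (V : Type) (e : rel V) (Z : pred V) :
  symmetric e -> symmetric (isolate e Z).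
Proof. by move=> es x y; rewrite /isolate es; case: (e y x); case: (Z x); case: (Z y). Qed.

Lemma gball_isolate (V : Type) (e : rel V) (Z : pred V) r x y :
  gball (isolate e Z) r x y -> gball e r x y.
Proof.
move=> [p [px yp sp]]; exists p; split=> //; apply: sub_path px => u v.
by case/and3P.
Qed.

(** * The uniform distribution on the pieces *)

Section Pieces.
Variables (R : realType) (d : nat) (G : mgraph R d) (Z : pred G) (K : nat).
Hypothesis Zmeas : meas Z.
Hypothesis ZK : hyperfin (@medge R d G) Z K.
Local Notation e := (@medge R d G).
Local Notation eZ := (isolate e Z).

(** Written with moves so that measurability follows by induction on [n]. *)
Fixpoint reach n (x y : G) : bool :=
  if n is n'.+1 then
    reach n' x y || has (fun i => eZ x (move i x) && reach n' (move i x) y) (enum (moves G))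
  else x == y.

Lemma nice_reach n : nice2 (reach n).
Proof.
elim: n => [|n IH] v /=; first exact: (finmeas_walk_eq [::] v).
apply: (finmeas_map2 orb (IH v)); apply: finmeas_has => i; apply: fin_and.
  apply: (@fin_and _ _ _ (fun x => e x (move i x))); first exact: (nice_edge [:: i]).
  apply: fin_and; apply: (finmeas_map negb); first exact: finmeas_of_meas.
  by apply: finmeas_of_meas; exact: (@move_meas _ _ _ i Z).
exact: (nice3_ay IH [:: i] v).
Qed.

Lemma reachP n x y : reach n x y <-> gball eZ n x y.
Proof.
elim: n x y => [|n IH] x y /=.
  by split=> [/eqP->|H]; [exact: gball_refl | rewrite (gball0 H)].
split=> [/orP[/IH|/hasP[i _ /andP[xi /IH iy]]]|H].
- exact: gball_mono.
- exact: (@gball_trans _ _ 1 _ _ _ _ (gball1 xi) iy).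
- case: (gballS H) => [->|[z xz zy]]; first by apply/orP; left; apply/IH; exact: gball_refl.
  apply/orP; right; have [i iz] := move_ex (proj1 (andP xz)).
  by apply/hasP; exists i; rewrite ?mem_enum // iz xz; apply/IH.
Qed.

Let eZs : symmetric eZ. Proof. apply: isolate_sym; exact: medge_sym. Qed.

(** A path without repeated vertices inside a piece has at most [K] vertices, so [K] steps reach the
    whole piece. *)
Lemma reach_component x y : reach K x y <-> gcomponent eZ x y.
Proof.
rewrite reachP; split=> [|[p px ->]]; first exact: gball_comp.
case: (shortenP px) => q qx uq _; exists q; split=> //; apply: ltnW.
apply: (ZK (x := x) (s := x :: q)) => // z zq.
case/splitPl: zq qx {uq} => q1 q2 <-; rewrite cat_path => /andP[q1x _].
by exists q1.
Qed.

Lemma reach_ball x y : reach K x y -> y \in ball K x.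
Proof. by move=> /reachP H; apply/mem_ball; exact: (gball_isolate H). Qed.

Definition piece_mean (x y : G) : R :=
  (reach K x y)%:R / \sum_(z <- ball K x) (reach K x z)%:R.

Lemma nice_piece_mean : nice2 piece_mean.
Proof.
move=> v; apply: (finmeas_map2 (fun u w => u / w)); first by apply: finmeas_nat; exact: nice_reach.
by apply: finmeas_sum_ball => w; apply: finmeas_nat; exact: nice_reach.
Qed.

Lemma piece_gt0 (x : G) : 1 <= \sum_(z <- ball K x) (reach K x z)%:R :> R.
Proof.
rewrite (bigD1_seq x) ?ball_uniq ?ball_center //=.
have -> : reach K x x by apply/reachP; exact: gball_refl.
by rewrite lerDl sumr_ge0.
Qed.

Lemma piece_mean01 x y : 0 <= piece_mean x y <= 1.
Proof.
have := piece_gt0 x; rewrite /piece_mean; set s := \sum_(z <- _) _ => s1.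
have s0 : 0 < s by apply: lt_le_trans s1.
rewrite divr_ge0 ?ler0n ?(ltW s0) //= ler_pdivrMr // mul1r.
by apply: le_trans s1; case: (reach _ _ _).
Qed.

Lemma piece_mean_ball x y : y \notin ball K x -> piece_mean x y = 0.
Proof.
by move=> yx; rewrite /piece_mean (negbTE (contra (@reach_ball x y) yx)) mul0r.
Qed.

Lemma piece_mean_sum x : \sum_(y <- ball K x) piece_mean x y = 1.
Proof.
rewrite /piece_mean -big_distrl /= divff // gt_eqF //.
exact: lt_le_trans (piece_gt0 x).
Qed.

Lemma piece_mean_eq x a : eZ x a -> piece_mean x =1 piece_mean a.
Proof.
move=> xa y.
have xac : gcomponent eZ x a by exists [:: a]; rewrite /= ?xa.
have E z : reach K x z = reach K a z.
  apply/idP/idP => /reach_component H; apply/reach_component.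
    by apply: gcomponent_trans H; exact: gcomponent_sym.
  exact: gcomponent_trans H.
rewrite /piece_mean E; congr (_ / _).
have F (w : G) : \sum_(z <- ball K w) (reach K w z)%:R = \sum_(z <- [seq z <- ball K w | reach K w z]) 1 :> R.
  by rewrite big_filter [RHS]big_mkcond; apply: eq_bigr => z _; case: (reach _ _ _).
rewrite !F; apply: perm_big; apply: uniq_perm; rewrite ?filter_uniq ?ball_uniq // => z.
rewrite !mem_filter E; case: (boolP (reach K a z)) => //= az.
by rewrite (reach_ball az) reach_ball // E.
Qed.

(** Only edges with an end in [Z] contribute, each at most the sum of the two distributions, of
    total mass 2. With at most [d] edges per vertex and two possible ends in [Z], the factor is
    [4 d]. *)
Lemma piece_mean_variation :
  edge_mean K (fun x a y => `|piece_mean x y - piece_mean a y|)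
    <= 4 * d%:R * expect (fun x => (Z x)%:R : R).
Proof.
pose f := piece_mean; have nf := nice_piece_mean.
have nfx : nice3 (fun x a y => f x y) := nice3_xy nf.
have nfa : nice3 (fun x a y => f a y) := nice3_ay nf.
have fZ : finmeas (@meas _ _ G) (fun x => (Z x)%:R : R) by apply: finmeas_nat; exact: finmeas_of_meas.
have nZx : nice3 (fun x a y : G => (Z x)%:R : R) by move=> u v.
have nZa : nice3 (fun x a y : G => (Z a)%:R : R) by move=> u v; exact: (finmeas_walk u fZ).
have mul (g h : G -> G -> G -> R) : nice3 g -> nice3 h -> nice3 (fun x a y => g x a y * h x a y).
  by move=> ng nh u v; exact: (finmeas_map2 *%R (ng u v) (nh u v)).
have add (g h : G -> G -> G -> R) : nice3 g -> nice3 h -> nice3 (fun x a y => g x a y + h x a y).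
  by move=> ng nh u v; exact: (finmeas_map2 +%R (ng u v) (nh u v)).
have nabs : nice3 (fun x a y => `|f x y - f a y|).
  by move=> u v; exact: (finmeas_map2 (fun s t => `|s - t|) (nfx u v) (nfa u v)).
have B (h : G -> G -> G -> R) : nice3 h ->
    (forall x a, e x a -> \sum_(y <- dom K x a) h x a y = 1) ->
    edge_mean K (fun x a y => (Z x)%:R * h x a y) <= d%:R * expect (fun x => (Z x)%:R : R).
  move=> nh h1; rewrite -(expectZ d%:R fZ); apply: expect_le.
  - by apply: finmeas_edge_mean; exact: (mul _ _ nZx nh).
  - exact: (finmeas_map ( *%R d%:R) fZ).
  - move=> x; apply: (@le_trans _ _ (\sum_(a <- nb x) (Z x)%:R)).
      rewrite big_seq [leRHS]big_seq; apply: ler_sum => a; rewrite mem_nb => xa.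
      by rewrite -big_distrr /= h1 // mulr1.
    rewrite big_const_seq count_predT iter_addr_0 -[leLHS]mulr_natl ler_wpM2r ?ler0n //.
    by rewrite ler_nat size_nb.
have Sx x a : e x a -> \sum_(y <- dom K x a) f x y = 1.
  by move=> xa; rewrite sum_dom_ball //; [exact: piece_mean_sum | exact: piece_mean_ball].
have Sa x a : e x a -> \sum_(y <- dom K x a) f a y = 1.
  by move=> xa; rewrite (perm_big _ (perm_dom K xa)) Sx // medge_sym.
have B1 := B _ nfx Sx; have B2 := B _ nfa Sa.
have F1 := edge_mean_flip K (mul _ _ nZx nfx).
have F2 := edge_mean_flip K (mul _ _ nZx nfa).
have n1 := mul _ _ nZx nfx; have n2 := mul _ _ nZx nfa.
have n3 := mul _ _ nZa nfx; have n4 := mul _ _ nZa nfa.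
have n12 := add _ _ n1 n2; have n34 := add _ _ n3 n4.
have le : edge_mean K (fun x a y => `|f x y - f a y|) <=
    edge_mean K (fun x a y => (Z x)%:R * f x y + (Z x)%:R * f a y +
      ((Z a)%:R * f x y + (Z a)%:R * f a y)).
  apply: (edge_mean_le nabs (add _ _ n12 n34)) => x a y xa _.
  have /andP[fx0 fx1] := piece_mean01 x y; have /andP[fa0 fa1] := piece_mean01 a y.
  rewrite -/(f x y) -/(f a y) in fx0 fx1 fa0 fa1 *.
  have [E|] := boolP (eZ x a).
    have -> : f x y = f a y by exact: piece_mean_eq.
    by rewrite subrr normr0 !addr_ge0 // mulr_ge0 // ler0n.
  rewrite /isolate xa /= negb_and !negbK => ZZ.
  have n : `|f x y - f a y| <= f x y + f a y by rewrite ler_norml; apply/andP; split; lra.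
  apply: le_trans n _; case/orP: ZZ => ->; rewrite !mul1r.
    by rewrite lerDl addr_ge0 // mulr_ge0 // ler0n.
  by rewrite lerDr addr_ge0 // mulr_ge0 // ler0n.
apply: le_trans le _; rewrite (edge_meanD _ n12 n34) (edge_meanD _ n1 n2) (edge_meanD _ n3 n4).
have ar (a1 a2 a3 a4 b : R) : a1 <= b -> a2 <= b -> a1 = a4 -> a2 = a3 ->
  a1 + a2 + (a3 + a4) <= 4 * b by lra.
rewrite -mulrA; exact: (ar _ _ _ _ _ B1 B2 F1 F2).
Qed.

End Pieces.

(** * Rounding a local rule to a partition *)

Section Thresholds.
Variable R : realType.

Lemma threshold_count (N : nat) (u : R) : u <= N%:R ->
  u <= (\sum_(t < N) (t%:R < u)%R)%N%:R.
Proof.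
have H : Num.min u N%:R <= (\sum_(t < N) (t%:R < u)%R)%N%:R :> R.
  elim: N => [|N IH]; first by rewrite big_ord0 ge_min lexx orbT.
  rewrite big_ord_recr /= natrD; case: ltP => Nu /=.
    have Nle : N%:R <= (\sum_(t < N) (t%:R < u)%R)%N%:R :> R by move: IH; rewrite minElt ltNge (ltW Nu).
    by rewrite ge_min -[N.+1%:R]natr1 lerD2r Nle orbT.
  by rewrite addr0 ge_min; move: IH; rewrite (min_l Nu) => ->.
by move=> uN; move: H; rewrite (min_l uN).
Qed.

Lemma threshold_diff (N : nat) (u v : R) :
  (\sum_(t < N) ((t%:R < u)%R != (t%:R < v)%R))%N%:R <= `|u - v| + 1.
Proof.
wlog uv : u v / u <= v.
  move=> H; case: (leP u v) => [/H //|/ltW /H]; rewrite distrC.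
  by congr (_%:R <= _); apply: eq_bigr => t _; rewrite eq_sym.
(* The second bound drives the induction: when [M] itself is counted, [M < v] turns [M - u + 1] into
   at most [v - u + 1]. *)
have H (M : nat) : let S := (\sum_(t < M) ((t%:R < u)%R != (t%:R < v)%R))%N%:R : R in
    S <= v - u + 1 /\ (S <= 0 \/ S <= M%:R - u).
  elim: M => [|M [IH1 IH2]] /=; first by rewrite big_ord0; split; [lra | left].
  rewrite big_ord_recr /= natrD; set S := (\sum_(t < M) _)%N%:R in IH1 IH2 *.
  rewrite -[M.+1%:R]natr1; case: (ltP M%:R u) => Mu; case: (ltP M%:R v) => Mv /=; rewrite ?addr0.
  - by split=> //; case: IH2 => ?; [left | right; lra].
  - by have := lt_le_trans Mu (le_trans uv Mv); rewrite ltxx.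
  - by split; [case: IH2 => ?; lra | right; case: IH2 => ?; lra].
  - by split=> //; case: IH2 => ?; [left | right; lra].
have [S1 _] := H N; apply: le_trans S1 _.
by rewrite lerD2r -normrN opprB ler_norm.
Qed.

End Thresholds.

Section Priority.
Variable T : finType.
Implicit Types (s : {perm T}) (A B : {set T}).

Definition first_elt s A : option T :=
  [pick t in A | [forall u in A, enum_rank (s t) <= enum_rank (s u)]%N].

Lemma first_eltE s A t : t \in A ->
  (forall u, u \in A -> (enum_rank (s t) <= enum_rank (s u))%N) -> first_elt s A = Some t.
Proof.
move=> tA tmin; rewrite /first_elt; case: pickP => [u /andP[uA /forallP umin]|/(_ t)].
  congr Some; apply: (@perm_inj _ s); apply: enum_rank_inj; apply: val_inj; apply/eqP.
  by rewrite eqn_leq tmin // andbT; have := umin t; rewrite tA.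
by rewrite tA /= => /negP[]; apply/forallP => u; apply/implyP => /tmin.
Qed.

Lemma first_eltP s A t : first_elt s A = Some t ->
  t \in A /\ forall u, u \in A -> (enum_rank (s t) <= enum_rank (s u))%N.
Proof.
rewrite /first_elt; case: pickP => // u /andP[uA /forallP umin] [<-]; split=> // w wA.
by have := umin w; rewrite wA.
Qed.

Lemma first_elt_ex s A : (0 < #|A|)%N -> exists t, first_elt s A = Some t.
Proof.
case/card_gt0P => t0 t0A.
case: (arg_minnP (P := [in A]) (fun t => enum_rank (s t) : nat) t0A) => t tA tmin.
by exists t; exact: first_eltE.
Qed.

(** Precomposing the order with the transposition of [t] and [t'] exchanges their ranks. *)
Lemma card_first_elt A t t' : t \in A -> t' \in A ->
  (#|[set s | first_elt s A == Some t]%SET| <= #|[set s | first_elt s A == Some t']%SET|)%N.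
Proof.
move=> tA t'A; pose h (s : {perm T}) : {perm T} := (tperm t t' * s)%g.
have hi : injective h by move=> s s'; exact: mulgI.
rewrite -(card_imset _ hi); apply: subset_leq_card; apply/fintype.subsetP => _ /imsetP[s + ->].
rewrite !inE => /eqP/first_eltP[_ tmin]; apply/eqP; apply: first_eltE => // u uA.
rewrite !permM tpermR; apply: tmin.
by case: tpermP => [_|_|_ _].
Qed.

(** If the first element of the union lies in both sets, it is the first element of both. All
    elements of the union are equally likely to be first, so disagreement has probability at most
    the size of the symmetric difference over that of the union. *)
Lemma card_first_elt_neq A B N : (0 < N)%N -> (N <= #|A|)%N ->
  (#|[set s | first_elt s A != first_elt s B]%SET| * N <=
   #|(A :\: B) :|: (B :\: A)| * #|{perm T}|)%N.
Proof.
move=> N0 NA; set D := (A :\: B) :|: (B :\: A); pose U := A :|: B.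
have NU : (N <= #|U|)%N by apply: leq_trans NA (subset_leq_card (finset.subsetUl _ _)).
have [t0 t0U] : exists t, t \in U by apply/card_gt0P; exact: leq_trans NU.
pose q := #|[set s | first_elt s U == Some t0]%SET|.
have qE t : t \in U -> #|[set s | first_elt s U == Some t]%SET| = q.
  by move=> tU; apply/eqP; rewrite eqn_leq !card_first_elt.
have qU : (#|U| * q <= #|{perm T}|)%N.
  rewrite -sum_nat_const.
  under eq_bigr => t tU do rewrite -(qE t tU) -sum1_card.
  rewrite (exchange_big_dep predT) //= -sum1_card; apply: leq_sum => s _.
  case E: (first_elt s U) => [t|]; last first.
    by rewrite big_pred0 // => t; apply/negP => /andP[_]; rewrite inE ?E.
  rewrite big_mkcond (bigD1 t) //= big1 ?addn0; first by case: ifP.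
  move=> u ut; case: ifP => // /andP[_]; rewrite inE ?E => /eqP[tu].
  by move: ut; rewrite tu eqxx.
have sub : [set s | first_elt s A != first_elt s B]%SET \subset
    (\bigcup_(t in D) [set s | first_elt s U == Some t])%SET.
  apply/fintype.subsetP => s; rewrite inE => neq.
  have [t Et] : exists t, first_elt s U = Some t by apply: first_elt_ex; exact: leq_trans NU.
  apply/finset.bigcupP; exists t; rewrite ?inE ?Et //.
  have [tU tmin] := first_eltP Et; move: tU; rewrite inE.
  have E (C : {set T}) : C \subset U -> t \in C -> first_elt s C = Some t.
    by move=> /fintype.subsetP CU tC; apply: first_eltE => // u /CU; exact: tmin.
  case: (boolP (t \in A)) => tA; case: (boolP (t \in B)) => tB //= _.
  by move: neq; rewrite (E A) ?finset.subsetUl // (E B) ?finset.subsetUr // eqxx.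
have le1 : (#|[set s | first_elt s A != first_elt s B]%SET| <= #|D| * q)%N.
  apply: leq_trans (subset_leq_card sub) _.
  have -> : (#|D| * q = \sum_(t in D) #|[set s | first_elt s U == Some t]%SET|)%N.
    rewrite -sum_nat_const; apply: eq_bigr => t tD; rewrite qE //.
    by move: tD; rewrite !inE => /orP[] /andP[_ ->]; rewrite ?orbT.
  elim/big_ind2: _ => [|n1 C1 n2 C2 h1 h2|//]; first by rewrite cards0.
  by apply: leq_trans (leq_card_setU _ _) _; exact: leq_add.
apply: leq_trans (leq_mul le1 NU) _.
by rewrite -mulnA leq_mul2l [(q * _)%N]mulnC qU orbT.
Qed.

End Priority.

Lemma sum_uniq_witness (T : eqType) (s : seq T) (P : pred T) : uniq s ->
  (forall x y, x \in s -> y \in s -> P x -> P y -> x = y) ->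
  (\sum_(x <- s) P x)%N = has P s.
Proof.
move=> us uP; case: (boolP (has P s)) => [/hasP[x xs Px]|/hasPn nP].
  rewrite (bigD1_seq x) //= Px big_seq_cond big1 ?addn0 // => y /andP[ys yx].
  by apply/eqP; rewrite eqb0; apply: contra yx => Py; apply/eqP; exact: uP.
by rewrite big_seq big1 // => x /nP/negbTE->.
Qed.

Lemma card_set_sum (T : finType) (A : {set T}) : #|A| = (\sum_t (t \in A))%N.
Proof. by rewrite -sum1_card big_mkcond; apply: eq_bigr => t _; case: (t \in A). Qed.

Lemma sum_pair (S T : finType) (F : S * T -> nat) :
  (\sum_p F p = \sum_s \sum_t F (s, t))%N.
Proof. by rewrite pair_bigA; apply: eq_bigr => -[]. Qed.

Section Rounding.
Variables (R : realType) (d : nat) (G : mgraph R d) (K : nat).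
Variables (f : G -> G -> R) (good : pred G).
Hypothesis f_nice : nice2 f.
Hypothesis f01 : forall x y, 0 <= f x y <= 1.
Hypothesis f_ball : forall x y, y \notin ball K x -> f x y = 0.
Hypothesis good_meas : meas good.
Hypothesis f_sum : forall x, good x -> \sum_(y <- ball K x) f x y = 1.
Local Notation e := (@medge R d G).

Variables (m : nat) (c : G -> 'I_m).
Hypothesis c_meas : forall k, meas (fun x => c x == k).
Hypothesis c_inj : forall x y, gball e (2 * K).+1 x y -> c x = c y -> x = y.
Variable N : nat.
Hypothesis N0 : (0 < N)%N.

Local Notation T := ('I_m * 'I_N)%type.

Definition tokens (x : G) : {set T} :=
  finset (fun kt : T => has (fun y => (c y == kt.1) && (kt.2%:R < N%:R * f x y)) (ball K x)).

Let c_ball x y z : y \in ball K x -> z \in ball K x -> c y = c z -> y = z.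
Proof.
move=> /mem_ball yx /mem_ball zx; apply: c_inj.
apply: (@gball_mono _ _ (K + K)); first by rewrite mul2n addnn.
exact: gball_trans (gball_sym (@medge_sym _ _ G) yx) zx.
Qed.

(** Points of one [K]-ball have different colours, so their tokens do not collide, and [y]
    contributes at least [N * f x y] of them. *)
Lemma card_tokens x : good x -> (N <= #|tokens x|)%N.
Proof.
move=> gx; rewrite -(ler_nat R) card_set_sum.
have -> : (\sum_kt (kt \in tokens x) =
    \sum_(y <- ball K x) \sum_(t < N) (t%:R < (N%:R * f x y : R))%R)%N.
  rewrite sum_pair.
  under eq_bigr => k _ do under eq_bigr => t _ do rewrite inE /=.
  have E k (t : 'I_N) : (has (fun y => (c y == k) && (t%:R < N%:R * f x y)) (ball K x) : nat) =
      (\sum_(y <- ball K x) ((c y == k) && (t%:R < (N%:R * f x y : R))%R))%N.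
    rewrite sum_uniq_witness ?ball_uniq // => y z yx zx /andP[/eqP yk _] /andP[/eqP zk _].
    by apply: c_ball yx zx _; rewrite yk zk.
  under eq_bigr => k _ do under eq_bigr => t _ do rewrite E.
  under eq_bigr => k _ do rewrite exchange_big.
  rewrite exchange_big /=; apply: eq_bigr => y _; rewrite exchange_big /=.
  apply: eq_bigr => t _; rewrite (bigD1 (c y)) //= eqxx /= big1 ?addn0 // => k.
  by rewrite eq_sym => /negbTE ->.
apply: (@le_trans _ _ (\sum_(y <- ball K x) N%:R * f x y)).
  by rewrite -big_distrr /= f_sum // mulr1.
rewrite natr_sum; apply: ler_sum => y _.
apply: threshold_count; have /andP[_ f1] := f01 x y.
by rewrite ler_piMr // ler0n.
Qed.

(** The additive term is the rounding error: one token for each point of [dom K x a]. *)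
Lemma card_tokens_diff x a : e x a ->
  #|(tokens x :\: tokens a) :|: (tokens a :\: tokens x)|%:R <=
    N%:R * (\sum_(y <- dom K x a) `|f x y - f a y|) + (d.+1 ^ K.+1)%:R :> R.
Proof.
move=> xa; set D := _ :|: _.
pose xo y (t : 'I_N) := ((t%:R < N%:R * f x y) != (t%:R < N%:R * f a y)).
have sub : (#|D| <= \sum_(y <- dom K x a) \sum_(t < N) xo y t)%N.
  rewrite card_set_sum sum_pair.
  have -> : (\sum_(y <- dom K x a) \sum_(t < N) xo y t =
      \sum_(k < m) \sum_(t < N) \sum_(y <- dom K x a) ((c y == k) && xo y t))%N.
    under [RHS]eq_bigr => k _ do rewrite exchange_big.
    rewrite [RHS]exchange_big /=; apply: eq_bigr => y _; rewrite [RHS]exchange_big /=.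
    apply: eq_bigr => t _; rewrite (bigD1 (c y)) //= eqxx /= big1 ?addn0 // => k.
    by rewrite eq_sym => /negbTE ->.
  apply: leq_sum => k _; apply: leq_sum => t _.
  case: (boolP ((k, t) \in D)) => // kD.
  suff /hasP[y ya yk] : has (fun y => (c y == k) && xo y t) (dom K x a).
    by rewrite (bigD1_seq y) ?dom_uniq //= yk.
  have half x1 a1 : e x1 a1 -> (k, t) \in tokens x1 -> (k, t) \notin tokens a1 ->
      exists y, [/\ y \in dom K x1 a1, c y = k, t%:R < N%:R * f x1 y & ~~ (t%:R < N%:R * f a1 y)].
    move=> xa1; rewrite !inE /= => /hasP[y yx /andP[/eqP yk yt]] /hasPn nh.
    exists y; split=> //; first by rewrite mem_dom // yx.
    have [ya|/f_ball ->] := boolP (y \in ball K a1); last by rewrite mulr0 -leNgt ler0n.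
    by have := nh y ya; rewrite yk eqxx.
  move: kD; rewrite inE [X in X || _]inE [X in _ || X]inE => /orP[] /andP[k1 k2].
    have [y [yd yk y1 y2]] := half _ _ xa k2 k1; apply/hasP; exists y => //.
    by rewrite yk eqxx /xo y1 (negbTE y2).
  have ax : e a x by rewrite medge_sym.
  have [y [yd yk y1 y2]] := half _ _ ax k2 k1; apply/hasP; exists y.
    by rewrite (perm_mem (perm_dom K xa)).
  by rewrite yk eqxx /xo y1 (negbTE y2).
apply: (@le_trans _ _ (\sum_(y <- dom K x a) \sum_(t < N) xo y t)%N%:R); first by rewrite ler_nat.
rewrite natr_sum big_distrr /=.
apply: (@le_trans _ _ (\sum_(y <- dom K x a) (N%:R * `|f x y - f a y| + 1))).
  apply: ler_sum => y _; apply: le_trans (threshold_diff N _ _) _.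
  by rewrite -mulrBr normrM ger0_norm.
rewrite big_split /= lerD2l big_const_seq count_predT iter_addr_0 ler_nat.
exact: size_dom.
Qed.

Let fin_good : finmeas (@meas _ _ G) good. Proof. exact: finmeas_of_meas. Qed.

Let fin_tokens : finmeas (@meas _ _ G) tokens.
Proof.
have fh : finmeas (@meas _ _ G) (fun x => [seq has (fun w : K.-tuple (moves G) =>
    (c (walk w x) == kt.1) && (kt.2%:R < N%:R * f x (walk w x))) (enum {: K.-tuple (moves G)})
    | kt : T <- enum {: T}]).
  apply: finmeas_seq => kt; apply: finmeas_has => w; apply: fin_and.
    by apply: (finmeas_walk w (h := fun x => c x == kt.1)); exact: finmeas_of_meas.
  exact: (finmeas_map (fun u => kt.2%:R < N%:R * u) (f_nice w)).
apply: (finmeas_determined (mvertex0 G) fh) => x x' /eq_in_map E.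
apply/setP => kt; rewrite !inE.
have F (z : G) : has (fun y => (c y == kt.1) && (kt.2%:R < N%:R * f z y)) (ball K z) =
    has (fun w : K.-tuple (moves G) => (c (walk w z) == kt.1) && (kt.2%:R < N%:R * f z (walk w z)))
      (enum {: K.-tuple (moves G)}).
  apply/hasP/hasP => [[y]|[w _ wP]].
    by rewrite mem_undup => /mapP[w _ ->] ?; exists w; rewrite ?mem_enum.
  by exists (walk w z) => //; rewrite mem_undup; apply: map_f; rewrite mem_enum.
by rewrite !F; apply: E; rewrite mem_enum.
Qed.

Let cut (s : {perm T}) (x a : G) : bool :=
  [&& good x, good a & first_elt s (tokens x) != first_elt s (tokens a)].

Let nice_cut s : nice2 (cut s).
Proof.
move=> v; apply: fin_and => //; apply: fin_and; first exact: (finmeas_walk v fin_good).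
exact: (finmeas_map2 (fun A B => first_elt s A != first_elt s B) fin_tokens (finmeas_walk v fin_tokens)).
Qed.

Let cuts (s : {perm T}) : R := expect (fun x : G => \sum_(a <- nb x) (cut s x a)%:R).

Let fin_cuts s : finmeas (@meas _ _ G) (fun x : G => \sum_(a <- nb x) (cut s x a)%:R : R).
Proof. by apply: finmeas_sum_nb => v; apply: finmeas_nat; exact: nice_cut. Qed.

(** The bound holds on average over all orders, so some order satisfies it. The last term collects
    the rounding errors of the tokens over at most [d] neighbours, divided by [N]. *)
Lemma cuts_average : exists s, cuts s <=
  edge_mean K (fun x a y => `|f x y - f a y|) + (d * d.+1 ^ K.+1)%:R / N%:R.
Proof.
set V := edge_mean K _; set q := (d * d.+1 ^ K.+1)%:R / N%:R.
pose P := #|{perm T}|.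
have P0 : (0 < P)%N by apply/card_gt0P; exists 1%g.
have nabs : nice3 (fun x a y => `|f x y - f a y|).
  by move=> u v; exact: (finmeas_map2 (fun s t => `|s - t|) (nice3_xy f_nice u v) (nice3_ay f_nice u v)).
have fv := finmeas_edge_mean K nabs.
have N0' : 0 < N%:R :> R by rewrite ltr0n.
have sum_le : \sum_s cuts s <= P%:R * (V + q).
  rewrite /cuts -expect_sum //.
  have -> : P%:R * (V + q) = expect (fun x : G => P%:R * ((\sum_(a <- nb x) \sum_(y <- dom K x a) `|f x y - f a y|) + q)).
    rewrite expectZ; last by apply: (finmeas_map2 +%R) fv _; exact: finmeas_cst.
    by rewrite expectD ?expect_cst //; exact: finmeas_cst.
  apply: expect_le => [||x]; first exact: finmeas_sum.
    apply: (finmeas_map ( *%R P%:R)); apply: (finmeas_map2 +%R) fv _; exact: finmeas_cst.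
  rewrite exchange_big /=.
  have step a : e x a -> \sum_s (cut s x a)%:R <=
      P%:R * ((\sum_(y <- dom K x a) `|f x y - f a y|) + (d.+1 ^ K.+1)%:R / N%:R) :> R.
    move=> xa; case: (boolP (good x)) => gx; last first.
      rewrite big1 => [|s _]; last by rewrite /cut (negbTE gx).
      by rewrite mulr_ge0 // addr_ge0 ?sumr_ge0 // divr_ge0.
    have H := card_first_elt_neq (tokens a) N0 (card_tokens gx).
    have -> : (\sum_(y <- dom K x a) `|f x y - f a y|) + (d.+1 ^ K.+1)%:R / N%:R =
       (N%:R * (\sum_(y <- dom K x a) `|f x y - f a y|) + (d.+1 ^ K.+1)%:R) / N%:R.
      by rewrite mulrDl [N%:R * _]mulrC mulfK // gt_eqF.
    rewrite mulrA ler_pdivlMr //.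
    apply: (@le_trans _ _ (#|[set s | first_elt s (tokens x) != first_elt s (tokens a)]%SET| * N)%N%:R).
      rewrite natrM ler_wpM2r // card_set_sum natr_sum; apply: ler_sum => s _.
      rewrite inE /cut gx /=; case: (good a) => //=; exact: ler0n.
    apply: (@le_trans _ _ (#|(tokens x :\: tokens a) :|: (tokens a :\: tokens x)| * P)%N%:R).
      by rewrite ler_nat.
    by rewrite natrM mulrC ler_wpM2l // card_tokens_diff.
  apply: (@le_trans _ _ (\sum_(a <- nb x) (P%:R * ((\sum_(y <- dom K x a) `|f x y - f a y|) + (d.+1 ^ K.+1)%:R / N%:R)))).
    by rewrite big_seq [leRHS]big_seq; apply: ler_sum => a; rewrite mem_nb; exact: step.
  rewrite -big_distrr ler_wpM2l // big_split lerD2l /= big_const_seq count_predT iter_addr_0.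
  rewrite /q natrM -mulrA -[leLHS]mulr_natl ler_wpM2r ?divr_ge0 //.
  by rewrite ler_nat size_nb.
apply: contrapT => /forallNP H.
suff : P%:R * (V + q) < \sum_s cuts s by rewrite ltNge sum_le.
have -> : P%:R * (V + q) = \sum_(s : {perm T}) (V + q).
  by rewrite sumr_const mulr_natl.
apply: ltr_sum => [|s _]; first by apply/hasP; exists 1%g; rewrite // mem_index_enum.
by rewrite ltNge; apply/negP.
Qed.

(** [Z] consists of the bad vertices and those with a cut edge. Along a path avoiding [Z] the chosen
    token is constant, and the separation of colours makes its centre constant too, so a component
    lies in the [K]-ball of that centre. *)
Lemma rounding : exists Z : pred G, [/\ meas Z,
  expect (fun x : G => (Z x)%:R) <= expect (fun x : G => (~~ good x)%:R) +
    (edge_mean K (fun x a y => `|f x y - f a y|) + (d * d.+1 ^ K.+1)%:R / N%:R) &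
  hyperfin e Z (d.+1 ^ K)].
Proof.
have [s Hs] := cuts_average.
pose Z x := ~~ good x || has (cut s x) (nb x).
have fZ : finmeas (@meas _ _ G) Z.
  apply: (finmeas_map2 orb); first exact: (finmeas_map negb fin_good).
  have -> : (fun x => has (cut s x) (nb x)) = fun x =>
      has (fun i => (move i x != x) && cut s x (move i x)) (enum (moves G)).
    apply/funext => x; apply/hasP/hasP => [[a]|[i _ /andP[ix ic]]].
      move=> /mapP[i]; rewrite mem_filter => /andP[ix _] -> ic.
      by exists i; rewrite ?mem_enum // ix.
    by exists (move i x) => //; apply: map_f; rewrite mem_filter ix mem_enum.
  apply: finmeas_has => i; apply: fin_and; first exact: finmeas_move_ne.
  exact: (nice_cut s [:: i]).
have Zc x z : e x z -> ~~ Z x -> ~~ Z z -> first_elt s (tokens x) = first_elt s (tokens z).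
  move=> xz; rewrite /Z !negb_or !negbK => /andP[gx /hasPn hx] /andP[gz _].
  by have := hx z; rewrite mem_nb xz /cut gx gz /= negbK => /(_ isT)/eqP.
have tok x kt : first_elt s (tokens x) = Some kt -> exists2 y, y \in ball K x & c y = kt.1.
  case/first_eltP; rewrite inE => /hasP[y yx /andP[/eqP yk _]] _.
  by exists y.
exists Z; split.
- exact: meas_of_fin.
- apply: le_trans (lerD (lexx _) Hs).
  have fg : finmeas (@meas _ _ G) (fun x => (~~ good x)%:R : R).
    by apply: finmeas_nat; exact: (finmeas_map negb fin_good).
  rewrite -(expectD fg (fin_cuts s)); apply: expect_le => [||x].
  + exact: finmeas_nat.
  + exact: (finmeas_map2 +%R fg (fin_cuts s)).
  + rewrite /Z; case: (good x) => /=; last by rewrite lerDl sumr_ge0.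
    rewrite add0r; case: hasP => [[a ax ca]|_]; last by rewrite sumr_ge0.
    by rewrite (bigD1_seq a) ?nb_uniq //= ca lerDl sumr_ge0.
- move=> x q uq Hq.
  have [Zx|nZx] := boolP (Z x).
    apply: (@leq_trans 1); last by rewrite expn_gt0.
    rewrite -[1%N]/(size [:: x]); apply: uniq_leq_size => // y /Hq [[|z p] /= px ->].
      by rewrite mem_head.
    by move: px; rewrite {1}/isolate Zx andbF.
  have gx : good x by move: nZx; rewrite negb_or negbK => /andP[].
  have [kt ktE] := first_elt_ex s (leq_trans N0 (card_tokens gx)).
  have [y0 y0x y0k] := tok _ _ ktE.
  have stay p x1 : ~~ Z x1 -> first_elt s (tokens x1) = Some kt -> y0 \in ball K x1 ->
      path (isolate e Z) x1 p -> y0 \in ball K (last x1 p).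
    elim: p x1 => [//|z p IH] x1 Z1 E1 y1 /= /andP[/and3P[xz _ Zz] pz].
    have Ez : first_elt s (tokens z) = Some kt by rewrite -(Zc _ _ xz).
    apply: (IH z) => //; have [y' y'z y'k] := tok _ _ Ez.
    suff -> : y0 = y' by [].
    (* [y0] and [y'] are within [K] of the two ends of an edge, hence within [2K + 1] of each
       other. *)
    apply: c_inj; last by rewrite y0k.
    move/mem_ball: y1 => y1; move/mem_ball: y'z => y'z.
    have := gball_trans (gball_sym (@medge_sym _ _ G) y1) (gball_trans (gball1 xz) y'z).
    by apply: gball_mono; rewrite mul2n -addnn add1n addnS.
  apply: leq_trans (size_ball K y0); apply: uniq_leq_size => // y /Hq[p px ->].
  have := stay p x nZx ktE y0x px.
  by move=> /mem_ball H; apply/mem_ball; exact: gball_sym (@medge_sym _ _ G) _ _ _ H.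
Qed.

End Rounding.

(** * Transfer between measured graphs *)

Definition type_freq (R : realType) (d : nat) (A : mgraph R d) r (t : {set code d r}) : R :=
  expect (fun x : A => (ball_type r x x x == t)%:R).

Lemma small_increment (R : realType) (a : nat -> R) (q : R) n : (0 < n)%N ->
  (forall k, 0 <= a k <= q) -> exists2 k, (k < n)%N & a k.+1 - a k <= q / n%:R.
Proof.
move=> n0 aq; apply: contrapT => /forall2NP H.
have n0' : 0 < n%:R :> R by rewrite ltr0n.
have : \sum_(0 <= k < n) q / n%:R < \sum_(0 <= k < n) (a k.+1 - a k).
  rewrite !big_mkord; apply: ltr_sum => [|k _].
    by apply/hasP; exists (Ordinal n0); rewrite // mem_index_enum.
  by rewrite ltNge; apply/negP; case: (H k) => // /(_ (ltn_ord k)).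
rewrite telescope_sumr // sumr_const_nat subn0 -[X in X < _]mulr_natr divfK ?gt_eqF //.
by have /andP[_ an] := aq n; have /andP[a0 _] := aq 0%N; lra.
Qed.

Section Transfer.
Variables (R : realType) (d : nat).
Implicit Types A B : mgraph R d.

Lemma finmeas_type A r (t : {set code d r}) :
  finmeas (@meas _ _ A) (fun x : A => (ball_type r x x x == t)%:R : R).
Proof. by apply: finmeas_nat; exact: (nice_ball_type t [::] [::]). Qed.

Lemma sum_type_indicator A r (U : {set code d r} -> R) :
  (fun x : A => U (ball_type r x x x)) =
  fun x => \sum_t U t * (ball_type r x x x == t)%:R.
Proof.
apply/funext => x; rewrite (bigD1 (ball_type r x x x)) //= eqxx mulr1 big1 ?addr0 //.
by move=> t /negPf; rewrite eq_sym => ->; rewrite mulr0.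
Qed.

Lemma expect_type A r (U : {set code d r} -> R) :
  expect (fun x : A => U (ball_type r x x x)) = \sum_t U t * type_freq A t.
Proof.
rewrite sum_type_indicator.
rewrite expect_sum => [|t]; last exact: (finmeas_map ( *%R (U t)) (finmeas_type A t)).
by apply: eq_bigr => t _; rewrite expectZ //; exact: finmeas_type.
Qed.

Lemma finmeas_of_type A r (U : {set code d r} -> R) :
  finmeas (@meas _ _ A) (fun x : A => U (ball_type r x x x)).
Proof.
rewrite sum_type_indicator.
by apply: finmeas_sum => t; exact: (finmeas_map ( *%R (U t)) (finmeas_type A t)).
Qed.

Local Notation Q K := ((d * d.+1 ^ K.+1)%:R : R).

Definition variation K r (F : {set code d r} -> R) A :=
  edge_mean K (fun x a y : A => `|rule K F x y - rule K F a y|).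

Lemma exists_rule K (g : R) : 0 < g -> exists rmax, forall A (Z : pred A),
  meas Z -> hyperfin (@medge _ _ A) Z K ->
  exists r (F : {set code d r} -> R), [/\ (K < r <= rmax)%N, forall t, 0 <= F t <= 1,
    variation K F A <= 4 * d%:R * expect (fun x : A => (Z x)%:R) + g &
    forall x : A, type_freq A (ball_type r x x x) != 0 ->
      \sum_(y <- ball K x) rule K F x y = 1].
Proof.
(* [c] and [n] make the two error terms of [rule_variation] at most [g / 2] each; adding 1 to the
   volume bound keeps the denominator positive. *)
move=> g0; pose c := g / (2 * (Q K + 1)).
have Q1 : 0 < Q K + 1 by rewrite ltr_wpDl.
have c0 : 0 < c by rewrite divr_gt0 // mulr_gt0.
have cQ : c * Q K <= g / 2.
  rewrite /c invfM mulrA -mulrA ler_piMr ?divr_ge0 ?(ltW g0) //.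
  by rewrite mulrC ler_pdivrMr // mul1r lerDl.
pose n := (Num.bound (2 * Q K / (c * g))).+1.
have nP : Q K / n%:R / c <= g / 2.
  have : 2 * Q K / (c * g) < n%:R.
    apply: lt_le_trans (archi_boundP _) _; first by rewrite divr_ge0 ?mulr_ge0 // ltW.
    by rewrite ler_nat.
  rewrite ltr_pdivrMr ?mulr_gt0 // => H.
  by rewrite ler_pdivrMr // ler_pdivrMr ?ltr0n //; lra.
(* Radii advance by 2 because [rule_variation] involves the energies at [r] and [r.+2], and start at
   [K + 1] because it requires [K < r]. *)
exists (K + 1 + 2 * n)%N => A Z mZ hZ.
pose phi := piece_mean Z K.
have pn : nice2 phi := nice_piece_mean K mZ.
have p01 : forall x y, 0 <= phi x y <= 1 by exact: piece_mean01.
have pb : forall x y, y \notin ball K x -> phi x y = 0 by exact: piece_mean_ball.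
have ps : forall x, \sum_(y <- ball K x) phi x y = 1 by exact: piece_mean_sum.
pose en k := energy K phi (K + 1 + 2 * k)%N.
have [k kn Hk] : exists2 k, (k < n)%N & en k.+1 - en k <= Q K / n%:R.
  by apply: small_increment => // k; exact: energy_bound.
pose r := (K + 1 + 2 * k)%N.
have Kr : (K < r)%N by rewrite /r addn1 addSn ltnS leq_addr.
exists r, (avg_coef K phi (r := r)); split.
- by rewrite Kr /r leq_add2l leq_mul2l /= ltnW.
- by move=> t; exact: avg_coef01.
- apply: le_trans (rule_variation pn p01 pb Kr c0) _.
  have D := piece_mean_variation mZ hZ.
  have E : (energy K phi r.+2 - energy K phi r) / c <= g / 2.
    apply: le_trans nP; rewrite ler_wpM2r ?invr_ge0 ?(ltW c0) //.
    by have -> : r.+2 = (K + 1 + 2 * k.+1)%N by rewrite /r; lia.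
  have ar (a b x y z : R) : a <= b -> x <= g / 2 -> y <= g / 2 -> a + x + y <= b + g by lra.
  exact: ar D E cQ.
- by move=> x; apply: rule_sum.
Qed.

(** The variation at a vertex is bounded by [Q K] and determined by its [(r+1)]-ball, which contains
    the [r]-balls of the neighbours. Its mean is thus a finite combination of frequencies. *)
Lemma variation_transfer K r (F : {set code d r} -> R) A B (del : R) : (K < r)%N ->
  (forall t, 0 <= F t <= 1) ->
  (forall t : {set code d r.+1}, `|type_freq A t - type_freq B t| <= del) ->
  variation K F B <= variation K F A + #|{set code d r.+1}|%:R * (Q K * del).
Proof.
move=> Kr F01 Hdel.
pose v (C : mgraph R d) (x : C) := \sum_(a <- nb x) \sum_(y <- dom K x a) `|rule K F x y - rule K F a y|.
have v0 (C : mgraph R d) (x : C) : 0 <= v C x by rewrite !sumr_ge0 // => a _; rewrite sumr_ge0.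
have vQ (C : mgraph R d) (x : C) : v C x <= Q K.
  apply: (@le_trans _ _ (\sum_(a <- nb x) (d.+1 ^ K.+1)%:R)).
    apply: ler_sum => a _; apply: (@le_trans _ _ (\sum_(y <- dom K x a) 1)).
      apply: ler_sum => y _; have /andP[a0 a1] := rule01 K x y F01; have /andP[b0 b1] := rule01 K a y F01.
      by rewrite ler_norml; apply/andP; split; lra.
    by rewrite big_const_seq count_predT iter_addr_0 ler_nat size_dom.
  by rewrite big_const_seq count_predT iter_addr_0 -mulrnA ler_nat mulnC leq_mul2r size_nb orbT.
have vtype (C C' : mgraph R d) (x : C) (x' : C') :
    ball_type r.+1 x x x = ball_type r.+1 x' x' x' -> v C x = v C' x'.
  move=> T; have [g [gb _ _]] := biso_of_ball_type (ball_center _ _) (ball_center _ _) T.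
  rewrite /v [RHS](perm_big _ (perm_nb_biso (ltn0Sn r) gb)) [RHS]big_map /=.
  rewrite [LHS]big_seq [RHS]big_seq; apply: eq_bigr => a; rewrite mem_nb => xa.
  have [_ pd] := biso_edge_dom (leqW Kr) gb xa.
  rewrite [RHS](perm_big _ pd) [RHS]big_map /= [LHS]big_seq [RHS]big_seq.
  apply: eq_bigr => y yd; have [gx _ _ _] := gb.
  have yr : y \in ball r.+1 x.
    by move: yd; rewrite mem_filter => /andP[_]; apply: ball_sub; exact: leqW.
  have -> : rule K F x' (g y) = rule K F x y.
    rewrite -gx; apply: (rule_biso F gb (ltnW Kr) (k := 0)) => //; last exact: ball_center.
    by rewrite addn0.
  have -> // : rule K F (g a) (g y) = rule K F a y.
  by apply: (rule_biso F gb (ltnW Kr) (k := 1)) => //; [rewrite addn1 | exact: nb_ball].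
(* [U] is exact on [B]. A type that does not occur in [B] gets 0, a lower bound for the variation on
   [A], which is all that is required there. *)
have /choice[U HU] : forall t : {set code d r.+1}, exists u : R, (0 <= u <= Q K) /\
    ((forall x : B, ball_type r.+1 x x x = t -> v B x = u) /\
     (forall x : A, ball_type r.+1 x x x = t -> u <= v A x)).
  move=> t; have [[x xt]|n] := pselect (exists x : B, ball_type r.+1 x x x = t).
    exists (v B x); rewrite v0 vQ; split=> //; split=> y yt.
      by apply: vtype; rewrite xt.
    by rewrite le_eqVlt (vtype _ _ x y) ?eqxx // xt.
  exists 0; rewrite lexx ler0n; split=> //; split=> // x xt.
  by exfalso; apply: n; exists x.
have EB : variation K F B = \sum_t U t * type_freq B t.
  rewrite -expect_type; congr expect; apply/funext => x.
  by case: (HU (ball_type r.+1 x x x)) => _ [H _]; exact: H.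
have EA : \sum_t U t * type_freq A t <= variation K F A.
  rewrite -expect_type; apply: expect_le => [||x].
  - exact: finmeas_of_type.
  - apply: finmeas_edge_mean => u w.
    exact: (finmeas_map2 (fun s t => `|s - t|) (nice3_xy (@nice_rule R d K r F A) u w) (nice3_ay (@nice_rule R d K r F A) u w)).
  - by case: (HU (ball_type r.+1 x x x)) => _ [_ H]; exact: H.
rewrite EB -lerBlDl; apply: le_trans (lerB (lexx _) EA) _.
rewrite -sumrB; have -> : #|{set code d r.+1}|%:R * (Q K * del) = \sum_(t : {set code d r.+1}) Q K * del.
  by rewrite sumr_const mulr_natl.
apply: ler_sum => t _; rewrite -mulrBr.
have [/andP[U0 UQ] _] := HU t.
apply: (@le_trans _ _ (U t * del)); last by rewrite ler_wpM2r // (le_trans _ (Hdel t)).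
by rewrite ler_wpM2l // (le_trans (ler_norm _)) // distrC.
Qed.

(** At these vertices of [B] the rule need not sum to 1, as [rule_sum] says nothing about types of
    frequency zero in [A]. *)
Lemma bad_transfer r A B (del : R) :
  (forall t : {set code d r}, `|type_freq A t - type_freq B t| <= del) ->
  expect (fun x : B => (type_freq A (ball_type r x x x) == 0)%:R) <= #|{set code d r}|%:R * del.
Proof.
move=> Hdel; rewrite (expect_type B (fun t => (type_freq A t == 0)%:R)).
have -> : #|{set code d r}|%:R * del = \sum_(t : {set code d r}) del.
  by rewrite sumr_const mulr_natl.
apply: ler_sum => t _; have H := Hdel t; case: eqP => [E|_]; last first.
  by rewrite mul0r (le_trans _ H).
rewrite mul1r; move: H; rewrite E sub0r normrN; apply: le_trans; exact: ler_norm.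
Qed.

Theorem hyperfinite_transfer K (eps : R) : 0 < eps ->
  exists rmax (del : R), 0 < del /\ forall A B,
    (exists Z : pred A, [/\ meas Z, expect (fun x : A => (Z x)%:R) < eps &
       hyperfin (@medge _ _ A) Z K]) ->
    (forall r, (0 < r <= rmax)%N -> forall t : {set code d r},
       `|type_freq A t - type_freq B t| <= del) ->
    exists Z : pred B, [/\ meas Z, expect (fun x : B => (Z x)%:R) < (4 * d%:R + 5) * eps &
       hyperfin (@medge _ _ B) Z (d.+1 ^ K)].
Proof.
move=> e0; have [rmax Hr] := exists_rule K e0.
(* The radius is known only after [A], so [del] is fixed against the number of types of every radius
   up to [rmax + 1]. *)
pose S : R := (\sum_(r < rmax.+2) #|{set code d r}|)%N%:R + 1.
have S0 : 0 < S by rewrite ltr_wpDl.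
have Q1 : 0 < Q K + 1 by rewrite ltr_wpDl.
pose del := eps / (S * (Q K + 1)).
have del0 : 0 < del by rewrite divr_gt0 // mulr_gt0.
have Sdel : S * ((Q K + 1) * del) = eps.
  by rewrite /del mulrA mulrC divfK // gt_eqF // mulr_gt0.
have card_le r : (r <= rmax.+1)%N -> #|{set code d r}|%:R <= S :> R.
  move=> rm; apply: (@le_trans _ _ (\sum_(r < rmax.+2) #|{set code d r}|)%N%:R); last by rewrite lerDl.
  by rewrite ler_nat (bigD1 (Ordinal (rm : (r < rmax.+2)%N))) //= leq_addr.
exists rmax.+1, del; split=> // A B [Z [mZ Zeps hZ]] Hdel.
have [r [F [/andP[Kr rm] F01 varA Fsum]]] := Hr A Z mZ hZ.
have r0 : (0 < r)%N by exact: leq_ltn_trans Kr.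
have varB : variation K F B <= variation K F A + eps.
  apply: le_trans (variation_transfer Kr F01 (Hdel r.+1 _)) _; first by rewrite ltnS.
  rewrite lerD2l -Sdel; apply: ler_pM => //; first by rewrite mulr_ge0 // ltW.
    by rewrite card_le // ltnS.
  by rewrite ler_wpM2r ?(ltW del0) // lerDl.
have badB : expect (fun x : B => (type_freq A (ball_type r x x x) == 0)%:R) <= eps.
  apply: le_trans (bad_transfer (Hdel r _)) _; first by rewrite r0 leqW.
  rewrite -Sdel; apply: ler_pM => //; first exact: ltW.
    by rewrite card_le // leqW.
  by rewrite ler_peMl ?(ltW del0) // lerDr.
pose good (x : B) := type_freq A (ball_type r x x x) != 0.
have fgood : finmeas (@meas _ _ B) good.
  have H := finmeas_of_type B (fun t : {set code d r} => (type_freq A t == 0)%:R).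
  have := finmeas_map (fun u : R => u == 0) H.
  congr finmeas; apply/funext => x; rewrite /good; case: (type_freq A _ == 0).
    by rewrite oner_eq0.
  by rewrite eqxx.
have gsum x : good x -> \sum_(y <- ball K x) rule K F x y = 1.
  move=> gx; have [x' xt] : exists x' : A, ball_type r x' x' x' = ball_type r x x x.
    apply: contrapT => /forallNP n; move: gx; rewrite /good /type_freq.
    rewrite (_ : (fun x0 : A => _) = fun=> 0) ?expect0 ?eqxx //.
    by apply/funext => y; case: eqP => // /n.
  transitivity (\sum_(y <- ball K x') rule K F x' y); last by apply: Fsum; rewrite xt.
  have [g [gb _ _]] := biso_of_ball_type (ball_center _ _) (ball_center _ _) xt.
  have [gx' _ _ _] := gb; have Kb : biso K x' x g.
    by rewrite -gx'; apply: (biso_restrict gb (k := 0)); rewrite ?addn0 ?ball_center // ltnW.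
  rewrite [LHS](perm_big _ (perm_ball_biso Kb)) [LHS]big_map /=.
  rewrite [LHS]big_seq [RHS]big_seq; apply: eq_bigr => y yx; rewrite -gx'.
  apply: (rule_biso _ gb (ltnW Kr) (k := 0)); rewrite ?addn0 ?ball_center //.
  exact: ball_sub (ltnW Kr) yx.
have [m [c [cm ci]]] := meas_colouring B (2 * K).+1.
pose N := (Num.bound (Q K / eps)).+1.
have NQ : Q K / N%:R <= eps.
  have : Q K / eps < N%:R.
    apply: lt_le_trans (archi_boundP _) _; first by rewrite divr_ge0 // ltW.
    by rewrite ler_nat.
  by rewrite ltr_pdivrMr // ler_pdivrMr ?ltr0n // => H; rewrite mulrC ltW.
have fn : nice2 (@rule R d K r F B) by exact: nice_rule.
have f01 (x y : B) : 0 <= rule K F x y <= 1 by exact: rule01.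
have fb (x y : B) : y \notin ball K x -> rule K F x y = 0 by exact: rule_out.
have gm : meas good by exact: meas_of_fin.
have [Z' [mZ' Zle hZ']] := rounding fn f01 fb gm gsum cm ci (ltn0Sn _ : (0 < N)%N).
exists Z'; split=> //; apply: le_lt_trans Zle _.
have -> : expect (fun x : B => (~~ good x)%:R) = expect (fun x : B => (type_freq A (ball_type r x x x) == 0)%:R).
  by congr expect; apply/funext => x; rewrite /good negbK.
have d4 : 4 * d%:R * expect (fun x : A => (Z x)%:R) <= 4 * d%:R * eps.
  by rewrite ler_wpM2l ?mulr_ge0 // ltW.
(* Besides [4 d eps] from the cut of [A], one [eps] each pays for bad vertices, rounding, frequency
   errors and energy increments; the fifth makes the inequality strict. *)
have ar (b v q va ez D : R) : b <= eps -> q <= eps -> v <= va + eps -> va <= ez + eps -> ez <= D * eps ->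
  b + (v + q) < (D + 5) * eps by lra.
exact: ar badB NQ varB varA d4.
Qed.

End Transfer.

(** * Graphings and finite graphs as measured graphs *)

Section Colouring.
Variables (disp : measure_display) (X : measurableType disp).
Variables (U : nat -> set X) (D : X -> X -> Prop) (n : nat).
Hypothesis U_meas : forall i, measurable (U i).
Hypothesis U_sep : forall x (s : seq X), x \notin s ->
  exists i, U i x /\ forall y, y \in s -> ~ U i y.
Hypothesis D_sym : forall x y, D x y -> D y x.
Hypothesis D_irr : forall x, ~ D x x.
Hypothesis D_deg : forall x, exists2 s : seq X, (size s <= n)%N & forall y, D x y -> y \in s.
Hypothesis D_meas : forall B, measurable B -> measurable [set x | exists2 y, D x y & B y].

Let isolated_in i x := U i x /\ forall y, D x y -> ~ U i y.

Let iso_ex x : exists i, `[< isolated_in i x >].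
Proof.
have [s _ Ds] := D_deg x; have [|i [Uix Ui]] := @U_sep x [seq y <- s | y != x].
  by rewrite mem_filter eqxx.
exists i; apply/asboolP; split=> // y xy; apply: Ui; rewrite mem_filter Ds // andbT.
by apply/eqP => yx; apply: (@D_irr x); rewrite -{2}yx.
Qed.

(** A Borel proper colouring with countably many colours: related points never have the same
    rank. *)
Let rank x := ex_minn (iso_ex x).

Let rank_iso x : isolated_in (rank x) x.
Proof. by rewrite /rank; case: ex_minnP => i /asboolP. Qed.

Let rank_neq x y : D x y -> rank x <> rank y.
Proof.
move=> xy E; have [Ux _] := rank_iso x; have [_ /(_ x (D_sym xy))] := rank_iso y.
by rewrite -E.
Qed.

Let iso_meas i : measurable [set x | isolated_in i x].
Proof.
have -> : [set x | isolated_in i x] = U i `\` [set x | exists2 y, D x y & U i y].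
  apply/seteqP; split=> x /=; first by case=> Ux H; split=> // -[y /H].
  by case=> Ux H; split=> // y xy Uy; apply: H; exists y.
by apply: measurableD => //; exact: D_meas.
Qed.

Let rank_meas i : measurable [set x | rank x = i].
Proof.
have -> : [set x | rank x = i] = [set x | isolated_in i x] `\` \bigcup_(j in [set j | (j < i)%N]) [set x | isolated_in j x].
  apply/seteqP; split=> x /=.
    move=> <-; split; first exact: rank_iso.
    case=> j /= jr ij; move: jr; rewrite /rank; case: ex_minnP => k _ kmin.
    by rewrite ltnNge kmin //; apply/asboolP.
  case=> ix nj; rewrite /rank; case: ex_minnP => k /asboolP ik kmin.
  apply/eqP; rewrite eqn_leq kmin /=; last exact/asboolP.
  by rewrite leqNgt; apply/negP => ki; apply: nj; exists k.
apply: measurableD => //; apply: bigcup_measurable => j _; exact: iso_meas.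
Qed.

Let used (c : X -> nat) k x j := exists2 y, D x y & (rank y < k)%N /\ c y = j.

Let free_ex (c : X -> nat) k x : exists j, `[< (j <= n)%N /\ ~ used c k x j >].
Proof.
apply: contrapT => /forallNP H; have [s sn Ds] := D_deg x.
have sub : {subset iota 0 n.+1 <= [seq c y | y <- s]}.
  move=> j; rewrite mem_iota add0n ltnS => /= jn.
  have [[y xy [_ <-]]|nu] := pselect (used c k x j); last by case: (H j); apply/asboolP.
  by apply: map_f; exact: Ds.
have := uniq_leq_size (iota_uniq 0 n.+1) sub; rewrite size_iota size_map => h.
by have := leq_trans h sn; rewrite ltnn.
Qed.

(** Greedy recolouring by increasing rank. Points of one rank are unrelated and can be treated
    simultaneously, and at most [n] related points leave one of [n + 1] colours free. *)
Let Fixpoint col k x : nat :=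
  if k is k'.+1 then
    if rank x == k' then ex_minn (free_ex (col k') k' x) else col k' x
  else 0%N.

Let col_meas k j : measurable [set x | col k x = j].
Proof.
elim: k j => [|k IH] j.
  have [->|j0] := eqVneq j 0%N.
    by rewrite (_ : [set x | _] = setT) //; apply/seteqP.
  by rewrite (_ : [set x | _] = set0) //; apply/seteqP; split=> // x /= /eqP; rewrite eq_sym (negbTE j0).
have mr : measurable [set x | (rank x < k)%N].
  rewrite (_ : [set x | _] = \bigcup_(l in [set l | (l < k)%N]) [set x | rank x = l]).
    by apply: bigcup_measurable => l _; exact: rank_meas.
  apply/seteqP; split=> [x /= xk|x]; first by exists (rank x).
  by case=> l /= lk rl; rewrite rl.
have mused i : measurable [set x | used (col k) k x i].
  exact: (D_meas (measurableI _ _ mr (IH i))).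
have -> : [set x | col k.+1 x = j] =
   ([set x | rank x = k] `&` ((if (j <= n)%N then ~` [set x | used (col k) k x j] else set0) `&`
      \bigcap_(i in [set i | (i < j)%N]) (if (i <= n)%N then [set x | used (col k) k x i] else setT)))
   `|` (~` [set x | rank x = k] `&` [set x | col k x = j]).
  apply/seteqP; split=> x /=.
    case: eqP => [rk|rk]; last by right.
    case: ex_minnP => i /asboolP[iN nu] imin <-; left; split=> //; rewrite iN; split=> // l /= li.
    case: ifP => // lN; apply: contrapT => nul; have := imin l.
    by rewrite [(i <= l)%N]leqNgt li => H; suff: false by []; apply: H; apply/asboolP.
  case=> [[rk [H1 H2]]|[rk <-]]; last by case: eqP.
  rewrite rk eqxx; case: ex_minnP => i /asboolP[iN nu] imin.
  move: H1; case: ifP => // jn nuj.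
  apply/eqP; rewrite eqn_leq imin; last by apply/asboolP.
  rewrite leqNgt; apply/negP => ij; have := H2 i ij; by rewrite iN.
apply: measurableU; last first.
  by apply: measurableI => //; apply: measurableC.
apply: measurableI => //; apply: measurableI.
  by case: ifP => // _; apply: measurableC.
by apply: bigcap_measurableType => i _; case: ifP.
Qed.

Let col_stable x k : (rank x < k)%N -> col k x = col (rank x).+1 x.
Proof.
elim: k => // k IH; rewrite ltnS leq_eqVlt => /orP[/eqP <-//|rk].
by rewrite -IH //=; case: eqP => // E; move: rk; rewrite E ltnn.
Qed.

Lemma measurable_colouring : exists c : X -> 'I_n.+1,
  (forall k, measurable [set x | c x = k]) /\ forall x y, D x y -> c x <> c y.
Proof.
pose c x := col (rank x).+1 x.
have cn x : (c x <= n)%N.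
  by rewrite /c /= eqxx; case: ex_minnP => i /asboolP[].
have cneq x y : D x y -> (rank y < rank x)%N -> c x <> c y.
  move=> xy ryx; rewrite /c {1}/col -/col eqxx; case: ex_minnP => i /asboolP[_ nu] _ E.
  by apply: nu; exists y => //; split=> //; rewrite col_stable.
exists (fun x => inord (c x)); split=> [k|x y xy E].
  have -> : [set x | inord (c x) = k] = \bigcup_l ([set x | rank x = l] `&` [set x | col l.+1 x = k]).
    apply/seteqP; split=> x /=.
      by move=> <-; exists (rank x) => //; split=> //=; rewrite inordK // ltnS.
    case=> l _ [/= <- ck]; apply: val_inj; rewrite /= inordK ?ltnS //.
  by apply: bigcupT_measurable => l; apply: measurableI => //; exact: col_meas.
have {}E : c x = c y by move/(congr1 val): E; rewrite /= !inordK ?ltnS.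
case: (ltngtP (rank x) (rank y)) => [xr|yr|]; last exact: rank_neq.
  by apply: (cneq y x) => //; exact: D_sym.
exact: (cneq x y).
Qed.

End Colouring.

Section GraphingMgraph.
Variables (R : realType) (d : nat) (disp : measure_display) (X : measurableType disp).
Variables (mu : probability X R) (E : set (X * X)).
Hypothesis gE : is_graphing d mu E.
Local Notation e := (edge_rel E).

Let mb (b : X -> bool) : Prop := measurable [set x | b x].
Let Ex (g : X -> R) : R := \int[mu]_x g x.

Lemma edge_relP x y : e x y <-> E (x, y).
Proof. by rewrite /edge_rel; split=> [/set_mem|/mem_set]. Qed.

Lemma edge_rel_sym : symmetric e.
Proof. by move=> x y; apply/idP/idP => /edge_relP H; apply/edge_relP; exact: (graphing_sym gE). Qed.

Lemma edge_rel_irr : irreflexive e.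
Proof. by move=> x; apply/negP => /edge_relP; exact: (graphing_irr gE). Qed.

Lemma edge_rel_deg (x : X) (s : seq X) : uniq s -> all (e x) s -> (size s <= d)%N.
Proof.
move=> us /allP xs; have /card_le_IP := graphing_deg gE x; apply=> // y /xs.
by move/edge_relP.
Qed.

Lemma measurable_nb B : measurable B -> measurable [set x | exists2 y, e x y & B y].
Proof.
move=> mB.
have := measurable_neighbours (graphing_standard gE) (graphing_borel gE) (graphing_deg gE) mB.
congr measurable; apply/seteqP; split=> x [y xy By]; exists y => //.
  exact/edge_relP.
exact/edge_relP.
Qed.

Lemma coded_coordinates : exists a : nat -> X -> nat,
  (forall i k, measurable [set x | a i x = k]) /\
  forall x y, (forall i, a i x = a i y) -> x = y.
Proof. by have [a [w [am asep _ _]]] := standard_borel_code (graphing_standard gE); exists a. Qed.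

Lemma countable_separating : exists U : nat -> set X, (forall i, measurable (U i)) /\
  forall x (s : seq X), x \notin s -> exists i, U i x /\ forall y, y \in s -> ~ U i y.
Proof.
have [a [am asep]] := coded_coordinates.
(* Finite intersections of level sets, so that a point is separated from a whole finite list at
   once. *)
pose V (s : seq nat) : set X := \bigcap_(k in [set k | (k < size s)%N]) [set x | a k x = nth 0%N s k].
exists (fun i => if unpickle i is Some s then V s else set0); split=> [i|x s xs].
  by case: unpickle => // s; apply: bigcap_measurableType => k _; exact: am.
have [N HN] : exists N, forall y, y \in s -> exists2 k, (k < N)%N & a k x <> a k y.
  elim: s xs => [|y s IH]; first by exists 0%N.
  rewrite inE negb_or => /andP[xy /IH[N HN]].
  have [k nk] : exists k, a k x <> a k y.
    by apply/existsNP => H; move/eqP: xy; apply; exact: asep.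
  exists (maxn k.+1 N) => z; rewrite inE => /orP[/eqP ->|/HN[l lN nl]].
    by exists k; rewrite // leq_max leqnn.
  by exists l; rewrite // leq_max lN orbT.
exists (pickle (mkseq (fun k => a k x) N)); rewrite pickleK; split=> [k /=|y /HN[k kN nk]].
  by rewrite size_mkseq => kN; rewrite nth_mkseq.
by move=> /(_ k) /=; rewrite size_mkseq nth_mkseq // => /(_ kN) H; apply: nk.
Qed.

Lemma measurable_gball L B : measurable B -> measurable [set x | exists2 y, gball e L x y & B y].
Proof.
elim: L B => [|L IH] B mB.
  rewrite (_ : [set x | _] = B) //; apply/seteqP; split=> x /=.
    by case=> y H; rewrite (gball0 H).
  by move=> Bx; exists x => //; exact: gball_refl.
rewrite (_ : [set x | _] = B `|` [set x | exists2 z, e x z & exists2 y, gball e L z y & B y]).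
  by apply: measurableU => //; apply: measurable_nb; exact: IH.
apply/seteqP; split=> x /=.
  case=> y H By; case: (gballS H) => [<-|[z xz zy]]; first by left.
  by right; exists z => //; exists y.
case=> [Bx|[z xz [y zy By]]]; first by exists x => //; exact: gball_refl.
by exists y => //; exact: (@gball_trans _ _ 1 _ _ _ _ (gball1 xz) zy).
Qed.

Lemma gball_finite L : exists n, forall x, exists2 s : seq X, (size s <= n)%N &
  forall y, gball e L x y -> y \in s.
Proof.
have nbs x : exists2 s : seq X, (size s <= d)%N & forall y, e x y -> y \in s.
  apply: contrapT => H.
  have long m : exists s : seq X, [/\ uniq s, all (e x) s & size s = m].
    elim: m => [|m [s [us xs sm]]]; first by exists [::].
    have [y xy ys] : exists2 y, e x y & y \notin s.
      apply: contrapT => n; apply: H; exists s; first exact: edge_rel_deg us xs.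
      by move=> y xy; apply: contrapT => /negP ys; apply: n; exists y.
    by exists (y :: s); rewrite /= ys us xy xs sm.
  have [s [us xs sm]] := long d.+1.
  by have := edge_rel_deg us xs; rewrite sm ltnn.
elim: L => [|L [n IH]].
  by exists 1%N => x; exists [:: x] => // y H; rewrite (gball0 H) mem_head.
exists (1 + d * n)%N => x; have [s sd xs] := nbs x.
have /choice[B HB] : forall z, exists t : seq X, (size t <= n)%N /\ forall y, gball e L z y -> y \in t.
  by move=> z; have [t ? ?] := IH z; exists t.
exists (x :: flatten [seq B z | z <- s]) => [|y H].
  rewrite /= add1n ltnS; apply: (@leq_trans (size s * n)); last by rewrite leq_mul2r sd orbT.
  elim: (s) => //= z t IHt; rewrite size_cat mulSn leq_add //; by case: (HB z).
case: (gballS H) => [->|[z xz zy]]; first exact: mem_head.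
rewrite inE; apply/orP; right; apply/flattenP; exists (B z).
  by apply: map_f; exact: xs.
by case: (HB z) => _; apply.
Qed.

Lemma graphing_colouring L : exists m : nat, exists c : X -> 'I_m,
  (forall k, mb (fun x => c x == k)) /\ forall x y, gball e L x y -> c x = c y -> x = y.
Proof.
have [U [Um Us]] := countable_separating; have [n Hn] := gball_finite L.
have [||||c [cm cD]] := @measurable_colouring _ X U (fun x y => x <> y /\ gball e L x y) n Um Us.
- by move=> x y [xy H]; split; [exact/nesym | exact: (gball_sym edge_rel_sym H)].
- by move=> x [].
- by move=> x; have [s sn Hs] := Hn x; exists s => // y [_ /Hs].
(* The condition [x <> y] is replaced by a set [U i] containing [y] but not [x], so that only
   projections along balls remain. *)
- move=> B mB; rewrite (_ : [set x | _] = \bigcup_i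
      ([set x | exists2 y, gball e L x y & (B `&` U i) y] `\` U i)).
    apply: bigcupT_measurable => i; apply: measurableD => //.
    by apply: measurable_gball; exact: measurableI.
  apply/seteqP; split=> x /=.
    case=> y [xy H] By; have [i [Uy Ux]] : exists i, U i y /\ forall z, z \in [:: x] -> ~ U i z.
      by apply: Us; rewrite inE; apply/eqP/nesym.
    by exists i => //; split; [exists y | apply: Ux; rewrite mem_head].
  case=> i _ [[y H [By Uy]] Ux]; exists y => //; split=> // xy.
  by apply: Ux; rewrite xy.
exists n.+1, c; split=> [k|x y H xy].
  rewrite /mb (_ : [set x | _] = [set x | c x = k]); first exact: cm.
  by apply/seteqP; split=> x /= /eqP.
by apply: contrapT => nxy; apply: (cD x y).
Qed.

Lemma graphing_measT : mb (fun=> true).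
Proof. by rewrite /mb (_ : [set x | _] = setT) //; apply/seteqP. Qed.

Lemma graphing_measN b : mb b -> mb (fun x => ~~ b x).
Proof.
rewrite /mb => h; rewrite (_ : [set x | _] = ~` [set x | b x]); first exact: measurableC.
by apply/seteqP; split=> x /= /negP.
Qed.

Lemma graphing_measI b c : mb b -> mb c -> mb (fun x => b x && c x).
Proof.
rewrite /mb => hb hc; rewrite (_ : [set x | _] = [set x | b x] `&` [set x | c x]); first exact: measurableI.
by apply/seteqP; split=> x /= => [/andP[]|[-> ->]].
Qed.

Lemma graphing_preimage (f : X -> X) : (forall b, mb b -> mb (fun x => b (f x))) ->
  forall A, measurable A -> measurable (f @^-1` A).
Proof.
move=> mf A mA; have := mf (fun x => x \in A).
have E1 : [set x | x \in A] = A by apply/seteqP; split=> x /=; rewrite inE.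
rewrite /mb E1 => /(_ mA); congr measurable; apply/seteqP; split=> x /=; by rewrite inE.
Qed.

Lemma graphing_meas_eq (f g : X -> X) : (forall b, mb b -> mb (fun x => b (f x))) ->
  (forall b, mb b -> mb (fun x => b (g x))) -> mb (fun x => f x == g x).
Proof.
move=> mf mg; have [a [am asep]] := coded_coordinates.
rewrite /mb (_ : [set x | _] = \bigcap_i \bigcup_k
   (f @^-1` [set x | a i x = k] `&` g @^-1` [set x | a i x = k])).
  apply: bigcapT_measurable => i; apply: bigcupT_measurable => k.
  by apply: measurableI; apply: graphing_preimage.
apply/seteqP; split=> x /=.
  by move=> /eqP fg i _; exists (a i (g x)); rewrite //= fg.
by move=> H; apply/eqP; apply: asep => i; have [k _ [/= -> ->]] := H i I.
Qed.

Lemma graphing_neighbour b : mb b -> mb (fun x => `[< exists2 y, e x y & b y >]).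
Proof.
rewrite /mb => h; rewrite (_ : [set x | _] = [set x | exists2 y, e x y & [set y | b y] y]).
  exact: measurable_nb.
by apply/seteqP; split=> x /= /asboolP.
Qed.

Lemma finmeas_measurable_fun (g : X -> R) : finmeas mb g -> measurable_fun setT g.
Proof.
move=> fg _ B mB; rewrite setTI.
have := meas_of_finmeas graphing_measT graphing_measN graphing_measI (finmeas_map (fun u => u \in B) fg).
by rewrite /mb; congr measurable; apply/seteqP; split=> x /=; rewrite inE.
Qed.

Lemma finmeas_integrable (g : X -> R) : finmeas mb g -> mu.-integrable setT (EFin \o g).
Proof.
move=> fg; have lt : (mu setT < +oo)%E by rewrite probability_setT ltry.
apply: (measurable_bounded_integrable measurableT lt (finmeas_measurable_fun fg)).
have [I [b [F [_ gE']]]] := fg.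
exists (\sum_f `|F f|); split=> [|M hM x _ /=]; first exact: num_real.
apply: le_trans (ltW hM); rewrite gE' (bigD1 [ffun i => b i x]) //= lerDl.
by rewrite sumr_ge0.
Qed.

Lemma graphing_mean_indicator b : mb b -> Ex (fun x => (b x)%:R) = fine (mu [set x | b x]).
Proof.
move=> h; rewrite /Ex /Rintegral; congr fine.
rewrite -[X in mu X]setIT -(integral_indic mu measurableT h).
apply: eq_integral => x _; rewrite indicE.
suff -> : (x \in [set x | b x]) = b x by [].
by apply/idP/idP; rewrite inE.
Qed.

Lemma graphing_mean_linear (a : R) g h : finmeas mb g -> finmeas mb h ->
  Ex (fun x => a * g x + h x) = a * Ex g + Ex h.
Proof.
move=> fg fh; rewrite /Ex RintegralD ?RintegralZl //; try exact: finmeas_integrable.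
by apply: finmeas_integrable; exact: (finmeas_map ( *%R a)).
Qed.

Lemma graphing_mean_ge0 g : finmeas mb g -> (forall x, 0 <= g x) -> 0 <= Ex g.
Proof. by move=> _ g0; apply: Rintegral_ge0. Qed.

Lemma graphing_mean1 : Ex (fun=> 1) = 1.
Proof. by rewrite /Ex Rintegral_cst // mul1r; exact: (congr1 fine (probability_setT mu)). Qed.

Lemma graphing_mean_invariant (f : X -> X) : involutive f -> (forall x, f x = x \/ e x (f x)) ->
  (forall b, mb b -> mb (fun x => b (f x))) ->
  forall b, mb b -> Ex (fun x => (b (f x))%:R) = Ex (fun x => (b x)%:R).
Proof.
move=> fK fe mf b mb'; rewrite !graphing_mean_indicator //; last exact: mf.
congr fine; apply: (graphing_inv gE (T := f)) => //.
- by move=> _ A mA; rewrite setTI; exact: graphing_preimage.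
- exact: inv_bij.
- by move=> x; case: (fe x) => [|/edge_relP]; [left | right].
Qed.

Definition graphing_mgraph : mgraph R d :=
  @MGraph R d X e mb Ex point edge_rel_sym edge_rel_irr edge_rel_deg graphing_measT graphing_measN graphing_measI graphing_meas_eq
    graphing_neighbour graphing_colouring graphing_mean_linear graphing_mean_ge0 graphing_mean1 graphing_mean_invariant.

End GraphingMgraph.

Section FiniteMgraph.
Variables (R : realType) (d : nat) (G : bdgraph d).

Let Ex (g : G -> R) : R := (\sum_x g x) / #|G|%:R.

Let card_neq0 : #|G|%:R != 0 :> R.
Proof. by rewrite pnatr_eq0 -lt0n; exact: vertex_gt0. Qed.

Lemma bdgraph_deg (x : G) (s : seq G) : uniq s -> all (@adj d G x) s -> (size s <= d)%N.
Proof.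
move=> /card_uniqP <- /allP xs; apply: leq_trans (adj_deg x).
by apply: subset_leq_card; apply/fintype.subsetP => y /xs.
Qed.

Lemma bdgraph_colouring L : exists m : nat, exists c : G -> 'I_m,
  (forall k : 'I_m, True) /\ forall x y, gball (@adj d G) L x y -> c x = c y -> x = y.
Proof. by exists #|G|, enum_rank; split=> // x y _; exact: enum_rank_inj. Qed.

Lemma bdgraph_mean_linear (a : R) g h : Ex (fun x => a * g x + h x) = a * Ex g + Ex h.
Proof. by rewrite /Ex big_split -big_distrr /= mulrDl mulrA. Qed.

Lemma bdgraph_mean_ge0 g : (forall x, 0 <= g x) -> 0 <= Ex g.
Proof. by move=> g0; rewrite divr_ge0 // sumr_ge0. Qed.

Lemma bdgraph_mean1 : Ex (fun=> 1) = 1.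
Proof. by rewrite /Ex sumr_const divff. Qed.

Lemma bdgraph_mean_invariant (f : G -> G) (b : G -> bool) : involutive f ->
  Ex (fun x => (b (f x))%:R) = Ex (fun x => (b x)%:R).
Proof. by move=> fK; rewrite /Ex [in RHS](reindex_inj (inv_inj fK)). Qed.

Definition bdgraph_mgraph : mgraph R d :=
  @MGraph R d G (@adj d G) (fun=> True) Ex (enum_val (Ordinal (vertex_gt0 G)))
    (@adj_sym d G) (@adj_irr d G) bdgraph_deg I (fun _ _ => I) (fun _ _ _ _ => I)
    (fun _ _ _ _ => I) (fun _ _ => I) bdgraph_colouring
    (fun a g h _ _ => bdgraph_mean_linear a g h) (fun g _ => @bdgraph_mean_ge0 g) bdgraph_mean1
    (fun f fK _ _ b _ => bdgraph_mean_invariant b fK).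

End FiniteMgraph.

(** * Balls as rooted graphs *)

Section BallGraph.
Variables (R : realType) (d r : nat) (A : mgraph R d) (x0 : A).
Local Notation V := (seq_sub (ball r x0)).
Local Notation e := (@medge R d A).

Let adjB (u v : V) : bool := e (val u) (val v).
Let rootB : V := SeqSub (ball_center r x0).

Lemma ball_adj_sym : symmetric adjB. Proof. by move=> u v; exact: medge_sym. Qed.
Lemma ball_adj_irr : irreflexive adjB. Proof. by move=> u; exact: medge_irr. Qed.

Lemma ball_adj_deg u : (#|adjB u| <= d)%N.
Proof.
rewrite cardE -(size_map val); apply: (@medge_deg _ _ A (val u)).
  by rewrite map_inj_uniq ?enum_uniq //; exact: val_inj.
by apply/allP => _ /mapP[v + ->]; rewrite mem_enum.
Qed.

Lemma ball_card_gt0 : (0 < #|{: V}|)%N.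
Proof. by apply/card_gt0P; exists rootB. Qed.

Definition ball_bdgraph : bdgraph d :=
  @BDGraph d V adjB ball_adj_sym ball_adj_irr ball_adj_deg ball_card_gt0.

Lemma lift_path (p : seq A) (z : V) : path e (val z) p -> (forall w, w \in p -> w \in ball r x0) ->
  exists q : seq V, [/\ path adjB z q, last (val z) p = val (last z q) & size q = size p].
Proof.
elim: p z => [|w p IH] z /=; first by exists [::].
move=> /andP[zw wp] pb; have wb : w \in ball r x0 by apply: pb; rewrite mem_head.
have [|q [wq lq sq]] := IH (SeqSub wb) wp; first by move=> v vp; apply: pb; rewrite inE vp orbT.
by exists (SeqSub wb :: q); rewrite /= wq sq andbT.
Qed.

Lemma ball_radius (v : ball_bdgraph) : gball (@adj d ball_bdgraph) r rootB v.
Proof.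
have /mem_ball[p [px vp sp]] := valP v.
have [|q [zq lq sq]] := @lift_path p rootB px.
  (* Each vertex of a path of length at most [r] from the centre is the end of a prefix, so the path
     stays in the ball. *)
  move=> w wp; apply/mem_ball; have wp' : w \in x0 :: p by rewrite inE wp orbT.
  case/splitPl: wp' px sp {vp wp} => p1 p2 <-.
  rewrite cat_path size_cat => /andP[p1x _] sp; exists p1; split=> //.
  by apply: leq_trans sp; exact: leq_addr.
by exists q; split=> //; [apply: val_inj; rewrite -lq | rewrite sq].
Qed.

Definition ball_rooted_graph : rooted_graph d r := @RootedGraph d r ball_bdgraph rootB ball_radius.

Lemma ball_iso_type (B : mgraph R d) (x : B) :
  ball_iso (@medge R d B) ball_rooted_graph x <-> ball_type r x x x = ball_type r x0 x0 x0.
Proof.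
split=> [[f [[f1 f2 f3] fr fe]]|T]; last first.
  have [g [gb _ _]] := biso_of_ball_type (ball_center _ _) (ball_center _ _) (esym T).
  have [gx gi gim ge] := gb.
  exists (fun v : ball_rooted_graph => g (val (v : V))); split=> //.
  - split=> [v _|u v _ _|y] /=.
    + by apply/mem_ball; apply/gim; exists (val v) => //; exact: valP.
    + by move=> E; apply: val_inj; apply: gi => //; exact: valP.
    + move=> /mem_ball/gim[z zb <-]; by exists (SeqSub zb).
  - move=> u v; exact: ge (valP (u : V)) (valP (v : V)).
pose g (y : A) : B := if insub y is Some u then f (u : V) else x.
have gE (y : A) (yb : y \in ball r x0) : g y = f (SeqSub yb : V).
  rewrite /g; case: insubP => [u _ uy|]; last by rewrite yb.
  by congr f; apply: val_inj.
have gb : biso r x0 x g.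
  split=> [|y z yb zb|y|y z yb zb].
  - by rewrite (gE _ (ball_center r x0)) -fr.
  - rewrite (gE _ yb) (gE _ zb) => /f2 fE.
    by have := fE (mem_set I) (mem_set I) => /(congr1 val).
  - split=> [/mem_ball/f3[v _ <-]|[z zb <-]].
      by exists (val (v : V)); [exact: valP | rewrite (gE _ (valP (v : V))); congr f; exact: val_inj].
    by apply/mem_ball; rewrite (gE _ zb); exact: f1.
  - by rewrite (gE _ yb) (gE _ zb) fe.
have [gx _ _ _] := gb.
by rewrite (ball_type_biso gb (leqnn _) (ball_center _ _) (ball_center _ _)) gx.
Qed.

End BallGraph.

Section Frequencies.
Variables (R : realType) (d : nat) (G : nat -> bdgraph d).
Variables (disp : measure_display) (X : measurableType disp).
Variables (mu : probability X R) (E : set (X * X)).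
Hypothesis gE : is_graphing d mu E.
Hypothesis lim : graphing_limit G mu E.

Local Notation Gr := (graphing_mgraph gE).
Local Notation Gn n := (bdgraph_mgraph R (G n)).

Lemma ball_freq_type (H : bdgraph d) r (t : {set code d r}) (al : rooted_graph d r) :
  (forall x : bdgraph_mgraph R H, ball_iso (@medge R d (bdgraph_mgraph R H)) al x <-> ball_type r x x x = t) ->
  ball_freq R H al = type_freq (bdgraph_mgraph R H) t.
Proof.
move=> alt; rewrite /ball_freq /type_freq /=; congr (_ / _).
rewrite card_set_sum natr_sum; apply: eq_bigr => x _; rewrite inE.
congr (_%:R); congr nat_of_bool; apply/idP/eqP; first by move/asboolP/alt.
by move=> xt; apply/asboolP/alt.
Qed.

Lemma graphing_freq_type r (t : {set code d r}) (al : rooted_graph d r) :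
  (forall x : Gr, ball_iso (@medge R d Gr) al x <-> ball_type r x x x = t) ->
  graphing_freq mu E al = (type_freq Gr t)%:E.
Proof.
move=> alt.
have mt : measurable [set x : X | ball_type r (x : Gr) x x == t].
  have : @meas _ _ Gr (fun x => ball_type r x x x == t).
    by apply: meas_of_fin; exact: (nice_ball_type t [::] [::]).
  by [].
rewrite /graphing_freq /type_freq /= graphing_mean_indicator // fineK; last exact: fin_num_measure.
congr (mu _); apply/seteqP; split=> x /=; first by move/alt => ->.
by move=> /eqP xt; apply/alt.
Qed.

(** Convergence is given for rooted graphs. A type realised in some [G n] or in the graphing comes
    from one, and a type realised nowhere has frequency constantly zero. *)
Lemma type_freq_cvg r (t : {set code d r}) : (0 < r)%N ->
  (fun n => type_freq (Gn n) t) @ \oo --> type_freq Gr t.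
Proof.
move=> r0.
have main (al : rooted_graph d r) :
    (forall (B : mgraph R d) (x : B), ball_iso (@medge R d B) al x <-> ball_type r x x x = t) ->
    (fun n => type_freq (Gn n) t) @ \oo --> type_freq Gr t.
  move=> alt; have := @lim r r0 al; rewrite (graphing_freq_type (alt Gr)) => /fine_cvg.
  by under eq_fun do rewrite /= (ball_freq_type (alt _)).
have [[n [x0 xt]]|Hn] := pselect (exists n, exists x0 : Gn n, ball_type r x0 x0 x0 = t).
  by apply: (main (ball_rooted_graph r x0)) => B x; rewrite -xt; exact: ball_iso_type.
have [[x0 xt]|Hx] := pselect (exists x0 : Gr, ball_type r x0 x0 x0 = t).
  by apply: (main (ball_rooted_graph r x0)) => B x; rewrite -xt; exact: ball_iso_type.
have z (B : mgraph R d) : ~ (exists x0 : B, ball_type r x0 x0 x0 = t) -> type_freq B t = 0.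
  move=> H; rewrite /type_freq -[RHS](expect0 B); congr expect; apply/funext => x.
  by case: eqP => // xt; exfalso; apply: H; exists x.
rewrite (z Gr Hx); under eq_fun => n.
  rewrite z; first over.
  by case=> x0 xt; apply: Hn; exists n, x0.
exact: cvg_cst.
Qed.

Lemma eventually_fin (T : finType) (P : T -> nat -> Prop) :
  (forall t, exists n0, forall n, (n0 <= n)%N -> P t n) ->
  exists n0, forall n, (n0 <= n)%N -> forall t, P t n.
Proof.
move=> /choice[N HN]; exists (\max_t N t)%N => n nN t; apply: HN.
by apply: leq_trans nN; exact: leq_bigmax.
Qed.

Lemma type_freq_close rmax (del : R) : 0 < del -> exists n0, forall n, (n0 <= n)%N ->
  forall r, (0 < r <= rmax)%N -> forall t : {set code d r},
    `|type_freq (Gn n) t - type_freq Gr t| <= del.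
Proof.
move=> del0.
have [|n0 Hn0] := @eventually_fin 'I_rmax.+1 (fun r n => (0 < r)%N ->
    forall t : {set code d r}, `|type_freq (Gn n) t - type_freq Gr t| <= del).
  move=> r; have [r0|r0] := posnP r; first by exists 0%N => n _; rewrite r0.
  have [|n0 Hn0] := @eventually_fin {set code d r} (fun t n =>
      `|type_freq (Gn n) t - type_freq Gr t| <= del).
    move=> t; have /cvgrPdist_le/(_ _ del0)[n0 _ Hn0] := @type_freq_cvg r t r0.
    by exists n0 => n nn; rewrite distrC; exact: Hn0.
  by exists n0 => n nn _; exact: Hn0.
exists n0 => n nn r /andP[r0 rm]; have rm' : (r < rmax.+1)%N by [].
exact: (Hn0 n nn (Ordinal rm') r0).
Qed.

Lemma hyperfin_bdgraph (H : bdgraph d) (Z : {set H}) K :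
  (forall x : H, (#|connect (isolate (@adj d H) (mem Z)) x| <= K)%N) <->
  hyperfin (@medge R d (bdgraph_mgraph R H)) (mem Z) K.
Proof.
split=> [HK x s us sx|HK x].
  apply: leq_trans (HK x); rewrite -(card_uniqP us); apply: subset_leq_card.
  by apply/fintype.subsetP => y /sx[p px yp]; apply/connectP; exists p.
rewrite cardE; apply: (HK x); first exact: enum_uniq.
by move=> y; rewrite mem_enum => /connectP[p px yp]; exists p.
Qed.

Lemma hyperfin_graphing (Z : set X) K :
  (forall x, (gcomponent (isolate (edge_rel E) (mem Z)) x #<= `I_K)%card) <->
  hyperfin (@medge R d Gr) (mem Z) K.
Proof.
split=> [HK x s us sx|HK x]; first by have /card_le_IP := HK x; apply.
by apply/card_le_IP => s us sx; exact: (HK x).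
Qed.

Lemma expect_bdgraph (H : bdgraph d) (Z : {set H}) :
  expect (fun x : bdgraph_mgraph R H => ((mem Z : pred _) x)%:R) = #|Z|%:R / #|H|%:R.
Proof. by rewrite /= card_set_sum natr_sum. Qed.

Lemma expect_graphing (Z : set X) : measurable Z ->
  (expect (fun x : Gr => ((mem Z : pred _) x)%:R))%:E = mu Z.
Proof.
move=> mZ; have EZ : [set x | (mem Z : pred X) x] = Z by apply/seteqP; split=> x /=; rewrite inE.
by rewrite /= graphing_mean_indicator EZ // fineK //; exact: fin_num_measure.
Qed.

End Frequencies.

Theorem theorem1 (R : realType) (d : nat) (hd : (1 <= d)%N)
    (G : nat -> bdgraph d)
    (disp : measure_display) (X : measurableType disp)
    (mu : probability X R) (E : set (X * X)) :
  convergent_graph_seq R G ->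
  is_graphing d mu E ->
  graphing_limit G mu E ->
  hyperfinite_family R G <-> hyperfinite_graphing mu E.
Proof.
move=> _ gE lim; pose C : R := 4 * d%:R + 5.
have C0 : 0 < C by rewrite ltr_wpDl // mulr_ge0.
have card0 n : 0 < #|G n|%:R :> R by rewrite ltr0n; exact: vertex_gt0.
split=> H eps e0; have e1 : 0 < eps / C by rewrite divr_gt0.
- have [K K0 HK] := H _ e1.
  have [rmax [del [del0 tr]]] := hyperfinite_transfer d K e1.
  (* A single sufficiently late graph of the sequence suffices for the transfer to the graphing. *)
  have [n0 Hn0] := type_freq_close gE lim rmax del0.
  have [Z [Zc ZK]] := HK n0.
  have [||Z' [mZ' Z'e Z'K]] := tr (bdgraph_mgraph R (G n0)) (graphing_mgraph gE).
  + exists (mem Z); split=> //; last exact/hyperfin_bdgraph.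
    by rewrite expect_bdgraph ltr_pdivrMr.
  + exact: (Hn0 n0 (leqnn _)).
  exists (d.+1 ^ K)%N; first by rewrite expn_gt0.
  have EZ : (mem [set x : X | Z' x] : pred X) = Z' by apply/funext => x; apply/idP/idP; rewrite inE.
  exists [set x | Z' x]; split=> //.
    rewrite -(expect_graphing gE) // EZ lte_fin (lt_le_trans Z'e) //.
    by rewrite -/C mulrC divfK // gt_eqF.
  by apply/(hyperfin_graphing gE); rewrite EZ.
- have [K K0 [Z [mZ Ze ZK]]] := H _ e1.
  have [rmax [del [del0 tr]]] := hyperfinite_transfer d K e1.
  have [n0 Hn0] := type_freq_close gE lim rmax del0.
  (* The finitely many graphs before [n0] are left whole, with empty [Z], so their sizes enter the
     bound. *)
  pose K' := maxn (d.+1 ^ K) (\max_(n < n0) #|G n|).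
  exists K'; first by rewrite /K' leq_max expn_gt0.
  move=> n; case: (ltnP n n0) => nn.
    exists finset.set0; split; first by rewrite cards0 mulr_gt0.
    move=> x; apply: leq_trans (max_card _) _; apply: leq_trans (leq_maxr _ _).
    exact: (leq_bigmax (Ordinal nn)).
  have [||Z' [_ Z'e Z'K]] := tr (graphing_mgraph gE) (bdgraph_mgraph R (G n)).
  + exists (mem Z); split; last exact/hyperfin_graphing.
      rewrite /= (_ : [set x | _] = Z) //; by apply/seteqP; split=> x /=; rewrite inE.
    by rewrite -lte_fin expect_graphing.
  + by move=> r rr t; rewrite distrC; exact: Hn0.
  have EZ : (mem (finset Z') : pred (G n)) = Z' by apply/funext => x; rewrite /= inE.
  exists (finset Z'); split.
    rewrite -ltr_pdivrMr // -(expect_bdgraph R) EZ (lt_le_trans Z'e) //.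
    by rewrite -/C mulrC divfK // gt_eqF.
  apply/(hyperfin_bdgraph R); rewrite EZ => x s us sx.
  by apply: leq_trans (leq_maxl _ _); exact: Z'K us sx.
Qed.
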